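(* Let $q,\tilde q\in L^1(0,T)$ be complex-valued, and let the linear forms $U_1,U_2$ be fixed (the same for $q$ and $\tilde q$), with $H_1\neq 0$. Let $\omega,\Lambda_1,\Xi,M$ be the objects associated with $q$ and let $\tilde\omega,\tilde M$ be the corresponding objects associated with $\tilde q$, where $\omega\not\equiv0$ and $\tilde\omega\not\equiv 0$. Suppose that $\Lambda_1\cap\Xi=\emptyset$. If $M(\lambda)=\tilde M(\lambda)$ and $\omega(\lambda)=\tilde\omega(\lambda)$ (as meromorphic, respectively entire, functions of $\lambda$), then $q(x)=\tilde q(x)$ for almost every $x\in(0,T)$.
   Context: Let $T>0$. For a complex-valued $q\in L^1(0,T)$ consider the equation $$-y''+q(x)y=\lambda y,\quad x\in(0,T),\qquad (\ast)$$ with complex spectral parameter $\lambda$. For $j=1,2$ let $\sigma_j$ be a complex-valued function of bounded variation on $[0,T]$, continuous from the right for $t>0$, and set $$U_j(y)=\int_0^T y(t)\,d\sigma_j(t),\qquad H_j:=\sigma_j(+0)-\sigma_j(0).$$ Equivalently, $U_j(y)=H_jy(0)+\int_0^T y(t)\,d\sigma_{j0}(t)$, where $\sigma_{j0}$ is of bounded variation and continuous from the right for all $t\ge 0$ (so $d\sigma_{j0}$ has no mass at $0$). It is assumed that $H_1\ne0$. The functions $\sigma_j$ are known a priori and do not depend on the potential. Put $V_1(y)=y(T)$. Let $X_1(x,\lambda),X_2(x,\lambda)$ be the solutions of $(\ast)$ with $X_1(0,\lambda)=X_2'(0,\lambda)=1$, $X_1'(0,\lambda)=X_2(0,\lambda)=0$.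 Define the entire functions $$\omega(\lambda)=U_1(X_1)U_2(X_2)-U_1(X_2)U_2(X_1),\qquad \Delta_1(\lambda)=U_1(X_1)V_1(X_2)-U_1(X_2)V_1(X_1).$$ $\Xi$ is the set of zeros of $\omega$ (the eigenvalues of $(\ast)$ with $U_1(y)=U_2(y)=0$), and $\Lambda_1$ is the set of zeros of $\Delta_1$ (the eigenvalues of $(\ast)$ with $U_1(y)=V_1(y)=0$). Let $\Phi(x,\lambda)$ be the solution of $(\ast)$ with $U_1(\Phi)=1$, $V_1(\Phi)=0$ (it exists and is unique when $\Delta_1(\lambda)\ne0$). The Weyl-type function is $M(\lambda):=U_2(\Phi(\cdot,\lambda))$, a meromorphic function of $\lambda$. A tilde denotes the analogous object with $q$ replaced by $\tilde q$ (and the same $\sigma_1,\sigma_2$). *)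

(* Defs.v *)
From mathcomp Require Import all_boot all_order all_algebra.
From mathcomp Require Import all_classical all_reals all_analysis.
From mathcomp Require Import complex.

Set Implicit Arguments.
Unset Strict Implicit.
Unset Printing Implicit Defensive.

Import Order.TTheory GRing.Theory Num.Theory.
Import numFieldNormedType.Exports.

Local Open Scope classical_set_scope.
Local Open Scope complex_scope.
Local Open Scope ring_scope.

Section ComplexValued.
Variable R : realType.
Local Notation mu := (@lebesgue_measure R).
Implicit Types (a b x : R) (D : set R) (f g y s : R -> R[i]).

Definition cintegrable D f :=
  mu.-integrable D (EFin \o (@complex.Re R \o f)) /\
  mu.-integrable D (EFin \o (@complex.Im R \o f)).

Definition cintegral D f : R[i] :=
  (\int[mu]_(t in D) complex.Re (f t)) +i* (\int[mu]_(t in D) complex.Im (f t)).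

(* f is absolutely continuous on [0, T], with almost everywhere derivative g;
   when g is continuous, f' = g at every point of [0, T] (one-sided at 0, T) *)
Definition ac_with_deriv (T : R) f g :=
  cintegrable `[0, T] g /\
  forall x, x \in `[0, T] -> f x = f 0 + cintegral `[0, x] g.

Definition cbounded_variation a b s :=
  bounded_variation a b (@complex.Re R \o s) /\
  bounded_variation a b (@complex.Im R \o s).

Definition right_continuous_at s x :=
  (complex.Re (s t) @[t --> x^'+] --> complex.Re (s x)) /\
  (complex.Im (s t) @[t --> x^'+] --> complex.Im (s x)).

Definition right_lim s x : R[i] :=
  lim (complex.Re (s t) @[t --> x^'+]) +i* lim (complex.Im (s t) @[t --> x^'+]).

(* p lists the nodes after a (as in itv_partition) and tau n is the tag in the
   n-th subinterval *)
Definition rs_sum a b y s (p : seq R) (tau : nat -> R) : R[i] :=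
  let node := nth b (a :: p) in
  \sum_(0 <= n < size p) y (tau n) * (s (node n.+1) - s (node n)).

Definition tagged_partition a b (delta : R) (p : seq R) (tau : nat -> R) :=
  itv_partition a b p /\
  let node := nth b (a :: p) in
  forall n, (n < size p)%N ->
    node n <= tau n <= node n.+1 /\ node n.+1 - node n < delta.

Definition is_rs_integral a b y s (I : R[i]) :=
  forall eps : R, 0 < eps -> exists2 delta : R, 0 < delta &
    forall p tau, tagged_partition a b delta p tau ->
      `|rs_sum a b y s p tau - I| < eps%:C.

(* the Riemann-Stieltjes integral of y with respect to s over [a, b], endpoint
   jumps of s included *)
Definition rs_integral a b y s : R[i] := xget 0 [set I | is_rs_integral a b y s I].

End ComplexValued.

Section SturmLiouville.
Variables (R : realType) (T : R).
Implicit Types (q s y dy : R -> R[i]) (l : R[i]).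

(* dy is y'; both y and y' are absolutely continuous on [0, T] *)
Definition sl_solution q l y dy :=
  ac_with_deriv T y dy /\
  exists2 d2y : R -> R[i], ac_with_deriv T dy d2y &
    {ae @lebesgue_measure R, forall x, x \in `]0, T[ ->
       - d2y x + q x * y x = l * y x}.

(* Functions are chosen on the whole of R, but only their values on [0, T],
   where they are uniquely determined, are ever used. *)
Definition cauchy_solution q l (y0 dy0 : R[i]) : R -> R[i] :=
  xget (fun=> 0) [set y | exists dy, [/\ sl_solution q l y dy, y 0 = y0 & dy 0 = dy0]].

Definition X1 q l := cauchy_solution q l 1 0.
Definition X2 q l := cauchy_solution q l 0 1.

(* right-continuity at t = T is void, T being the right end of the domain *)
Definition admissible s :=
  cbounded_variation 0 T s /\
  forall t, t \in `]0, T[ -> right_continuous_at s t.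

Definition jump0 s : R[i] := right_lim s 0 - s 0.

Definition U s y : R[i] := rs_integral 0 T y s.
Definition V1 y : R[i] := y T.

Definition omega (s1 s2 : R -> R[i]) q l : R[i] :=
  U s1 (X1 q l) * U s2 (X2 q l) - U s1 (X2 q l) * U s2 (X1 q l).

Definition Delta1 (s1 : R -> R[i]) q l : R[i] :=
  U s1 (X1 q l) * V1 (X2 q l) - U s1 (X2 q l) * V1 (X1 q l).

Definition Xi (s1 s2 : R -> R[i]) q : set R[i] := [set l | omega s1 s2 q l = 0].
Definition Lambda1 (s1 : R -> R[i]) q : set R[i] := [set l | Delta1 s1 q l = 0].

Definition Phi (s1 : R -> R[i]) q l : R -> R[i] :=
  xget (fun=> 0)
    [set y | [/\ exists dy, sl_solution q l y dy, U s1 y = 1 & V1 y = 0]].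

(* meaningful off Lambda1 s1 q only *)
Definition weylM (s1 s2 : R -> R[i]) q l : R[i] := U s2 (Phi s1 q l).

(* Equality as meromorphic functions: the exceptional set is discrete, since
   Delta1 is entire and does not vanish identically when jump0 s1 != 0. *)
Definition eq_weylM (s1 s2 q qt : R -> R[i]) :=
  forall l, ~ Lambda1 s1 q l -> ~ Lambda1 s1 qt l ->
    weylM s1 s2 q l = weylM s1 s2 qt l.

End SturmLiouville.

(* Main.v *)
Require Import Defs.
From mathcomp Require Import all_boot all_order all_algebra.
From mathcomp Require Import all_classical all_reals all_analysis.
From mathcomp Require Import complex ring lra zify cyclic separable cyclotomic measurable_realfun.

Set Implicit Arguments.
Unset Strict Implicit.
Unset Printing Implicit Defensive.

Import Order.TTheory GRing.Theory Num.Theory.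
Import numFieldNormedType.Exports.

Local Open Scope classical_set_scope.
Local Open Scope complex_scope.
Local Open Scope ring_scope.

(** Let X_1, X_2 be the solutions of the statement, let psi be the solution
    with psi(T) = 0 and psi'(T) = -1, and put
      phi_j = U_j(X_1) X_2 - U_j(X_2) X_1,     Delta_j = U_j(psi),
    so that U_j(phi_j) = 0. Then M = Delta_2 / Delta_1, and
      omega psi = Delta_2 phi_1 - Delta_1 phi_2                        (E)
    is an identity between 2 x 2 determinants. Write p, f_j for psi, phi_j
    built from the second potential, and l = - k^2, u = Re k >= 0.

    The pair (Delta_1, Delta_2) is determined by M. A common zero of Delta_1
    and Delta_2 would be a zero of omega by [no_common_zero], hence a point of
    Lambda_1 and Xi. So the equality of the functions M makes the two pairs of
    characteristic functions proportional, with a factor g that has no poles: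
    at a zero of the first Delta_1 it is a quotient of the functions Delta_2.
    All these functions have order 1/2, and since H_1 <> 0, Delta_1 is
    asymptotic to H_1 exp(kT) / (2k) when l goes to infinity outside the
    sector |Im l| < Re l ([form_leading]). There g is bounded and tends to 1;
    by Phragmen-Lindelof and Liouville ([quotient_constant]) g = 1, which is
    [char_fun_eq].

    The cross function vanishes step by step. Let F(x) = psi f_1 - p phi_1.
    Since omega, Delta_1 and Delta_2 agree for the two potentials, (E) gives
      omega F = Delta_1 (f_2 phi_1 - phi_2 f_1),
    and omega <> 0 at the zeros of Delta_1, so F / Delta_1 has no poles. For
    fixed x, F(x) = U_1(L) where L(t) is built from the solutions that vanish
    at x. Suppose that the potentials agree on (a, T) and a/2 <= x <= a. Then L
    vanishes at T, is O(exp(uT) / |k|^2) at 0, and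
      |L'(t)| <= C exp(uT) / |k| (exp(-u t) + exp(-u |t - a|)),
    so that F = O(exp(uT) / |k|^2) and F / Delta_1 = O(1/|k|) outside the
    sector. Again by [quotient_constant] F / Delta_1 is constant, hence zero
    ([cross_zero]).

    The potentials agree on (a/2, a). Differentiating F = 0 and using that the
    Wronskian of phi_1 and psi is - Delta_1 for both potentials yields
    psi^2 = p^2; the common leading term of psi and p fixes the sign. As psi = p
    on the interval, the two equations give (q - q~) psi = 0, and psi has no
    zero there for large real k ([potential_eq_of_cross]). Halving a repeatedly
    from a = T exhausts (0, T).

    The complex analysis rests on two encodings. Entire functions are the
    locally uniform limits of polynomials, for which the maximum principle
    follows from averages over roots of unity. Meromorphic functions without
    poles are local quotients of entire functions ([qentire]); this is the form
    in which g and F / Delta_1 arise. The quotient of two functions of order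
    1/2, if it has no poles, is again of order 1/2: instead of a Hadamard
    product, [quotient_bound] reflects zeros in a circle and applies Harnack's
    inequality to the logarithm of a zero-free polynomial. *)

(** * Modulus of complex numbers *)

Section Modulus.
Variable R : realType.
Implicit Types (z w : R[i]) (r x : R).

Definition cmod z : R := Normc.normc z.

Lemma cmod_norm z : `|z| = (cmod z)%:C. Proof. by []. Qed.

Lemma cmodE z : cmod z = Num.sqrt (complex.Re z ^+ 2 + complex.Im z ^+ 2).
Proof. by case: z. Qed.

Lemma cmod_ge0 z : 0 <= cmod z. Proof. by rewrite cmodE sqrtr_ge0. Qed.

Lemma cmod_sqr z : cmod z ^+ 2 = complex.Re z ^+ 2 + complex.Im z ^+ 2.
Proof. by rewrite cmodE sqr_sqrtr // addr_ge0 // sqr_ge0. Qed.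

Lemma cmod0 : cmod 0 = 0. Proof. exact: Normc.normc0. Qed.
Lemma cmod1 : cmod 1 = 1. Proof. exact: Normc.normc1. Qed.
Lemma cmodN z : cmod (- z) = cmod z. Proof. exact: normcN. Qed.
Lemma cmodM z w : cmod (z * w) = cmod z * cmod w. Proof. exact: Normc.normcM. Qed.
Lemma cmodV z : cmod z^-1 = (cmod z)^-1. Proof. exact: Normc.normcV. Qed.
Lemma cmodD z w : cmod (z + w) <= cmod z + cmod w. Proof. exact: le_normcD. Qed.
Lemma cmodB z w : cmod (z - w) = cmod (w - z). Proof. by rewrite -cmodN opprB. Qed.
Lemma cmod_eq0 z : (cmod z == 0) = (z == 0).
Proof. by apply/eqP/eqP => [/Normc.eq0_normc|->] //; exact: cmod0. Qed.
Lemma cmod_gt0 z : (0 < cmod z) = (z != 0).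
Proof. by rewrite lt_def cmod_ge0 andbT cmod_eq0. Qed.
Lemma cmodX z n : cmod (z ^+ n) = cmod z ^+ n.
Proof. by elim: n => [|n IH]; rewrite ?expr0 ?cmod1 // !exprS cmodM IH. Qed.
Lemma cmodR x : cmod x%:C = `|x|.
Proof. by rewrite cmodE /= expr0n /= addr0 sqrtr_sqr. Qed.
Lemma cmod_nat n : cmod n%:R = n%:R.
Proof.
have -> : (n%:R : R[i]) = (n%:R)%:C by rewrite rmorph_nat.
by rewrite cmodR ger0_norm.
Qed.
Lemma cmodDB z w : cmod z - cmod w <= cmod (z - w).
Proof. by rewrite lerBlDr (le_trans _ (cmodD _ _)) // subrK. Qed.
Lemma cmodDBn z w : cmod z - cmod w <= cmod (z + w).
Proof. by have := cmodDB z (- w); rewrite cmodN opprK. Qed.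
Lemma cmodDl z w : cmod (z - w) <= cmod z + cmod w.
Proof. by rewrite -(cmodN w) cmodD. Qed.
Lemma le_cmod_dist z w v : cmod (z - v) <= cmod (z - w) + cmod (w - v).
Proof. by rewrite (le_trans _ (cmodD _ _)) // addrA subrK. Qed.
Lemma Re_le_cmod z : `|complex.Re z| <= cmod z.
Proof.
rewrite -(@ler_pXn2r _ 2) ?nnegrE ?cmod_ge0 //.
by rewrite real_normK ?num_real // cmod_sqr lerDl sqr_ge0.
Qed.
Lemma Im_le_cmod z : `|complex.Im z| <= cmod z.
Proof.
rewrite -(@ler_pXn2r _ 2) ?nnegrE ?cmod_ge0 //.
by rewrite real_normK ?num_real // cmod_sqr lerDr sqr_ge0.
Qed.
Lemma cmod_le_ReIm z : cmod z <= `|complex.Re z| + `|complex.Im z|.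
Proof.
rewrite -(@ler_pXn2r _ 2) ?nnegrE ?cmod_ge0 ?addr_ge0 //.
rewrite cmod_sqr sqrrD !real_normK ?num_real // addrAC lerDl.
by rewrite mulrn_wge0 // mulr_ge0.
Qed.
Lemma cmod_sum I (s : seq I) (P : pred I) (F : I -> R[i]) :
  cmod (\sum_(i <- s | P i) F i) <= \sum_(i <- s | P i) cmod (F i).
Proof.
elim/big_ind2: _ => [|x y z w h1 h2|] //; first by rewrite cmod0.
by rewrite (le_trans (cmodD _ _)) // lerD.
Qed.
Lemma cmod_prod I (s : seq I) (P : pred I) (F : I -> R[i]) :
  cmod (\prod_(i <- s | P i) F i) = \prod_(i <- s | P i) cmod (F i).
Proof.
by elim/big_ind2: _ => [|x y z w h1 h2|] //; rewrite ?cmod1 // cmodM h1 h2.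
Qed.
Lemma cmod_conj z : cmod z^*%C = cmod z.
Proof. by case: z => a b; rewrite !cmodE /= sqrrN. Qed.
Lemma mul_conj z : z * z^*%C = (cmod z ^+ 2)%:C.
Proof.
rewrite cmod_sqr; case: z => a b /=; rewrite -!/(_ * _).
by apply/eqP; rewrite eq_complex /=; apply/andP; split; apply/eqP; ring.
Qed.
Lemma cReM z w : complex.Re (z * w) =
  complex.Re z * complex.Re w - complex.Im z * complex.Im w.
Proof. by case: z => a b; case: w. Qed.
Lemma cImM z w : complex.Im (z * w) =
  complex.Re z * complex.Im w + complex.Im z * complex.Re w.
Proof. by case: z => a b; case: w => c d /=; rewrite addrC (mulrC b). Qed.
Lemma cReD z w : complex.Re (z + w) = complex.Re z + complex.Re w.
Proof. by case: z => a b; case: w. Qed.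
Lemma cImD z w : complex.Im (z + w) = complex.Im z + complex.Im w.
Proof. by case: z => a b; case: w. Qed.
Lemma cReN z : complex.Re (- z) = - complex.Re z. Proof. by case: z. Qed.
Lemma cImN z : complex.Im (- z) = - complex.Im z. Proof. by case: z. Qed.
Lemma cReB z w : complex.Re (z - w) = complex.Re z - complex.Re w.
Proof. by rewrite cReD cReN. Qed.
Lemma cImB z w : complex.Im (z - w) = complex.Im z - complex.Im w.
Proof. by rewrite cImD cImN. Qed.
Lemma complex_eq z w : complex.Re z = complex.Re w -> complex.Im z = complex.Im w -> z = w.
Proof. by case: z => a b; case: w => c d /= -> ->. Qed.
Lemma cReZ x z : complex.Re (x%:C * z) = x * complex.Re z.
Proof. by rewrite cReM /= mul0r subr0. Qed.
Lemma cImZ x z : complex.Im (x%:C * z) = x * complex.Im z.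
Proof. by rewrite cImM /= mul0r addr0. Qed.
End Modulus.

(** * Averages over roots of unity and the maximum principle for polynomials *)

Section UnityRoots.
Variable R : realType.

(** X^n - 1 is separable and splits, so it has n distinct roots, which form a
    cyclic group. *)
Lemma prim_root_exists n : (0 < n)%N -> exists z : R[i], n.-primitive_root z.
Proof.
pose p : {poly R[i]} := 'X^n - 1; have [r Dp] := closed_field_poly_normal p.
move=> n_gt0; rewrite (monicP _) ?monicXnsubC // scale1r in Dp.
have rn1: all n.-unity_root r by apply/allP=> z; rewrite -root_prod_XsubC -Dp.
have sz_r: (n < (size r).+1)%N.
  by rewrite -(size_prod_XsubC r id) -Dp size_XnsubC.
have [|z] := hasP (has_prim_root n_gt0 rn1 _ sz_r); last by exists z.
by rewrite -separable_prod_XsubC -Dp separable_Xn_sub_1 // pnatr_eq0 -lt0n.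
Qed.

Lemma cmod_prim_root n (w : R[i]) : n.-primitive_root w -> cmod w = 1.
Proof.
move=> pw; have /eqP := congr1 (@cmod R) (prim_expr_order pw).
rewrite cmodX cmod1; case: n pw => [|n] pw; first by have := prim_order_gt0 pw.
by rewrite pexpr_eq1 ?cmod_ge0 // => /eqP.
Qed.

Lemma sum_unity_roots n (w : R[i]) k : n.-primitive_root w -> ~~ (n %| k)%N ->
  \sum_(j < n) (w ^+ j) ^+ k = 0.
Proof.
move=> pw nk.
have wk1 : w ^+ k - 1 != 0 by rewrite subr_eq0 -(prim_order_dvd pw).
apply: (mulfI wk1); rewrite mulr0.
have -> : \sum_(j < n) (w ^+ j) ^+ k = \sum_(j < n) (w ^+ k) ^+ j.
  by apply: eq_bigr => j _; rewrite -!exprM mulnC.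
by rewrite -subrX1 -exprM mulnC exprM (prim_expr_order pw) expr1n subrr.
Qed.

(** Orthogonality of the characters of Z/n: once n exceeds the degree, the
    average over the n-th roots of unity is an exact discrete Cauchy formula. *)
Lemma poly_coef_average n (w : R[i]) (p : {poly R[i]}) k r :
  n.-primitive_root w -> (size p <= n)%N -> (k < n)%N ->
  \sum_(j < n) (w ^+ j) ^+ (n - k) * p.[r * w ^+ j] = n%:R * (p`_k * r ^+ k).
Proof.
move=> pw sp kn.
have E j : p.[r * w ^+ j] = \sum_(i < n) p`_i * r ^+ i * (w ^+ j) ^+ i.
  by rewrite (horner_coef_wide _ sp); apply: eq_bigr => i _; rewrite exprMn mulrA.
under eq_bigr do rewrite E mulr_sumr.
rewrite exchange_big /= (bigD1 (Ordinal kn)) //= [X in _ + X]big1 ?addr0.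
  transitivity (\sum_(j < n) p`_k * r ^+ k).
    apply: eq_bigr => j _; rewrite mulrCA -exprD subnK ?(ltnW kn) //.
    by rewrite -exprM mulnC exprM (prim_expr_order pw) expr1n mulr1.
  by rewrite sumr_const card_ord mulr_natl.
move=> i ik; under eq_bigr do rewrite mulrCA -exprD.
rewrite -mulr_sumr (sum_unity_roots pw) ?mulr0 //.
apply/negP; have ik' : (i != k :> nat) by [].
have il := ltn_ord i.
have [lki|lik|eik] := ltngtP k i; last by rewrite eik eqxx in ik'.
  have -> : (n - k + i = n + (i - k))%N by lia.
  by rewrite dvdn_addr // => /dvdn_leq; lia.
by move=> /dvdn_leq; lia.
Qed.

Lemma poly_coef_bound (p : {poly R[i]}) (r M : R) k : 0 <= r ->
  (forall z, cmod z = r -> cmod p.[z] <= M) -> cmod p`_k * r ^+ k <= M.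
Proof.
move=> r0 pM.
set n := (maxn (size p) k).+1.
have [w pw] := prim_root_exists (ltn0Sn (maxn (size p) k)).
have := congr1 (@cmod R) (@poly_coef_average n w p k r%:C pw _ _).
rewrite leqW ?leq_maxl // ltnS leq_maxr => /(_ isT isT) /esym.
rewrite cmodM cmod_nat cmodM cmodX cmodR ger0_norm // => E.
rewrite -(@ler_pM2l _ n%:R) ?ltr0n // E.
apply: le_trans (cmod_sum _ _ _) _.
have -> : n%:R * M = \sum_(j < n) M by rewrite sumr_const card_ord mulr_natl.
apply: ler_sum => j _; rewrite cmodM cmodX cmodX (cmod_prim_root pw) !expr1n mul1r.
by apply: pM; rewrite cmodM cmodR cmodX (cmod_prim_root pw) expr1n mulr1 ger0_norm.
Qed.

(** Summing the coefficient bounds loses a factor that is linear in the degree.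
    Applied to p^m this gives |p(z)|^m <= (m size p + 1) M^m, and the factor
    disappears under m-th roots. *)
Lemma poly_maxmod (p : {poly R[i]}) (r M : R) z : 0 <= r ->
  (forall z, cmod z = r -> cmod p.[z] <= M) -> cmod z <= r -> cmod p.[z] <= M.
Proof.
move=> r0 pM zr.
have M0 : 0 <= M.
  apply: le_trans (cmod_ge0 _) (pM r%:C _); by rewrite cmodR ger0_norm.
have key m : cmod p.[z] ^+ m <= (m * size p).+1%:R * M ^+ m.
  rewrite -cmodX -horner_exp.
  rewrite (@horner_coef_wide _ (m * size p).+1); last first.
    by apply: leq_trans (size_exp_leq _ _) _; rewrite ltnS mulnC leq_mul // leq_pred.
  apply: le_trans (cmod_sum _ _ _) _.
  have -> : (m * size p).+1%:R * M ^+ m = \sum_(j < (m * size p).+1) M ^+ m.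
    by rewrite sumr_const card_ord mulr_natl.
  apply: ler_sum => j _; rewrite cmodM cmodX.
  apply: (@le_trans _ _ (cmod (p ^+ m)`_j * r ^+ j)).
    by rewrite ler_wpM2l ?cmod_ge0 // lerXn2r // nnegrE cmod_ge0.
  apply: poly_coef_bound => // u ur.
  by rewrite horner_exp cmodX lerXn2r ?nnegrE ?cmod_ge0 // pM.
rewrite leNgt; apply/negP => Mlt.
have p0 : 0 < cmod p.[z] by apply: le_lt_trans Mlt.
have p0' := lt0r_neq0 p0.
have [M00|Mn0] := eqVneq M 0.
  by have := key 1%N; rewrite M00 !expr1 mulr0 leNgt p0.
have Mp : 0 < M by rewrite lt_def Mn0.
set h := cmod p.[z] / M - 1.
have h0 : 0 < h by rewrite subr_gt0 ltr_pdivlMr // mul1r.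
have k2 m : (1 + h) ^+ m <= (m * size p).+1%:R.
  by rewrite /h addrC subrK expr_div_n ler_pdivrMr ?exprn_gt0.
(* Bernoulli's inequality, squared, exceeds the linear bound for large m *)
clearbody h; have bern m : 1 + m%:R * h <= (1 + h) ^+ m.
  elim: m => [|m IH]; first by rewrite mul0r addr0 expr0.
  rewrite exprS (@le_trans _ _ ((1 + h) * (1 + m%:R * h))) ?ler_wpM2l ?addr_ge0 ?(ltW h0) //.
  have := mulr_ge0 (ler0n R m) (sqr_ge0 h); rewrite -natr1; nra.
set s := (size p)%:R : R.
have s0 : 0 <= s by rewrite ler0n.
pose m1 := Num.bound (2 * s / h ^+ 2).
have hm : 2 * s / h ^+ 2 < m1%:R.
  apply: archi_boundP; rewrite divr_ge0 ?exprn_ge0 ?(ltW h0) //; lra.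
have := k2 (2 * m1)%N; rewrite mulnC exprM.
have : (1 + m1%:R * h) ^+ 2 <= ((1 + h) ^+ m1) ^+ 2.
  have b0 : 0 <= 1 + m1%:R * h by rewrite addr_ge0 // mulr_ge0 // ltW.
  by rewrite lerXn2r // ?nnegrE ?(le_trans b0).
move=> /le_trans H /H; rewrite -natr1 natrM natrM -/s.
move: hm; rewrite ltr_pdivrMr ?exprn_gt0 // => hm.
have m0 : (0 : R) <= m1%:R by [].
have : 0 < m1%:R :> R.
  by rewrite lt_def m0 andbT; apply: contraTneq hm => ->; rewrite mul0r -leNgt; lra.
move=> mp; have := mulr_gt0 mp h0; have : 0 < m1%:R * (m1%:R * h ^+ 2 - 2 * s).
  by rewrite mulr_gt0 // subr_gt0.
nra.
Qed.
End UnityRoots.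

(** * Entire functions as limits of polynomials *)

Section Entire.
Variable R : realType.
Local Notation C := R[i].
Implicit Types (f g h : C -> C) (p : {poly C}) (z w : C) (r e M : R).

Lemma ccauchy_lim (a : nat -> C) (b : nat -> R) : (forall n, 0 <= b n) ->
  (forall n m, (n <= m)%N -> cmod (a m - a n) <= b n) ->
  exists l : C, forall n, cmod (l - a n) <= 2 * b n.
Proof.
move=> b0 ab.
have key (u : nat -> R) : (forall n m, (n <= m)%N -> `|u m - u n| <= b n) ->
    exists l : R, forall n, `|l - u n| <= b n.
  move=> ub; pose S := [set x | exists n, x = u n - b n].
  have up m : ubound S (u m + b m).
    move=> _ [n ->]; have [nm|/ltnW mn] := leqP n m.
      by have := ub _ _ nm; rewrite ler_norml => /andP[]; have := b0 m; lra.
    by have := ub _ _ mn; rewrite ler_norml => /andP[]; have := b0 n; lra.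
  have S0 : S !=set0 by exists (u 0%N - b 0%N), 0%N.
  exists (sup S) => n; rewrite ler_norml; apply/andP; split.
    have : u n - b n <= sup S by apply: ub_le_sup; [exists (u n + b n)|exists n].
    lra.
  have : sup S <= u n + b n by apply: ge_sup.
  lra.
have [|x xP] := key (fun n => complex.Re (a n)).
  by move=> n m nm; rewrite -cReB (le_trans (Re_le_cmod _)) ?ab.
have [|y yP] := key (fun n => complex.Im (a n)).
  by move=> n m nm; rewrite -cImB (le_trans (Im_le_cmod _)) ?ab.
exists (x +i* y) => n; rewrite (le_trans (cmod_le_ReIm _)) // cReB cImB /=.
by have := lerD (xP n) (yP n); lra.
Qed.

Lemma half_pow_small e : 0 < e -> exists n, 2^-1 ^+ n < e.
Proof.
move=> e0; have ei : 0 <= e^-1 by rewrite invr_ge0 ltW.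
exists (Num.bound e^-1); have := archi_boundP ei; set n := Num.bound _ => en.
rewrite exprVn -[e]invrK ltf_pV2 ?posrE ?exprn_gt0 ?invr_gt0 //.
by rewrite (lt_le_trans en) // -natrX ler_nat ltnW // ltn_expl.
Qed.

(** These are exactly the holomorphic functions of the plane, in a form that
    yields the maximum principle and the division by a zero without complex
    derivatives or contour integrals. *)
Definition entire f := forall r e, 0 < e ->
  exists p, forall z, cmod z <= r -> cmod (f z - p.[z]) <= e.

Lemma entire_ext f g : f =1 g -> entire f -> entire g.
Proof. by move=> fg ef r e e0; have [p pP] := ef r e e0; exists p => z; rewrite -fg; exact: pP. Qed.

Lemma entire_horner p : entire (horner p).
Proof. by move=> r e e0; exists p => z _; rewrite subrr cmod0 ltW. Qed.

Lemma entire_cst (c : C) : entire (fun=> c).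
Proof. by apply: entire_ext (entire_horner c%:P) => z; rewrite hornerC. Qed.

Lemma entire_id : entire id.
Proof. by apply: entire_ext (entire_horner 'X) => z; rewrite hornerX. Qed.

Lemma poly_bounded p r : exists2 M, 0 <= M & forall z, cmod z <= r -> cmod p.[z] <= M.
Proof.
exists (\sum_(i < size p) cmod p`_i * `|r| ^+ i).
  by apply: sumr_ge0 => i _; rewrite mulr_ge0 ?cmod_ge0 // exprn_ge0.
move=> z zr; rewrite horner_coef (le_trans (cmod_sum _ _ _)) //.
apply: ler_sum => i _; rewrite cmodM cmodX ler_wpM2l ?cmod_ge0 //.
by rewrite lerXn2r ?nnegrE ?cmod_ge0 // (le_trans zr) // ler_norm.
Qed.

Lemma entire_bounded f r : entire f ->
  exists2 M, 0 <= M & forall z, cmod z <= r -> cmod (f z) <= M.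
Proof.
move=> /(_ r 1 ltr01)[p pP]; have [M M0 MP] := poly_bounded p r.
exists (1 + M) => [|z zr]; first by rewrite addr_ge0.
rewrite -(subrK p.[z] (f z)) (le_trans (cmodD _ _)) // lerD ?pP ?MP //.
Qed.

Lemma entireD f g : entire f -> entire g -> entire (fun z => f z + g z).
Proof.
move=> ef eg r e e0; have e2 : 0 < e / 2 by rewrite divr_gt0.
have [p pP] := ef r _ e2; have [q qP] := eg r _ e2.
exists (p + q) => z zr; rewrite hornerD opprD addrACA (le_trans (cmodD _ _)) //.
by have := lerD (pP z zr) (qP z zr); lra.
Qed.

Lemma entireM f g : entire f -> entire g -> entire (fun z => f z * g z).
Proof.
move=> ef eg r e e0.
have [M M0 MP] := entire_bounded r ef; have [N N0 NP] := entire_bounded r eg.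
have d0 : 0 < e / 2 / (M + N + e + 1) by rewrite !divr_gt0 //; lra.
set d := e / 2 / (M + N + e + 1) in d0.
have dE : d * (M + N + e + 1) = e / 2 by rewrite /d divfK //; apply: lt0r_neq0; lra.
clearbody d.
have d1 : d <= 1 by rewrite leNgt; apply/negP => d1; nra.
have [p pP] := ef r _ d0; have [q qP] := eg r _ d0.
exists (p * q) => z zr; rewrite hornerM.
have -> : f z * g z - p.[z] * q.[z] = (f z - p.[z]) * g z + f z * (g z - q.[z])
  - (f z - p.[z]) * (g z - q.[z]) by ring.
apply: (le_trans (cmodDl _ _)); rewrite cmodM.
apply: (@le_trans _ _ ((d * N + M * d) + d * d)).
  rewrite lerD ?(ler_pM _ _ (pP z zr) (qP z zr)) ?cmod_ge0 //.
  by rewrite (le_trans (cmodD _ _)) // !cmodM lerD // ler_pM ?cmod_ge0 ?pP ?NP ?MP ?qP.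
nra.
Qed.

Lemma entireN f : entire f -> entire (fun z => - f z).
Proof. by move=> ef; apply: entire_ext (entireM (entire_cst (-1)) ef) => z; rewrite mulN1r. Qed.

Lemma entireB f g : entire f -> entire g -> entire (fun z => f z - g z).
Proof. by move=> ef eg; apply: entireD => //; apply: entireN. Qed.

Lemma entire_exp f n : entire f -> entire (fun z => f z ^+ n).
Proof.
move=> ef; elim: n => [|n IH]; first exact: entire_ext (entire_cst 1).
by apply: entire_ext (entireM ef IH) => z; rewrite exprS.
Qed.

Lemma entire_sum I (s : seq I) (F : I -> C -> C) : (forall i, entire (F i)) ->
  entire (fun z => \sum_(i <- s) F i z).
Proof.
move=> eF; elim: s => [|i s IH].
  by apply: entire_ext (entire_cst 0) => z; rewrite big_nil.
by apply: entire_ext (entireD (eF i) IH) => z; rewrite big_cons.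
Qed.

Lemma entire_comp_poly f p : entire f -> entire (fun z => f p.[z]).
Proof.
move=> ef r e e0; have [M M0 MP] := poly_bounded p r.
have [q qP] := ef M e e0; exists (q \Po p) => z zr.
by rewrite horner_comp qP ?MP.
Qed.

Lemma entire_shift f (a : C) : entire f -> entire (fun z => f (z + a)).
Proof.
by move=> ef; apply: entire_ext (entire_comp_poly ('X + a%:P) ef) => z; rewrite !hornerE.
Qed.

Lemma entire_lim f : (forall r e, 0 < e ->
   exists2 g, entire g & forall z, cmod z <= r -> cmod (f z - g z) <= e) -> entire f.
Proof.
move=> fg r e e0; have e2 : 0 < e / 2 by rewrite divr_gt0.
have [g eg gP] := fg r _ e2; have [p pP] := eg r _ e2; exists p => z zr.
apply: (le_trans (le_cmod_dist _ (g z) _)).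
by have := lerD (gP z zr) (pP z zr); lra.
Qed.

Lemma poly_cont p z e : 0 < e ->
  exists2 d : R, 0 < d & forall w, cmod (w - z) < d -> cmod (p.[w] - p.[z]) < e.
Proof.
move=> e0; have : root (p - p.[z]%:P) z by rewrite rootE !hornerE subrr.
move=> /factor_theorem[q qE]; have [M M0 MP] := poly_bounded q (cmod z + 1).
exists (Num.min 1 (e / (M + 1))).
  by rewrite lt_min ltr01 divr_gt0 //; lra.
move=> w; rewrite lt_min => /andP[w1 we].
have -> : p.[w] - p.[z] = (p - p.[z]%:P).[w] by rewrite !hornerE.
rewrite qE hornerM !hornerE cmodM.
have qM : cmod q.[w] <= M.
  apply: MP; have := cmodD (w - z) z; rewrite subrK; lra.
move: we; rewrite ltr_pdivlMr; last lra.
have := cmod_ge0 (w - z); nra.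
Qed.

Definition ccont f := forall z e, 0 < e ->
  exists2 d : R, 0 < d & forall w, cmod (w - z) < d -> cmod (f w - f z) < e.

Lemma entire_cont f : entire f -> ccont f.
Proof.
move=> ef z e e0; have e3 : 0 < e / 3 by rewrite divr_gt0.
have [p pP] := ef (cmod z + 1) _ e3; have [d d0 dP] := poly_cont p z e3.
exists (Num.min 1 d); first by rewrite lt_min ltr01.
move=> w; rewrite lt_min => /andP[w1 wd].
have wz : cmod w <= cmod z + 1 by have := cmodD (w - z) z; rewrite subrK; lra.
have := le_cmod_dist (f w) p.[w] (f z); have := le_cmod_dist p.[w] p.[z] (f z).
have := pP z; have := pP w wz; have := dP w wd; rewrite [cmod (f z - _)]cmodB.
have zz : cmod z <= cmod z + 1 by rewrite lerDl.
move=> + + /(_ zz); lra.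
Qed.

Lemma ccont_neq0 f z : ccont f -> f z != 0 ->
  exists2 d : R, 0 < d & forall w, cmod (w - z) < d -> cmod (f z) / 2 < cmod (f w).
Proof.
move=> cf fz; have e0 : 0 < cmod (f z) / 2 by rewrite divr_gt0 ?cmod_gt0.
have [d d0 dP] := cf z _ e0; exists d => // w /dP.
have := cmodDB (f z) (f w); rewrite cmodB; lra.
Qed.

Lemma entire_maxmod_disc f r M : 0 <= r -> entire f ->
  (forall z, cmod z = r -> cmod (f z) <= M) ->
  forall z, cmod z <= r -> cmod (f z) <= M.
Proof.
move=> r0 ef fM z zr; rewrite leNgt; apply/negP => Mf.
have e0 : 0 < (cmod (f z) - M) / 3 by rewrite divr_gt0 // subr_gt0.
have [p pP] := ef r _ e0.
have : cmod p.[z] <= M + (cmod (f z) - M) / 3.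
  apply: (poly_maxmod r0) => // w wr.
  have := fM w wr; have := pP w; rewrite wr lexx => /(_ isT).
  have := cmodDB p.[w] (f w); rewrite cmodB; lra.
have := pP z zr; have := cmodDB (f z) p.[z]; lra.
Qed.

(** Polynomial approximations of f, corrected so as to vanish at z0, are divided
    by z - z0. Two such quotients are close to each other on a circle whose
    points have distance at least 1 from z0, hence inside it; comparing d with a
    quotient that is accurate at the given z makes the error proportional to |z
    - z0|, which is what survives a division. *)
Lemma entire_div_approx f z0 r e : entire f -> f z0 = 0 -> 0 < e ->
  exists d : {poly C}, forall z, cmod z <= r ->
     cmod (f z - (z - z0) * d.[z]) <= e * cmod (z - z0).
Proof.
move=> ef f0 e0.
pose r1 := Num.max `|r| (cmod z0) + 1.
have r10 : 0 <= r1 by rewrite addr_ge0 // le_max normr_ge0.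
have z0r : cmod z0 <= r1 - 1 by rewrite /r1 addrK le_max lexx orbT.
have rr1 : r <= r1 - 1 by rewrite /r1 addrK le_max ler_norm.
have app e1 : 0 < e1 -> exists d : {poly C}, forall z, cmod z <= r1 ->
    cmod (f z - (z - z0) * d.[z]) <= e1.
  move=> e10; have e12 : 0 < e1 / 2 by rewrite divr_gt0.
  have [p pP] := ef r1 _ e12.
  have : root (p - p.[z0]%:P) z0 by rewrite rootE !hornerE subrr.
  move=> /factor_theorem[d dE]; exists d => z zr.
  have -> : (z - z0) * d.[z] = p.[z] - p.[z0].
    have := congr1 (fun q => q.[z]) dE; rewrite !hornerE => ->; by rewrite mulrC.
  have -> : f z - (p.[z] - p.[z0]) = (f z - p.[z]) - (f z0 - p.[z0]) by rewrite f0; ring.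
  apply: (le_trans (cmodDl _ _)).
  have z01 : cmod z0 <= r1 by lra.
  have := lerD (pP z zr) (pP z0 z01); lra.
have e4 : 0 < e / 4 by rewrite divr_gt0.
have [d dP] := app _ e4.
exists d => z zr; have [->|zz] := eqVneq z z0.
  by rewrite subrr mul0r f0 subrr cmod0 mulr0.
have zz0 : 0 < cmod (z - z0) by rewrite cmod_gt0 subr_eq0.
have [|d' d'P] := app (Num.min (e / 4) (e / 4 * cmod (z - z0))).
  by rewrite lt_min e4 mulr_gt0.
have zr1 : cmod z <= r1 by lra.
have dd : cmod (d - d').[z] <= e / 2.
  apply: (poly_maxmod r10) => // w wr.
  have wz : 1 <= cmod (w - z0) by have := cmodDB w z0; lra.
  have wr' : cmod w <= r1 by rewrite wr.
  have : cmod ((w - z0) * (d - d').[w]) <= e / 2.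
    have -> : (w - z0) * (d - d').[w] =
       (f w - (w - z0) * d'.[w]) - (f w - (w - z0) * d.[w]).
      by rewrite hornerD hornerN; ring.
    apply: (le_trans (cmodDl _ _)); have := d'P w wr'; have := dP w wr'.
    rewrite le_min => + /andP[+ _]; lra.
  by rewrite cmodM; have := cmod_ge0 (d - d').[w]; nra.
have -> : f z - (z - z0) * d.[z] = (f z - (z - z0) * d'.[z]) - (z - z0) * (d - d').[z].
  by rewrite hornerD hornerN; ring.
apply: (le_trans (cmodDl _ _)); rewrite cmodM.
have := d'P z zr1; rewrite le_min => /andP[_]; nra.
Qed.

(** The quotients of entire_div_approx converge, also at z0, since their errors
    are relative to |z - z0|; the value of g at z0 is the limit of the d_n(z0). *)
Lemma entire_div f z0 : entire f -> f z0 = 0 ->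
  exists2 g, entire g & forall z, f z = (z - z0) * g z.
Proof.
move=> ef f0; pose r1 := cmod z0 + 1.
have b0 n : 0 < 2^-1 ^+ n / 2 :> R by rewrite divr_gt0 ?exprn_gt0 ?invr_gt0.
have /choice[d dP] n := entire_div_approx r1 ef f0 (b0 n).
have ext (q : {poly C}) e : 0 < e -> (forall z, cmod z <= r1 -> z != z0 -> cmod q.[z] <= e) ->
    cmod q.[z0] <= e.
  move=> e0 qe; rewrite leNgt; apply/negP => lt.
  have e1 : 0 < cmod q.[z0] - e by rewrite subr_gt0.
  have [dd dd0 ddP] := poly_cont q z0 e1.
  pose t := Num.min 1 (dd / 2).
  have t0 : 0 < t by rewrite lt_min ltr01 divr_gt0.
  have tdd : t < dd.
    have : t <= dd / 2 by rewrite ge_min lexx orbT.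
    lra.
  have t1 : t <= 1 by rewrite ge_min lexx.
  have E : cmod (z0 + t%:C - z0) = t by rewrite addrC addKr cmodR gtr0_norm.
  have := ddP (z0 + t%:C); rewrite E => /(_ tdd).
  have := qe (z0 + t%:C); have zt := cmodD z0 t%:C.
  rewrite cmodR gtr0_norm // in zt.
  have -> : z0 + t%:C != z0.
    by rewrite -subr_eq0 -cmod_eq0 E gt_eqF.
  have -> : cmod (z0 + t%:C) <= r1 by rewrite /r1; lra.
  move=> /(_ isT isT); rewrite cmodB; have := cmodDB q.[z0] q.[z0 + t%:C]; lra.
have [||l lP] := @ccauchy_lim (fun n => (d n).[z0]) (fun n => 2^-1 ^+ n).
- by move=> n; rewrite exprn_ge0 // invr_ge0.
- move=> n m nm; rewrite -hornerN -hornerD; apply: ext; first by rewrite exprn_gt0 ?invr_gt0.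
  move=> z zr zz0; have zz1 : 0 < cmod (z - z0) by rewrite cmod_gt0 subr_eq0.
  rewrite -(ler_pM2l zz1) -cmodM.
  have -> : (z - z0) * (d m - d n).[z] =
     (f z - (z - z0) * (d n).[z]) - (f z - (z - z0) * (d m).[z]).
    by rewrite hornerD hornerN; ring.
  apply: (le_trans (cmodDl _ _)).
  have : 2^-1 ^+ m <= 2^-1 ^+ n :> R.
    by rewrite ler_wiXn2l ?invr_ge0 // invf_le1 // ler1n.
  have := dP n z zr; have := dP m z zr; set a := _ ^+ m; set b := _ ^+ n; nra.
pose g z := if z == z0 then l else f z / (z - z0).
have fg z : f z = (z - z0) * g z.
  rewrite /g; case: eqVneq => [->|zz]; first by rewrite subrr mul0r.
  by rewrite mulrC divfK // subr_eq0.
exists g => // r e e0; have e4 : 0 < e / 4 by rewrite divr_gt0.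
have [q qP] := entire_div_approx (Num.max r r1) ef f0 e4.
exists q => z zr; have := qP z; rewrite le_max zr /= => /(_ isT).
case: (eqVneq z z0) => [->|zz]; last first.
  by rewrite fg -mulrBr cmodM mulrC ler_pM2r ?cmod_gt0 ?subr_eq0 //; lra.
move=> _; rewrite {1}/g eqxx.
have [n nP] := half_pow_small e4.
have := le_cmod_dist l (d n).[z0] q.[z0]; have := lP n.
suff : cmod ((d n).[z0] - q.[z0]) <= e / 2 by lra.
rewrite -hornerN -hornerD; apply: ext; first lra.
move=> w wr wz; have wz1 : 0 < cmod (w - z0) by rewrite cmod_gt0 subr_eq0.
rewrite -(ler_pM2l wz1) -cmodM.
have -> : (w - z0) * (d n - q).[w] =
   (f w - (w - z0) * q.[w]) - (f w - (w - z0) * (d n).[w]).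
  by rewrite hornerD hornerN; ring.
apply: (le_trans (cmodDl _ _)).
have := dP n w wr; have := qP w; rewrite le_max wr orbT => /(_ isT); nra.
Qed.

End Entire.

(** * Local quotients of entire functions *)

Section Quotients.
Variable R : realType.
Local Notation C := R[i].
Implicit Types (f g h F D : C -> C) (p : {poly C}) (z w c : C) (r e M : R).

(** If f were divisible by every power of z - z0, the maximum principle on a
    circle whose points w satisfy |w - z0| >= 2 |z1 - z0| would give |f(z1)| <=
    M / 2^m for all m. *)
Lemma entire_finite_order f z0 z1 : entire f -> f z1 != 0 ->
  exists m, exists2 g, entire g /\ g z0 != 0 & forall z, f z = (z - z0) ^+ m * g z.
Proof.
move=> ef f1; apply: contrapT => H.
have all m : exists2 g, entire g & forall z, f z = (z - z0) ^+ m * g z.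
  elim: m => [|m [g eg gP]]; first by exists f => // z; rewrite mul1r.
  have [g0|g0] := eqVneq (g z0) 0.
    have [h eh hP] := entire_div eg g0; exists h => // z.
    by rewrite gP hP exprSr mulrA.
  by case: H; exists m, g.
pose r := cmod z0 + 2 * cmod (z1 - z0) + cmod z1 + 1.
have [r0 z0r z1r rz] : [/\ 0 < r, cmod z0 < r, cmod z1 <= r & 2 * cmod (z1 - z0) <= r - cmod z0].
  by have := cmod_ge0 z0; have := cmod_ge0 z1; have := cmod_ge0 (z1 - z0); rewrite /r; split; lra.
have [M M0 MP] := entire_bounded r ef.
have rz0 : 0 < r - cmod z0 by rewrite subr_gt0.
have fb m : cmod (f z1) <= M * 2^-1 ^+ m.
  have [g eg gP] := all m.
  have gb : cmod (g z1) <= M / (r - cmod z0) ^+ m.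
    apply: (entire_maxmod_disc (ltW r0) eg) => // w wr.
    rewrite ler_pdivlMr ?exprn_gt0 //.
    have := MP w; rewrite wr lexx => /(_ isT); apply: le_trans.
    rewrite gP cmodM cmodX mulrC ler_wpM2r ?cmod_ge0 // lerXn2r ?nnegrE ?cmod_ge0 //.
      exact: ltW.
    by rewrite -{1}wr cmodDB.
  rewrite gP cmodM cmodX; apply: (@le_trans _ _ (cmod (z1 - z0) ^+ m * (M / (r - cmod z0) ^+ m))).
    by rewrite ler_wpM2l // exprn_ge0 // cmod_ge0.
  rewrite mulrCA ler_wpM2l // -expr_div_n lerXn2r ?nnegrE ?divr_ge0 ?invr_ge0 ?cmod_ge0 ?(ltW rz0) //.
  by rewrite ler_pdivrMr //; lra.
have f0 : 0 < cmod (f z1) / (M + 1) by rewrite divr_gt0 ?cmod_gt0 //; lra.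
have [n] := half_pow_small f0; rewrite ltr_pdivlMr; last lra.
have := fb n; have : 0 <= 2^-1 ^+ n :> R by rewrite exprn_ge0 // invr_ge0.
nra.
Qed.

Lemma pt_near z e : 0 < e -> exists2 w, w != z & cmod (w - z) < e.
Proof.
move=> e0; have E : cmod (z + (e / 2)%:C - z) = e / 2.
  by rewrite addrC addKr cmodR gtr0_norm // divr_gt0.
exists (z + (e / 2)%:C); last by rewrite E; lra.
by rewrite -subr_eq0 -cmod_eq0 E gt_eqF // divr_gt0.
Qed.

(** Near z1 the factor f does not vanish, whereas a nonzero g has an isolated
    zero at most. *)
Lemma entire_idomain f g z1 : entire f -> entire g -> f z1 != 0 ->
  (forall z, f z * g z = 0) -> forall z, g z = 0.
Proof.
move=> ef eg f1 fg z2; apply/eqP/negPn/negP => g2.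
have [m [h [eh h1] hP]] := entire_finite_order z1 eg g2.
have [d d0 dP] := ccont_neq0 (entire_cont ef) f1.
have [d' d'0 d'P] := ccont_neq0 (entire_cont eh) h1.
have [|w wz wd] := @pt_near z1 (Num.min d d'); first by rewrite lt_min d0.
move: wd; rewrite lt_min => /andP[/dP fw /d'P hw].
have := fg w; rewrite hP => /eqP; rewrite !mulf_eq0 expf_eq0 subr_eq0 (negbTE wz) andbF /=.
rewrite -!cmod_eq0 !gt_eqF //.
  by apply: le_lt_trans hw; rewrite divr_ge0 // cmod_ge0.
by apply: le_lt_trans fw; rewrite divr_ge0 // cmod_ge0.
Qed.

(** Meromorphic functions without poles. A function given by different quotients
    F / D near different points is of this kind, and continuity, identity
    theorem and maximum principle can be read off from F and D. *)
Definition qentire f := forall z0, exists F D,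
  [/\ entire F, entire D, D z0 != 0 & forall z, F z = f z * D z].

Lemma qentire_entire f : entire f -> qentire f.
Proof.
move=> ef z0; exists f, (fun=> 1); split=> //; first exact: entire_cst.
by move=> z; rewrite mulr1.
Qed.

Lemma qentireM f g : qentire f -> qentire g -> qentire (fun z => f z * g z).
Proof.
move=> qf qg z0; have [F [D [eF eD D0 FD]]] := qf z0.
have [F' [D' [eF' eD' D'0 FD']]] := qg z0.
exists (fun z => F z * F' z), (fun z => D z * D' z); split.
- exact: entireM.
- exact: entireM.
- by rewrite mulf_neq0.
- by move=> z; rewrite FD FD'; ring.
Qed.

Lemma qentireB f g : qentire f -> qentire g -> qentire (fun z => f z - g z).
Proof.
move=> qf qg z0; have [F [D [eF eD D0 FD]]] := qf z0.
have [F' [D' [eF' eD' D'0 FD']]] := qg z0.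
exists (fun z => F z * D' z - F' z * D z), (fun z => D z * D' z); split.
- by apply: entireB; exact: entireM.
- exact: entireM.
- by rewrite mulf_neq0.
- by move=> z; rewrite FD FD'; ring.
Qed.

Lemma qentire_shift f (a : C) : qentire f -> qentire (fun z => f (z + a)).
Proof.
move=> qf z0; have [F [D [eF eD D0 FD]]] := qf (z0 + a).
by exists (fun z => F (z + a)), (fun z => D (z + a)); split=> //; apply: entire_shift.
Qed.

Lemma qentire_cont f : qentire f -> ccont f.
Proof.
move=> qf z e e0; have [F [D [eF eD D0 FD]]] := qf z.
have [d d0 dP] := ccont_neq0 (entire_cont eD) D0.
have D0' : 0 < cmod (D z) by rewrite cmod_gt0.
have e1 : 0 < e * (cmod (D z) / 2) by rewrite mulr_gt0 // divr_gt0.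
have eG : entire (fun w => F w - f z * D w).
  by apply: entireB => //; apply: entireM => //; exact: entire_cst.
have [d' d'0 d'P] := entire_cont eG z e1.
exists (Num.min d d'); first by rewrite lt_min d0.
move=> w; rewrite lt_min => /andP[/dP Dw /d'P]; rewrite !FD subrr subr0 -mulrBl cmodM.
have := cmod_ge0 (f w - f z); nra.
Qed.

(** The entire function F1 - c D1 attached to a point where f differs from c has
    a zero of finite order at z0, so it cannot vanish on a neighbourhood of z0. *)
Lemma qentire_const f z0 c d : 0 < d -> qentire f ->
  (forall z, cmod (z - z0) < d -> f z = c) -> forall z, f z = c.
Proof.
move=> d0 qf fc z1.
have [F [D [eF eD D0 FD]]] := qf z0; have [F1 [D1 [eF1 eD1 D10 FD1]]] := qf z1.
have eG : entire (fun w => F1 w - c * D1 w).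
  by apply: entireB => //; apply: entireM => //; exact: entire_cst.
apply/eqP; rewrite -subr_eq0; apply/negPn/negP => fz1.
have G1 : F1 z1 - c * D1 z1 != 0 by rewrite FD1 -mulrBl mulf_neq0.
have [m [h [eh h1] hP]] := entire_finite_order z0 eG G1.
have [d' d'0 d'P] := ccont_neq0 (entire_cont eh) h1.
have [|w wz wd] := @pt_near z0 (Num.min d d'); first by rewrite lt_min d0.
move: wd; rewrite lt_min => /andP[/fc fw /d'P hw].
have := hP w; rewrite FD1 fw subrr => /esym/eqP.
rewrite !mulf_eq0 expf_eq0 subr_eq0 (negbTE wz) andbF /= -cmod_eq0 gt_eqF //.
by apply: le_lt_trans hw; rewrite divr_ge0 // cmod_ge0.
Qed.

Lemma complex_root (k : nat) c : (0 < k)%N -> exists u : C, u ^+ k = c.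
Proof.
case: k => // k _; have [u uP] := @solve_monicpoly C k.+1 (fun i => if i == 0%N then c else 0) isT.
exists u; rewrite uP big_ord_recl /= mulr1 big1 ?addr0 // => i _; by rewrite mul0r.
Qed.

(** Write f = f(z0) + (z - z0)^m h / D with m > 0 and h(z0) <> 0. Leaving z0 in
    a direction in which the second term is a positive multiple of f(z0) to
    first order makes |f| larger. *)
Lemma qentire_local_max f z0 d : 0 < d -> qentire f ->
  (forall z, cmod (z - z0) < d -> cmod (f z) <= cmod (f z0)) -> forall z, f z = f z0.
Proof.
move=> d0 qf fmax; have [f00|f00] := eqVneq (f z0) 0.
  rewrite f00; apply: (qentire_const d0 qf (z0 := z0)) => z /fmax.
  by rewrite f00 cmod0 => h; apply/eqP; rewrite -cmod_eq0 eq_le h cmod_ge0.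
have [F [D [eF eD D0 FD]]] := qf z0; set c := f z0 in f00 *.
have eG : entire (fun w => F w - c * D w).
  by apply: entireB => //; apply: entireM => //; exact: entire_cst.
have [G0|/existsNP[z1 /eqP G1]] := pselect (forall z, F z - c * D z = 0).
  have [d' d'0 d'P] := ccont_neq0 (entire_cont eD) D0.
  apply: (qentire_const d'0 qf (z0 := z0)) => z /d'P Dz.
  have Dz0 : D z != 0.
    by rewrite -cmod_eq0 gt_eqF // (le_lt_trans _ Dz) // divr_ge0 // cmod_ge0.
  by apply: (mulIf Dz0); rewrite -FD; apply/eqP; rewrite -subr_eq0 G0.
exfalso; have [m [h [eh h0] hP]] := entire_finite_order z0 eG G1.
have m0 : (0 < m)%N.
  case: m hP => // /(_ z0); rewrite FD subrr mul1r => /esym h00; by rewrite h00 eqxx in h0.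
(* the m-th power of the direction u aligns the second term with f(z0) *)
have [u uP] := complex_root (c * D z0 / h z0) m0.
have u0 : u != 0.
  apply: contra_eq_neq uP => ->; rewrite expr0n gtn_eqF // eq_sym.
  by rewrite !mulf_neq0 // invr_neq0.
have Q0 : h z0 / D z0 != 0 by rewrite mulf_neq0 // invr_neq0.
have e1 : 0 < cmod c * cmod (D z0) / 4.
  by rewrite divr_gt0 // mulr_gt0 ?cmod_gt0.
have eH : entire (fun w => u ^+ m * h w - c * D w).
  apply: entireB; apply: entireM => //; exact: entire_cst.
have [d1 d10 d1P] := entire_cont eH z0 e1.
have [d2 d20 d2P] := ccont_neq0 (entire_cont eD) D0.
pose s := Num.min (Num.min d d1) (Num.min d2 1) / 2 / (cmod u + 1).
have u1 : 0 < cmod u + 1 by have := cmod_ge0 u; lra.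
have mn0 : 0 < Num.min (Num.min d d1) (Num.min d2 1) by rewrite !lt_min d0 d10 d20 /=.
have s0 : 0 < s by rewrite !divr_gt0.
have su : cmod (s%:C * u) < Num.min (Num.min d d1) (Num.min d2 1).
  have sE : s * (cmod u + 1) = Num.min (Num.min d d1) (Num.min d2 1) / 2.
    by rewrite divfK // gt_eqF.
  rewrite cmodM cmodR gtr0_norm //; set M := Num.min _ _ in sE mn0 *; nra.
set w := z0 + s%:C * u.
have wz : w - z0 = s%:C * u by rewrite /w addrC addKr.
move: su; rewrite -wz !lt_min => /andP[/andP[/fmax fw /d1P Hw] /andP[/d2P Dw _]].
have T0 : u ^+ m * h z0 - c * D z0 = 0 by rewrite uP divfK // subrr.
move: Hw; rewrite T0 subr0.
set E := u ^+ m * h w - c * D w => HE.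
have Dw0 : D w != 0.
  by rewrite -cmod_eq0 gt_eqF // (le_lt_trans _ Dw) // divr_ge0 // cmod_ge0.
have fwE : f w * D w = c * D w * (1 + s%:C ^+ m) + s%:C ^+ m * E.
  have := hP w; rewrite FD wz exprMn => /eqP; rewrite subr_eq => /eqP ->.
  rewrite /E; ring.
have sm : s%:C ^+ m = (s ^+ m)%:C :> C by rewrite rmorphXn.
have sm0 : 0 < s ^+ m by rewrite exprn_gt0.
have : cmod (f w) * cmod (D w) >= cmod c * cmod (D w) * (1 + s ^+ m) - s ^+ m * cmod E.
  rewrite -(cmodM (f w)) fwE sm.
  have -> : cmod c * cmod (D w) * (1 + s ^+ m) = cmod (c * D w * (1 + (s ^+ m)%:C)).
    rewrite !cmodM; congr (_ * _).
    have -> : 1 + (s ^+ m)%:C = (1 + s ^+ m)%:C :> C by rewrite rmorphD.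
    by rewrite cmodR ger0_norm // addr_ge0 // ltW.
  have -> : s ^+ m * cmod E = cmod ((s ^+ m)%:C * E).
    by rewrite cmodM cmodR ger0_norm // ltW.
  exact: cmodDBn.
have c0 : 0 < cmod c by rewrite cmod_gt0.
have EcD : cmod E < cmod c * cmod (D w).
  have : 0 < cmod c * (cmod (D w) - cmod (D z0) / 2) by rewrite mulr_gt0 // subr_gt0.
  have : 0 < cmod c * cmod (D z0) by rewrite mulr_gt0 // cmod_gt0.
  move: HE; lra.
have : 0 < s ^+ m * (cmod c * cmod (D w) - cmod E) by rewrite mulr_gt0 // subr_gt0.
have : cmod (f w) * cmod (D w) <= cmod c * cmod (D w) by rewrite ler_wpM2r ?cmod_ge0.
lra.
Qed.

End Quotients.

(** * Maximum principle on compact sets and Liouville theorem *)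

Section MaxMod.
Variable R : realType.
Local Notation C := R[i].
Implicit Types (f g h F D : C -> C) (p : {poly C}) (z w c : C) (r e M : R).

Definition cclosed (K : C -> Prop) :=
  forall z, ~ K z -> exists2 d : R, 0 < d & forall w, cmod (w - z) < d -> ~ K w.

Lemma complex_EVT f (K : C -> Prop) r z1 : ccont f -> cclosed K ->
  (forall z, K z -> cmod z <= r) -> K z1 ->
  exists2 z0, K z0 & forall z, K z -> cmod (f z) <= cmod (f z0).
Proof.
move=> cf clK Kr Kz1.
pose A := [set p : R * R | K (p.1 +i* p.2)].
pose F (p : R * R) := cmod (f (p.1 +i* p.2)).
have dist (x y : R * R) e : 0 < e -> ball x (e / 2) y -> cmod ((y.1 +i* y.2) - (x.1 +i* x.2)) < e.
  move=> e0 [b1 b2]; apply: (le_lt_trans (cmod_le_ReIm _)) => /=.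
  move: b1 b2; rewrite /ball /= => b1 b2.
  by rewrite (splitr e) ltrD // distrC.
have cF : continuous F.
  move=> x; apply/cvgrPdist_lt => e e0.
  have [d d0 dP] := cf (x.1 +i* x.2) e e0.
  exists (ball x.1 (d / 2), ball x.2 (d / 2)) => /=.
    by split; apply: nbhsx_ballx; rewrite divr_gt0.
  move=> y [/= b1 b2]; have /dP := @dist x y d d0 (conj b1 b2).
  rewrite /F; set a := f _; set b := f _; have := cmodDB a b; have := cmodDB b a.
  by rewrite (cmodB b a) ltr_distl; move=> ? ? ?; apply/andP; split; lra.
have cA : compact A.
  apply: (@subclosed_compact _ A (`[-r, r] `*` `[-r, r])).
  - move=> x /= xA; apply: contrapT => /clK[d d0 dP].
    have := xA (ball x (d / 2)); case.
      exists (ball x.1 (d / 2), ball x.2 (d / 2)) => /=.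
        by split; apply: nbhsx_ballx; rewrite divr_gt0.
      by move=> y [].
    by move=> y [yA /(@dist x y d d0) /dP /(_ yA)].
  - by apply: compact_setX; exact: segment_compact.
  - move=> x /= /Kr xr; split => /=.
      by have := le_trans (Re_le_cmod _) xr; rewrite ler_norml in_itv.
    by have := le_trans (Im_le_cmod _) xr; rewrite ler_norml in_itv.
have [||x xA xmax] := @compact_EVT_max _ R F A _ cA.
- by exists (complex.Re z1, complex.Im z1); rewrite /A /=; case: z1 Kz1.
- exact: continuous_subspaceT.
exists (x.1 +i* x.2); first by move: xA; rewrite inE.
move=> [a b] zK; apply: (xmax (a, b)); by rewrite inE.
Qed.

(** |f| attains its maximum over K; at a maximum interior to K the function is
    constant, by qentire_local_max. *)
Lemma qentire_maxmod f (K : C -> Prop) r M z1 : qentire f -> cclosed K ->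
  (forall z, K z -> cmod z <= r) -> K z1 -> cmod (f z1) <= M ->
  (forall z, K z -> cmod (f z) <= M \/ exists2 d : R, 0 < d & forall w, cmod (w - z) < d -> K w) ->
  forall z, K z -> cmod (f z) <= M.
Proof.
move=> qf clK Kr K1 f1 Kb z Kz.
have [z0 K0 z0max] := complex_EVT (qentire_cont qf) clK Kr K1.
apply: le_trans (z0max z Kz) _.
have [//|[d d0 dP]] := Kb z0 K0.
by rewrite -(qentire_local_max d0 qf _ z1) // => w /dP; exact: z0max.
Qed.

Lemma qentire_maxmod_disc f r M : 0 <= r -> qentire f ->
  (forall z, cmod z = r -> cmod (f z) <= M) ->
  forall z, cmod z <= r -> cmod (f z) <= M.
Proof.
move=> r0 qf fM; apply: (@qentire_maxmod f (fun z => cmod z <= r) r M r%:C) => //.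
- move=> z /negP; rewrite -ltNge => rz; exists (cmod z - r); first by rewrite subr_gt0.
  by move=> w; have := cmodDB z w; rewrite cmodB => ? ? ?; lra.
- by rewrite cmodR ger0_norm.
- by apply: fM; rewrite cmodR ger0_norm.
- move=> z; rewrite le_eqVlt => /orP[/eqP/fM|zr]; first by left.
  right; exists (r - cmod z); first by rewrite subr_gt0.
  by move=> w; have := cmodDB w z; lra.
Qed.

(** Numerators are divided by z - z0 near z0, denominators are multiplied by it
    elsewhere. *)
Lemma qentire_div f z0 : qentire f -> f z0 = 0 ->
  exists2 g, qentire g & forall z, f z = (z - z0) * g z.
Proof.
move=> qf f0; have [F [D [eF eD D0 FD]]] := qf z0.
have F0 : F z0 = 0 by rewrite FD f0 mul0r.
have [F1 eF1 F1P] := entire_div eF F0.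
pose g z := if z == z0 then F1 z0 / D z0 else f z / (z - z0).
have fg z : f z = (z - z0) * g z.
  rewrite /g; case: eqVneq => [->|zz]; first by rewrite subrr mul0r.
  by rewrite mulrC divfK // subr_eq0.
exists g => // z1; have [->|z10] := eqVneq z1 z0.
  exists F1, D; split=> // z; have [->|zz] := eqVneq z z0.
    by rewrite /g eqxx divfK.
  have zz0 : z - z0 != 0 by rewrite subr_eq0.
  by apply: (mulfI zz0); rewrite -F1P FD fg mulrA.
have [F' [D' [eF' eD' D'0 FD']]] := qf z1.
exists F', (fun z => (z - z0) * D' z); split=> //.
- by apply: entireM => //; apply: entireB; [exact: entire_id|exact: entire_cst].
- by rewrite mulf_neq0 // subr_eq0.
- by move=> z; rewrite FD' fg; ring.
Qed.

(** (f(z) - f(0)) / z is O(1/|z|) on large circles, hence zero by the maximum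
    principle. *)
Lemma qentire_liouville f M : qentire f -> (forall z, cmod (f z) <= M) ->
  forall z, f z = f 0.
Proof.
move=> qf fM z.
have qg : qentire (fun z => f z - f 0).
  by apply: qentireB => //; apply: qentire_entire; exact: entire_cst.
have [g eg gP] := qentire_div qg (subrr (f 0)).
suff g0 : g z = 0 by have /eqP := gP z; rewrite g0 mulr0 subr_eq0 => /eqP.
apply/eqP; rewrite -cmod_eq0; apply/negPn/negP => gz.
have gz0 : 0 < cmod (g z) by rewrite lt_def gz cmod_ge0.
have M0 : 0 <= M by apply: le_trans (cmod_ge0 _) (fM 0).
pose r := cmod z + 2 * M / (cmod (g z) / 2) + 1.
have q0 : 0 <= 2 * M / (cmod (g z) / 2) by rewrite divr_ge0 ?mulr_ge0 ?divr_ge0 // ltW.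
have r0 : 0 < r by rewrite /r; have := cmod_ge0 z; lra.
have : cmod (g z) <= cmod (g z) / 2.
  apply: (qentire_maxmod_disc (ltW r0) eg); last by rewrite /r; lra.
  move=> w wr; have : cmod (w * g w) <= 2 * M.
    have := gP w; rewrite subr0 => <-; apply: (le_trans (cmodDl _ _)).
    by have := fM w; have := fM 0; lra.
  rewrite cmodM wr => H; rewrite leNgt; apply/negP => lt.
  have E : 2 * M / (cmod (g z) / 2) * (cmod (g z) / 2) = 2 * M.
    by rewrite divfK // gt_eqF // divr_gt0.
  have : 2 * M / (cmod (g z) / 2) < r by rewrite /r; have := cmod_ge0 z; lra.
  set t := 2 * M / _ in E q0 *; nra.
lra.
Qed.
End MaxMod.

(** * The complex exponential *)

Section ComplexExp.
Variable R : realType.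
Local Notation C := R[i].
Implicit Types (z w c : C) (x y r e M : R).

Lemma is_derive_eps (f : R -> R) x a e : is_derive x 1 f a -> 0 < e ->
  exists2 d : R, 0 < d & forall h, `|h| < d -> `|f (x + h) - f x - a * h| <= e * `|h|.
Proof.
move=> [df fa] e0.
have /cvgrPdist_le : h^-1 *: (f (h *: (1:R) + x) - f x) @[h --> 0^'] --> a.
  by rewrite -fa; exact: df.
move=> /(_ e e0); rewrite near_withinE => -[d /= d0 dP].
exists d => // h hd; have [->|h0] := eqVneq h 0.
  by rewrite addr0 subrr mulr0 subr0 normr0 mulr0.
have := dP h; rewrite /ball_ /= sub0r normrN => /(_ hd h0).
rewrite /GRing.scale /= mulr1 distrC (addrC h).
rewrite -(@ler_pM2r _ `|h|) ?normr_gt0 // -normrM mulrBl mulrAC mulVf // mul1r.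
done.
Qed.

Definition cexp z : C :=
  (expR (complex.Re z) * cos (complex.Im z)) +i* (expR (complex.Re z) * sin (complex.Im z)).

Lemma cexp0 : cexp 0 = 1.
Proof. by rewrite /cexp /= expR0 cos0 sin0 mulr1 mulr0. Qed.

Lemma cexpD z w : cexp (z + w) = cexp z * cexp w.
Proof.
rewrite /cexp cReD cImD expRD cosD sinD.
by apply: complex_eq => /=; move: (expR _) (expR _) (cos _) (sin _) (cos _) (sin _) => a b c d e f; ring.
Qed.

Lemma cmod_cexp z : cmod (cexp z) = expR (complex.Re z).
Proof.
rewrite cmodE /= !exprMn -mulrDr cos2Dsin2 mulr1 sqrtr_sqr.
by rewrite ger0_norm // expR_ge0.
Qed.

Lemma cexpMn z n : cexp (z *+ n) = cexp z ^+ n.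
Proof. by elim: n => [|n IH]; rewrite ?cexp0 // mulrS cexpD IH exprS. Qed.

Lemma cexp_approx e : 0 < e ->
  exists2 d : R, 0 < d & forall z, cmod z < d -> cmod (cexp z - 1 - z) <= e * cmod z.
Proof.
move=> e0.
have e8 : 0 < Num.min 1 (e / 8) by rewrite lt_min ltr01 divr_gt0.
set e' := Num.min 1 _ in e8.
have [e1 ee] : e' <= 1 /\ e' <= e / 8.
  by split; rewrite /e' ge_min lexx ?orbT.
clearbody e'.
have [d1 d10 d1P] := is_derive_eps (@is_derive_expR R 0) e8.
have [d2 d20 d2P] := is_derive_eps (@is_derive_cos R 0) e8.
have [d3 d30 d3P] := is_derive_eps (@is_derive_sin R 0) e8.
exists (Num.min (Num.min d1 d2) (Num.min d3 (e' / 2))).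
  by rewrite !lt_min d10 d20 d30 divr_gt0.
move=> z; rewrite !lt_min => /andP[/andP[z1 z2] /andP[z3 z4]].
have zx := Re_le_cmod z; have zy := Im_le_cmod z.
have := d1P _ (le_lt_trans zx z1); have := d2P _ (le_lt_trans zy z2).
have := d3P _ (le_lt_trans zy z3); rewrite !add0r sin0 cos0 expR0 oppr0 mul0r !subr0 addr0 !mul1r.
set x := complex.Re z in zx *; set y := complex.Im z in zy *.
move=> hs hc hx.
apply: (le_trans (cmod_le_ReIm _)); rewrite !cReB !cImB /= subr0 -/x -/y.
set E := expR x in hx *.
have E2 : `|E - 1| <= 2 * `|x|.
  have -> : E - 1 = (E - 1 - x) + x by ring.
  by apply: le_trans (ler_normD _ _) _; have := normr_ge0 x; nra.
have E3 : `|E| <= 2.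
  have -> : E = (E - 1) + 1 by ring.
  by apply: le_trans (ler_normD _ _) _; rewrite normr1; lra.
have -> : E * cos y - 1 - x = (E - 1 - x) + E * (cos y - 1) by ring.
have -> : E * sin y - y = E * (sin y - y) + (E - 1) * y by ring.
have h1 := ler_normD (E - 1 - x) (E * (cos y - 1)).
have h2 := ler_normD (E * (sin y - y)) ((E - 1) * y).
rewrite !normrM in h1 h2.
have h3 : `|E| * `|cos y - 1| <= 2 * (e' * `|y|) by apply: ler_pM.
have h4 : `|E| * `|sin y - y| <= 2 * (e' * `|y|) by apply: ler_pM.
have h5 : `|E - 1| * `|y| <= 2 * `|x| * `|y| by rewrite ler_wpM2r.
have h6 : `|x| * `|y| <= e' / 2 * cmod z by apply: ler_pM => //; lra.
have h7 : e' * `|x| <= e' * cmod z by rewrite ler_wpM2l // ltW.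
have h8 : e' * `|y| <= e' * cmod z by rewrite ler_wpM2l // ltW.
have h9 : e' * cmod z <= e / 8 * cmod z by rewrite ler_wpM2r // cmod_ge0.
have h10 : 0 <= e * cmod z by rewrite mulr_ge0 ?cmod_ge0 // ltW.
lra.
Qed.

Lemma cmod_subX z w M n : cmod z <= M -> cmod w <= M ->
  cmod (z ^+ n - w ^+ n) <= n%:R * M ^+ n.-1 * cmod (z - w).
Proof.
move=> zM wM; rewrite subrXX cmodM mulrC ler_wpM2r ?cmod_ge0 //.
apply: (le_trans (cmod_sum _ _ _)).
have -> : n%:R * M ^+ n.-1 = \sum_(i < n) M ^+ n.-1 by rewrite sumr_const card_ord mulr_natl.
apply: ler_sum => i _; rewrite cmodM !cmodX.
have -> : M ^+ n.-1 = M ^+ (n.-1 - i) * M ^+ i.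
  by rewrite -exprD subnK //; have := ltn_ord i; lia.
have M0 : 0 <= M by apply: le_trans zM; exact: cmod_ge0.
by apply: ler_pM; rewrite ?exprn_ge0 ?cmod_ge0 // lerXn2r // nnegrE ?cmod_ge0.
Qed.

(** Limit of (1 + z/n)^n, uniform on discs because cexp w - 1 - w = o(w). *)
Lemma entire_cexp : entire cexp.
Proof.
move=> r0 e e0.
pose r := Num.max r0 1; have r1 : 0 < r by rewrite lt_max ltr01 orbT.
have rr : r0 <= r by rewrite le_max lexx.
have B0 : 0 < e / (r * expR (2 * r)) by rewrite divr_gt0 // mulr_gt0 // expR_gt0.
have [d d0 dP] := cexp_approx B0.
pose n := (Num.bound (r / d)).+1.
have n0 : 0 < n%:R :> R by rewrite ltr0n.
have rn : r / n%:R < d.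
  rewrite ltr_pdivrMr // mulrC -ltr_pdivrMr //.
  have := @archi_boundP R (r / d) _; rewrite divr_ge0 ?ltW // => /(_ isT) H.
  by rewrite (lt_trans H) // ltr_nat.
clearbody n; exists ((1 + n%:R^-1 *: 'X) ^+ n) => z zr0; rewrite horner_exp !hornerE.
have zr : cmod z <= r by apply: le_trans rr.
set w := n%:R^-1 * z.
have wE : cmod w = cmod z / n%:R by rewrite cmodM cmodV cmod_nat mulrC.
have zw : z = w *+ n by rewrite -mulr_natl /w mulrA divff ?mul1r // -cmod_eq0 cmod_nat gt_eqF.
have wr : cmod w <= r / n%:R by rewrite wE ler_pM2r // invr_gt0.
rewrite [X in cexp X]zw cexpMn.
have Ew : cmod (cexp w) <= expR (r / n%:R).
  by rewrite cmod_cexp ler_expR (le_trans _ wr) // (le_trans (ler_norm _)) // Re_le_cmod.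
have Ew' : cmod (1 + w) <= expR (r / n%:R).
  apply: (le_trans (cmodD _ _)); rewrite cmod1.
  by apply: le_trans (expR_ge1Dx _); rewrite lerD2l.
apply: (le_trans (cmod_subX n Ew Ew')).
have wd : cmod w < d by apply: le_lt_trans rn.
have -> : cexp w - (1 + w) = cexp w - 1 - w by ring.
apply: (@le_trans _ _ (n%:R * expR (r / n%:R) ^+ n.-1 * (e / (r * expR (2 * r)) * (r / n%:R)))).
  rewrite ler_wpM2l ?mulr_ge0 ?exprn_ge0 ?expR_ge0 ?ler0n //.
  by rewrite (le_trans (dP _ wd)) // ler_wpM2l // ltW.
have Xn : expR (r / n%:R) ^+ n.-1 <= expR (2 * r).
  rewrite -expRM_natl ler_expR.
  have : (n.-1)%:R <= n%:R :> R by rewrite ler_nat leq_pred.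
  rewrite -(@ler_pM2r _ (r / n%:R)) ?divr_gt0 // => h.
  have E1 : n%:R * (r / n%:R) = r by rewrite mulrC divfK // gt_eqF.
  by rewrite E1 in h; apply: (le_trans h); lra.
have X0 : 0 < expR (2 * r) by apply: expR_gt0.
have -> : n%:R * expR (r / n%:R) ^+ n.-1 * (e / (r * expR (2 * r)) * (r / n%:R)) =
   e * (expR (r / n%:R) ^+ n.-1 / expR (2 * r)).
  by field; rewrite !gt_eqF.
rewrite ger_pMr //.
by rewrite ler_pdivrMr // mul1r.
Qed.

End ComplexExp.

(** * Order one half, Phragmen-Lindelof principle, Harnack inequality *)

Section PhragmenLindelof.
Variable R : realType.
Local Notation C := R[i].
Implicit Types (f g h F D : C -> C) (p P : {poly C}) (z w c : C) (r e M K : R).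

(** Order at most 1/2 with finite type. The weight is at least 1, so that
    multiplicative constants can be absorbed into K. *)
Definition order_half f := exists2 K : R, 0 <= K &
  forall z, cmod (f z) <= expR (K * (1 + Num.sqrt (cmod z))).

Lemma entire_cexpZ (c : C) : entire (fun z => cexp (c * z)).
Proof.
apply: entire_ext (entire_comp_poly ('X * c%:P) (@entire_cexp R)) => z.
by rewrite !hornerE mulrC.
Qed.

Lemma ge0_eps_expR M x y : 0 < M -> 0 < x -> (forall e, 0 < e -> y <= M * expR (e * x)) -> y <= M.
Proof.
move=> M0 x0 H; rewrite leNgt; apply/negP => My.
have yM : 1 < y / M by rewrite ltr_pdivlMr // mul1r.
have l0 : 0 < ln (y / M) by rewrite ln_gt0.
have := H (ln (y / M) / 2 / x); rewrite !divr_gt0 // => /(_ isT).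
rewrite divfK ?gt_eqF //; apply/negP; rewrite -ltNge mulrC -ltr_pdivlMr //.
rewrite -[ltRHS]lnK ?posrE ?(lt_trans ltr01) // ltr_expR; lra.
Qed.

(** In the sector |Im z| <= Re z the factor exp(- e z) overcomes the growth
    exp(K sqrt |z|), and it has modulus at most 1 on the sides. The maximum
    principle on the triangle cut off by Re z = s^2 gives |f(z)| <= M exp(e Re
    z); then e tends to 0. *)
Lemma phragmen_lindelof f M : qentire f -> order_half f -> 0 < M ->
  (forall z, complex.Re z <= `|complex.Im z| -> cmod (f z) <= M) ->
  forall z, cmod (f z) <= M.
Proof.
move=> qf [K K0 fK] M0 fM z.
have [/fM//|zs] := leP (complex.Re z) `|complex.Im z|.
have x0 : 0 < complex.Re z by apply: le_lt_trans zs.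
apply: (ge0_eps_expR M0 x0) => e e0.
have q : qentire (fun w => f w * cexp (- e%:C * w)).
  by apply: qentireM => //; apply: qentire_entire; exact: entire_cexpZ.
have norm w : cmod (f w * cexp (- e%:C * w)) = cmod (f w) * expR (- (e * complex.Re w)).
  by rewrite cmodM cmod_cexp mulNr cReN cReZ.
(* so large that K (1 + 2 s) - e s^2 <= ln M on the third side, where |w| <= 2
   s^2 *)
pose s := (3 * K + `|ln M|) / e + 1 + complex.Re z.
have t0 : 0 <= (3 * K + `|ln M|) / e.
  by rewrite divr_ge0 ?addr_ge0 ?mulr_ge0 // ltW.
have s1 : 1 <= s by rewrite /s; lra.
have s0 : 0 <= s by lra.
have sz : complex.Re z <= s ^+ 2 by rewrite expr2 (@le_trans _ _ (1 * s)) ?ler_wpM2r // mul1r /s; lra.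
pose S := fun w : C => `|complex.Im w| <= complex.Re w /\ complex.Re w <= s ^+ 2.
suff : cmod (f z * cexp (- e%:C * z)) <= M.
  by rewrite norm expRN ler_pdivrMr // expR_gt0.
have Sb w : S w -> cmod w <= 2 * s ^+ 2.
  by move=> [h1 h2]; have := cmod_le_ReIm w; have := ler_norm (complex.Re w); rewrite (ger0_norm (le_trans (normr_ge0 _) h1)); lra.
apply: (@qentire_maxmod _ _ S (2 * s ^+ 2) M 0 q) => //.
- move=> w /not_andP[] /negP; rewrite -ltNge => h.
    exists ((`|complex.Im w| - complex.Re w) / 2); first by rewrite divr_gt0 // subr_gt0.
    move=> v vw [h1 h2]; have := Re_le_cmod (v - w); have := Im_le_cmod (v - w).
    rewrite cReB cImB => i1 i2; have := le_lt_trans i1 vw; have := le_lt_trans i2 vw.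
    rewrite ltr_norml => /andP[_ j1] j2.
    have := ler_distD (complex.Im v) (complex.Im w) 0; rewrite !subr0 distrC; lra.
  exists (complex.Re w - s ^+ 2); first by rewrite subr_gt0.
  move=> v vw [h1 h2]; have := Re_le_cmod (v - w); rewrite cReB => i1.
  have := le_lt_trans i1 vw; rewrite ltr_norml => /andP[]; lra.
- by rewrite /S /= normr0 lexx sqr_ge0.
- rewrite norm /= mulr0 oppr0 expR0 mulr1; apply: fM; by rewrite /= normr0.
- move=> w [h1 h2].
  have [e1|n1] := eqVneq `|complex.Im w| (complex.Re w).
    left; rewrite norm (le_trans _ (fM w _)) ?e1 //.
    rewrite -[leRHS]mulr1 ler_wpM2l ?cmod_ge0 // -[leRHS]expR0 ler_expR.
    by rewrite oppr_le0 mulr_ge0 ?(ltW e0) // (le_trans _ h1).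
  have [e2|n2] := eqVneq (complex.Re w) (s ^+ 2).
    left; rewrite norm; apply: (@le_trans _ _ (expR (K * (1 + 2 * s)) * expR (- (e * s ^+ 2)))).
      rewrite e2 ler_wpM2r ?expR_ge0 // (le_trans (fK w)) // ler_expR ler_wpM2l // lerD2l.
      rewrite -[leRHS]ger0_norm ?mulr_ge0 // -sqrtr_sqr ler_wsqrtr //.
      apply: (le_trans (Sb w _)) => //; rewrite exprMn ler_wpM2r ?sqr_ge0 //; lra.
    rewrite -expRD -[leRHS]lnK ?posrE // ler_expR.
    have : e * s = 3 * K + `|ln M| + e * (1 + complex.Re z).
      by rewrite /s; field; rewrite gt_eqF.
    have := ler_norm (- ln M); rewrite normrN expr2 mulrA => ? ->.
    have : (3 * K + `|ln M|) * s <= (3 * K + `|ln M| + e * (1 + complex.Re z)) * s.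
      rewrite ler_wpM2r // lerDl mulr_ge0 ?(ltW e0) // addr_ge0 // ltW //.
    have : `|ln M| <= `|ln M| * s by rewrite ler_peMr.
    have : K <= K * s by rewrite ler_peMr.
    lra.
  right.
  have d1 : 0 < complex.Re w - `|complex.Im w| by rewrite subr_gt0 lt_neqAle n1.
  have d2 : 0 < s ^+ 2 - complex.Re w by rewrite subr_gt0 lt_neqAle n2.
  exists (Num.min ((complex.Re w - `|complex.Im w|) / 2) (s ^+ 2 - complex.Re w)).
    by rewrite lt_min d2 divr_gt0.
  move=> v; rewrite lt_min => /andP[v1 v2].
  have := Re_le_cmod (v - w); have := Im_le_cmod (v - w); rewrite cReB cImB => i1 i2.
  have := ler_distD (complex.Im w) (complex.Im v) 0; rewrite !subr0.
  have := le_lt_trans i2 v1; have := le_lt_trans i2 v2; rewrite !ltr_norml.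
  move=> /andP[? ?] /andP[? ?] ?; split; lra.
- split; first exact: ltW. exact: sz.
Qed.

Lemma cont_bounded_disc f r : ccont f -> exists2 M, 0 <= M & forall z, cmod z <= r -> cmod (f z) <= M.
Proof.
move=> cf; have [r0|r0] := ltP r 0.
  by exists 0 => // z zr; have := cmod_ge0 z; rewrite leNgt (le_lt_trans zr r0).
have [||z0 _ zmax] := @complex_EVT _ f (fun z => cmod z <= r) r 0 cf _ (fun _ => id).
- move=> z /negP; rewrite -ltNge => rz; exists (cmod z - r); first by rewrite subr_gt0.
  by move=> w; have := cmodDB z w; rewrite cmodB => ? ? ?; lra.
- by rewrite cmod0.
by exists (cmod (f z0)); [exact: cmod_ge0|].
Qed.

(** Averages of the conjugate values of P against the same powers of w vanish,
    so the coefficients of P of positive index are averages of 2 Re P with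
    unimodular weights. As Re P >= 0, each is bounded by twice the mean of Re P,
    which is Re P(0), and the resulting geometric series is summed at radius
    r/2. *)
Lemma poly_harnack P r : 0 < r -> (forall z, cmod z = r -> 0 <= complex.Re P.[z]) ->
  forall z, cmod z <= r / 2 -> complex.Re P.[z] <= 3 * complex.Re P`_0.
Proof.
move=> r0 P0.
(* then P has no coefficient of index n - k when 0 < k < size P *)
pose n := (2 * (size P).+1)%N.
have [w pw] := @prim_root_exists R n isT.
have wr j : cmod (r%:C * w ^+ j) = r.
  by rewrite cmodM cmodR cmodX (cmod_prim_root pw) expr1n mulr1 gtr0_norm.
have sn : (size P <= n)%N by rewrite /n; lia.
have av0 : \sum_(j < n) complex.Re P.[r%:C * w ^+ j] = n%:R * complex.Re P`_0.
  have := congr1 (@complex.Re R) (@poly_coef_average R n w P 0 r%:C pw sn isT).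
  rewrite expr0 mulr1 subn0.
  have -> : (n%:R : C) = (n%:R)%:C by rewrite rmorph_nat.
  rewrite cReZ => <-; rewrite (big_morph _ (@cReD R) (erefl _)).
  apply: eq_bigr => j _; by rewrite exprAC (prim_expr_order pw) expr1n mul1r.
have co k : (0 < k)%N -> (k < size P)%N -> cmod P`_k * r ^+ k <= 2 * complex.Re P`_0.
  move=> k0 kP.
  have kn : (k < n)%N by rewrite /n; lia.
  have kn' : (n - k < n)%N by rewrite /n; lia.
  have h1 := @poly_coef_average R n w P k r%:C pw sn kn.
  have h2 := @poly_coef_average R n w P (n - k) r%:C pw sn kn'.
  rewrite subKn ?(ltnW kn) // in h2.
  have sk : (size P <= n - k)%N by rewrite /n; move: (size P) kP => s; clear; lia.
  have Pz : P`_(n - k) = 0 by rewrite nth_default.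
  rewrite Pz mul0r mulr0 in h2.
  have h3 : \sum_(j < n) (w ^+ j) ^+ (n - k) * (P.[r%:C * w ^+ j])^*%C = 0.
    transitivity ((\sum_(j < n) (w ^+ j) ^+ k * P.[r%:C * w ^+ j])^*%C); last by rewrite h2 conjc0.
    rewrite rmorph_sum; apply: eq_bigr => j _.
    rewrite rmorphM /=; congr (_ * _).
    have wn0 : (w ^+ j) ^+ k != 0.
      by rewrite -cmod_eq0 !cmodX (cmod_prim_root pw) !expr1n oner_eq0.
    apply: (mulfI wn0); rewrite mul_conj !cmodX (cmod_prim_root pw) !expr1n.
    rewrite -exprD subnKC ?(ltnW kn) // exprAC (prim_expr_order pw) expr1n //.
  have h4 : \sum_(j < n) (w ^+ j) ^+ (n - k) * (2 * complex.Re P.[r%:C * w ^+ j])%:C =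
      n%:R * (P`_k * r%:C ^+ k).
    transitivity (\sum_(j < n) (w ^+ j) ^+ (n - k) * P.[r%:C * w ^+ j] +
        \sum_(j < n) (w ^+ j) ^+ (n - k) * (P.[r%:C * w ^+ j])^*%C); last by rewrite h1 h3 addr0.
    rewrite -big_split /=; apply: eq_bigr => j _.
    rewrite -mulrDr; congr (_ * _); rewrite addcJ rmorphM /=; by rewrite rmorph_nat.
  have n0 : 0 < n%:R :> R by rewrite ltr0n.
  rewrite -(ler_pM2l n0).
  have -> : n%:R * (cmod P`_k * r ^+ k) = cmod (n%:R * (P`_k * r%:C ^+ k)).
    by rewrite !cmodM cmod_nat cmodX cmodR gtr0_norm.
  rewrite -h4 mulrCA -av0 mulr_sumr; apply: (le_trans (cmod_sum _ _ _)).
  apply: ler_sum => j _; rewrite cmodM !cmodX (cmod_prim_root pw) !expr1n mul1r cmodR.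
  by rewrite ger0_norm // mulr_ge0 // P0.
have c0 : 0 <= complex.Re P`_0.
  have n0 : 0 < n%:R :> R by rewrite ltr0n.
  rewrite -(pmulr_rge0 _ n0) -av0; apply: sumr_ge0 => j _; exact: P0.
move=> z zr.
case E : (size P) => [|m].
  by have /eqP -> : P == 0 by [rewrite -size_poly_eq0 E]; rewrite horner0 coef0 /= mulr0.
rewrite horner_coef E big_ord_recl /= expr0 mulr1 cReD.
have geo : \sum_(i < m) 2^-1 ^+ i.+1 <= 1 :> R.
  have -> : \sum_(i < m) 2^-1 ^+ i.+1 = 1 - 2^-1 ^+ m :> R.
    elim: m {E} => [|m IH]; first by rewrite big_ord0 expr0 subrr.
    by rewrite big_ord_recr /= IH exprSr; lra.
  by rewrite lerBlDr lerDl exprn_ge0 // invr_ge0.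
set S := \sum_(i < m) _; suff : complex.Re S <= 2 * complex.Re P`_0 * \sum_(i < m) 2^-1 ^+ i.+1.
  have := ler_wpM2l (mulr_ge0 (ler0n R 2) c0) geo; lra.
apply: (le_trans (ler_norm _)); apply: (le_trans (Re_le_cmod _)).
apply: (le_trans (cmod_sum _ _ _)); rewrite mulr_sumr; apply: ler_sum => i _.
rewrite /bump /= add1n cmodM cmodX; have := co i.+1 isT; rewrite E ltnS ltn_ord => /(_ isT) h.
apply: (@le_trans _ _ (cmod P`_i.+1 * (r ^+ i.+1 * 2^-1 ^+ i.+1))).
  rewrite ler_wpM2l ?cmod_ge0 // -exprMn lerXn2r ?nnegrE ?cmod_ge0 //.
  by rewrite mulr_ge0 ?invr_ge0 // ltW.
by rewrite mulrA ler_wpM2r // exprn_ge0 // invr_ge0.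
Qed.
End PhragmenLindelof.

(** * Logarithms of zero-free polynomials *)

Section LogSeries.
Variable R : realType.
Local Notation C := R[i].
Implicit Types (p P : {poly C}) (z w c : C) (t r e : R).

(** Partial sums of - log (1 - w). *)
Definition logsum (w : C) M : C := \sum_(n < M) n.+1%:R^-1 * w ^+ n.+1.

(** Evaluated at t w instead of w, the sum inside the absolute value has
    derivative - Re (w (t w)^M / (1 - t w)) in t, and it vanishes at t = 0; the
    mean value theorem applies. *)
Lemma log_series w M : cmod w < 1 ->
  `|ln (cmod (1 - w)) + complex.Re (logsum w M)| <= cmod w ^+ M.+1 / (1 - cmod w).
Proof.
move=> w1; set a := complex.Re w; set b := complex.Im w.
pose N t : R := (1 - t * a) ^+ 2 + (t * b) ^+ 2.
have NE t : N t = cmod (1 - t%:C * w) ^+ 2.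
  by rewrite cmod_sqr cReB cImB cReZ cImZ /= sub0r sqrrN.
have tw t : 0 <= t <= 1 -> cmod (t%:C * w) <= cmod w.
  by move=> /andP[t0 t1]; rewrite cmodM cmodR ger0_norm // ler_piMl ?cmod_ge0.
have dn t : 0 <= t <= 1 -> 1 - cmod w <= cmod (1 - t%:C * w).
  by move=> /tw h; have := cmodDB 1 (t%:C * w); rewrite cmod1; lra.
have N0 t : 0 <= t <= 1 -> 0 < N t.
  by move=> /dn h; rewrite NE exprn_gt0 //; lra.
pose S : {poly R} := \sum_(n < M) (n.+1%:R^-1 * complex.Re (w ^+ n.+1)) *: 'X^(n.+1).
have ReS (u : 'I_M -> C) : complex.Re (\sum_(n < M) u n) = \sum_(n < M) complex.Re (u n).
  by rewrite (big_morph _ (@cReD R) (erefl _)).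
have nat1 n z : complex.Re (n.+1%:R^-1 * z) = n.+1%:R^-1 * complex.Re z.
  have -> : (n.+1%:R^-1 : C) = (n.+1%:R^-1)%:C by rewrite fmorphV rmorph_nat.
  by rewrite cReZ.
have S1 : S.[1] = complex.Re (logsum w M).
  rewrite ReS horner_sum; apply: eq_bigr => n _.
  by rewrite hornerZ hornerXn expr1n mulr1 nat1.
have S0 : S.[0] = 0.
  by rewrite horner_sum big1 // => n _; rewrite hornerZ hornerXn expr0n mulr0.
have dS t : S^`().[t] = \sum_(n < M) t ^+ n * complex.Re (w ^+ n.+1).
  rewrite raddf_sum /= horner_sum; apply: eq_bigr => n _.
  rewrite derivZ derivXn /= hornerZ hornerMn hornerXn -(mulr_natr (t ^+ n)).
  have k0 : n.+1%:R != 0 :> R by rewrite pnatr_eq0.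
  move: (n.+1%:R) k0 => k k0. by field.
pose f t : R := 2^-1 * ln (N t) + S.[t].
pose df t : R := 2^-1 * ((N t)^-1 * (2 * (1 - t*a) * - a + 2 * (t * b) * b)) + S^`().[t].
have derf t : 0 <= t <= 1 -> is_derive t 1 f (df t).
  move=> ht; have dN : is_derive t 1 N (2 * (1 - t*a) * - a + 2 * (t * b) * b).
    by apply: is_derive_eq; rewrite /GRing.scale /=; ring.
  have dl := is_derive1_comp (is_derive1_ln (N0 t ht)) dN.
  have := is_deriveD (is_deriveZ 2^-1 dl) (is_derive_poly S t).
  by apply.
have dfE t : 0 <= t <= 1 -> df t = - complex.Re (w * (t%:C * w) ^+ M / (1 - t%:C * w)).
  move=> ht; have n0 : 1 - t%:C * w != 0.
    by rewrite -cmod_eq0 gt_eqF //; have := dn t ht; lra.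
  have -> : complex.Re (w * (t%:C * w) ^+ M / (1 - t%:C * w)) =
     complex.Re (w / (1 - t%:C * w)) - complex.Re (\sum_(n < M) t%:C ^+ n * w ^+ n.+1).
    rewrite -cReB; congr complex.Re.
    have -> : \sum_(n < M) t%:C ^+ n * w ^+ n.+1 = w * \sum_(n < M) (t%:C * w) ^+ n.
      rewrite mulr_sumr; apply: eq_bigr => n _; rewrite exprMn exprS; ring.
    have := subrX1 (t%:C * w) M; set s := \sum_(n < M) _ => E.
    apply: (mulIf n0); rewrite divfK // mulrBl divfK //.
    have -> : w * s * (1 - t%:C * w) = - w * ((t%:C * w - 1) * s) by ring.
    by rewrite -E; ring.
  rewrite ReS opprB /df dS addrC; congr (_ + _).
    apply: eq_bigr => n _; rewrite -rmorphXn; by rewrite cReZ.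
  have -> : w / (1 - t%:C * w) = ((N t)^-1)%:C * (w * (1 - t%:C * w)^*%C).
    apply: (mulIf n0); rewrite divfK // -!mulrA [_^*%C * _]mulrC mul_conj -NE.
    by rewrite mulrCA -rmorphM mulVf ?mulr1 // gt_eqF // N0.
  have Rc (u : C) : complex.Re u^*%C = complex.Re u by case: u.
  have Ic (u : C) : complex.Im u^*%C = - complex.Im u by case: u.
  rewrite cReZ cReM Rc Ic cReB cImB cReZ cImZ -/a -/b /=.
  by have := lt0r_neq0 (N0 t ht); move: (N t) => n nn0; field.
have cw0 : 0 < 1 - cmod w by rewrite subr_gt0.
have dfB t : 0 <= t <= 1 -> `|df t| <= cmod w ^+ M.+1 / (1 - cmod w).
  move=> ht; rewrite dfE // normrN (le_trans (Re_le_cmod _)) //.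
  rewrite !cmodM cmodV cmodX exprS; apply: ler_pM.
  - by rewrite mulr_ge0 ?exprn_ge0 ?cmod_ge0.
  - by rewrite invr_ge0 cmod_ge0.
  - by rewrite ler_wpM2l ?cmod_ge0 // lerXn2r ?nnegrE ?cmod_ge0 // tw.
  - by rewrite lef_pV2 ?posrE ?dn // (lt_le_trans cw0) // dn.
have [| |t] := @MVT_segment R f df 0 1 ler01.
- move=> t; rewrite in_itv /= => /andP[t0 t1]; apply: derf; by rewrite !ltW.
- apply: derivable_within_continuous => t; rewrite in_itv /= => ht.
  by have [] := derf t ht.
rewrite in_itv /= => ht; rewrite subr0 mulr1.
have -> : f 0 = 0.
  by rewrite /f S0 /N !mul0r subr0 expr1n expr0n /= !addr0 ln1 mulr0.
rewrite subr0 => E; have -> : ln (cmod (1 - w)) + complex.Re (logsum w M) = f 1.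
  rewrite /f S1 NE mul1r; congr (_ + _); rewrite lnXn ?mulrA; last first.
    have := dn 1; rewrite mul1r ler01 lexx => /(_ isT); lra.
  by rewrite -(mulr_natl (ln _)) mulrA mulVf ?mul1r // pnatr_eq0.
by rewrite E dfB.
Qed.

(** The members of cs are the inverses of the zeros of the product Q, none of
    which lies in the disc. Up to e, - log |Q| is the real part of a polynomial
    vanishing at 0; adding ln B makes this real part nonnegative on a circle,
    and Harnack's inequality bounds - log |Q| by 2 ln B. *)
Lemma zero_free_lower (cs : seq C) r B : 0 < r -> 1 <= B ->
  (forall c, c \in cs -> cmod c * r <= 1) ->
  (forall z, cmod z <= r -> cmod (\prod_(c <- cs) (1 - c * z)) <= B) ->
  forall z, cmod z <= r / 3 -> (B ^+ 2)^-1 <= cmod (\prod_(c <- cs) (1 - c * z)).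
Proof.
move=> r0 B1 csr QB z zr.
have B0 : 0 < B by lra.
pose Q z := \prod_(c <- cs) (1 - c * z).
pose r' := 2 * r / 3.
have r'0 : 0 < r' by rewrite /r'; lra.
have cz c u : c \in cs -> cmod u <= r' -> cmod (c * u) <= 2 / 3.
  move=> /csr cr ur; rewrite cmodM; have := cmod_ge0 c; rewrite /r' in ur.
  have := cmod_ge0 u; nra.
have n1 c u : c \in cs -> cmod u <= r' -> 0 < cmod (1 - c * u).
  by move=> cc /(cz _ _ cc) h; have := cmodDB 1 (c * u); rewrite cmod1; lra.
have lnQ u : cmod u <= r' -> ln (cmod (Q u)) = \sum_(c <- cs) ln (cmod (1 - c * u)).
  move=> ur; rewrite /Q cmod_prod.
  have : {subset cs <= cs} by [].
  move: {1 3 4}cs; elim=> [|c s IH] ss; first by rewrite !big_nil ln1.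
  have cc : c \in cs by rewrite ss // mem_head.
  have ss' : {subset s <= cs} by move=> x xs; rewrite ss // in_cons xs orbT.
  rewrite !big_cons lnM ?IH // posrE ?n1 //.
  by rewrite big_seq prodr_gt0 // => i /ss' ic; exact: n1.
suff key e : 0 < e -> - (2 * ln B) - 3 * e <= ln (cmod (Q z)).
  have Q0 : 0 < cmod (Q z).
    rewrite /Q cmod_prod big_seq prodr_gt0 // => i ic; apply: n1 => //.
    by rewrite /r'; lra.
  rewrite -ler_ln ?posrE ?invr_gt0 ?exprn_gt0 //.
  rewrite lnV ?posrE ?exprn_gt0 // lnXn // -mulr_natl.
  rewrite leNgt; apply/negP => lt.
  have e0 : 0 < (- (2 * ln B) - ln (cmod (Q z))) / 6 by rewrite divr_gt0 // subr_gt0.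
  have := key _ e0; lra.
move=> e0.
(* the truncation error of the logarithmic series at modulus at most 2/3, for
   all factors together *)
have [M HM] : exists M, (size cs)%:R * ((2 / 3) ^+ M.+1 / (1 - 2 / 3)) <= e.
  have : 0 < e / (3 * (size cs).+1%:R) by rewrite divr_gt0 // mulr_gt0.
  move=> /half_pow_small [n hn]; exists (2 * n)%N.
  have h1 : (2 / 3) ^+ (2 * n).+1 <= 2^-1 ^+ n :> R.
    have h2 : (2 / 3) ^+ 2 <= 2^-1 :> R by lra.
    have q0 : 0 <= 2 / 3 :> R by lra.
    apply: (@le_trans _ _ ((2 / 3) ^+ (2 * n))).
      rewrite ler_wiXn2l // ; lra.
    by rewrite exprM lerXn2r ?nnegrE ?exprn_ge0 // invr_ge0.
  rewrite ltr_pdivlMr ?mulr_gt0 // in hn.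
  have s0 : (0 : R) <= (size cs)%:R by [].
  have : (1 - 2 / 3)^-1 = 3 :> R by field.
  move=> ->; move: hn; rewrite -natr1.
  have : 0 <= 2^-1 ^+ n :> R by rewrite exprn_ge0 // invr_ge0.
  set x := 2^-1 ^+ n in h1 *; set y := _ ^+ _ in h1 *; set k := _%:R; nra.
pose P : {poly C} := \sum_(c <- cs) \sum_(n < M) (n.+1%:R^-1 * c ^+ n.+1) *: 'X^(n.+1).
have PE u : P.[u] = \sum_(c <- cs) logsum (c * u) M.
  rewrite horner_sum; apply: eq_bigr => c _; rewrite horner_sum; apply: eq_bigr => n _.
  by rewrite hornerZ hornerXn exprMn mulrA.
have close u : cmod u <= r' -> `|ln (cmod (Q u)) + complex.Re P.[u]| <= e.
  move=> ur; rewrite lnQ // PE (big_morph _ (@cReD R) (erefl _)) -big_split /=.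
  apply: le_trans (ler_norm_sum _ _ _) _; apply: le_trans HM.
  rewrite mulr_natl -[leRHS](@iter_addr_0 R) -count_predT -big_const_seq.
  rewrite big_seq [leRHS]big_seq; apply: ler_sum => c cc.
  have h := cz c u cc ur.
  apply: le_trans (log_series M _) _; first lra.
  apply: ler_pM; rewrite ?exprn_ge0 ?invr_ge0 ?cmod_ge0 //; first lra.
    by rewrite lerXn2r ?nnegrE ?cmod_ge0.
  by rewrite lef_pV2 ?posrE; lra.
pose H : {poly C} := (ln B + e)%:C%:P + P.
have P00 : P`_0 = 0.
  rewrite coef_sum big1 // => c _; rewrite coef_sum big1 // => n _.
  by rewrite coefZ coefXn /= mulr0.
have HE u : complex.Re H.[u] = ln B + e + complex.Re P.[u].
  by rewrite hornerD hornerC cReD.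
have := @poly_harnack R H r' r'0 _ z _.
have -> : complex.Re H`_0 = ln B + e by rewrite coefD coefC P00 addr0.
rewrite HE => Hk.
have : ln B + e + complex.Re P.[z] <= 3 * (ln B + e).
  apply: Hk; last by rewrite /r'; lra.
  move=> u ur; rewrite HE.
  have ur' : cmod u <= r' by rewrite ur.
  have := close u ur'; rewrite ler_norml => /andP[h _].
  have : ln (cmod (Q u)) <= ln B.
    rewrite ler_ln ?posrE //; last first.
      rewrite cmod_prod big_seq prodr_gt0 // => c cc; exact: n1.
    by apply: QB; rewrite ur /r'; lra.
  lra.
have zr' : cmod z <= r' by rewrite /r'; lra.
have := close z zr'; rewrite ler_norml => /andP[h _]; lra.
Qed.
End LogSeries.

(** * Growth of quotients without poles *)

Section QuotientGrowth.
Variable R : realType.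
Local Notation C := R[i].
Implicit Types (f g F G D : C -> C) (p P : {poly C}) (z w c : C) (t r e M A B : R).

(** Replace D by a polynomial P so close to it that the error is negligible even
    after multiplication by G, and reflect the zeros of P that lie in the disc.
    This produces Q without zeros in the disc and |P| = m |Q| on the circle. The
    product G Q is bounded there by the values of F, hence inside as well, and
    zero_free_lower bounds Q from below. *)
Lemma quotient_bound F G D r A B : entire D -> qentire G ->
  (forall z, F z = G z * D z) -> 0 < r -> 0 <= A -> 0 <= B -> D 0 != 0 ->
  (forall z, cmod z <= r -> cmod (F z) <= A) ->
  (forall z, cmod z <= r -> cmod (D z) <= B) ->
  forall z, cmod z <= r / 3 ->
    cmod (G z) <= (A + 1) * (B + 1) ^+ 2 * (2 / cmod (D 0)) ^+ 3.
Proof.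
move=> eD qG FE r0 A0 B0 D0 FA DB z zr.
have d0 : 0 < cmod (D 0) by rewrite cmod_gt0.
set d := cmod (D 0) in d0 *.
have [K K0 GK] := cont_bounded_disc r (qentire_cont qG).
(* K bounds G on the disc, and K e <= 1 *)
pose e := Num.min (Num.min 1 (d / 2)) (K + 1)^-1.
have K1 : 0 < K + 1 by lra.
have e0 : 0 < e by rewrite !lt_min ltr01 divr_gt0 // invr_gt0.
have [e1 e2 e3] : [/\ e <= 1, e <= d / 2 & e <= (K + 1)^-1].
  by rewrite /e; split; rewrite !ge_min lexx ?orbT.
have eK : K * e <= 1.
  have : e * (K + 1) <= 1 by rewrite -ler_pdivlMr // div1r.
  lra.
have [P PD] := eD r e e0.
have P0 : d / 2 <= cmod P.[0].
  have := PD 0; rewrite cmod0 => /(_ (ltW r0)).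
  have := cmodDB (D 0) P.[0]; have := cmodDB (D 0) (D 0 - P.[0]).
  by rewrite opprB addrCA subrr addr0 -/d; lra.
have [s sE] := closed_field_poly_normal P.
set lc := lead_coef P in sE.
have Ph u : P.[u] = lc * \prod_(a <- s) (u - a).
  rewrite {1}sE hornerZ horner_prod; congr (_ * _); apply: eq_bigr => a _.
  by rewrite !hornerE.
(* co a is the inverse of the zero that replaces a (its mirror image r^2 / conj
   a if a lies in the disc), and mu a normalizes the factor to have the modulus
   of z - a on the circle *)
pose mu a := if cmod a < r then r else cmod a.
pose co a : C := if cmod a < r then a^*%C * (r ^- 2)%:C else a^-1.
pose m := cmod lc * \prod_(a <- s) mu a.
pose Q u := \prod_(c <- map co s) (1 - c * u).
have mu0 a : 0 < mu a by rewrite /mu; case: (ltP (cmod a) r) => [_|h] //; exact: lt_le_trans r0 h.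
have cmodB' a u : cmod u = r -> cmod (u - a) = mu a * cmod (1 - co a * u).
  move=> ur; rewrite /mu /co; case: ifPn => ar.
    have u0 : u != 0 by rewrite -cmod_eq0 ur gt_eqF.
    have -> : 1 - a^*%C * (r ^- 2)%:C * u = (u - a)^*%C * (u * (r ^- 2)%:C).
      rewrite rmorphB /= mulrBl; congr (_ - _); last by ring.
      rewrite mulrA [_^*%C * _]mulrC mul_conj ur -rmorphM /= divff //.
      by rewrite expf_neq0 // gt_eqF.
    rewrite !cmodM cmod_conj ur cmodR ger0_norm ?invr_ge0 ?exprn_ge0 ?(ltW r0) //.
    by field; rewrite gt_eqF.
  have a0 : a != 0 by rewrite -cmod_eq0 gt_eqF // (lt_le_trans r0) // leNgt.
  by rewrite -cmodM mulrBr mulr1 mulrA divff // mul1r cmodB.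
have PQ u : cmod u = r -> cmod P.[u] = m * cmod (Q u).
  move=> ur; rewrite Ph cmodM /m -mulrA; congr (_ * _).
  rewrite !cmod_prod big_map -big_split /=; apply: eq_bigr => a _; exact: cmodB'.
have m0 : d / 2 <= m.
  apply: le_trans P0 _; rewrite Ph cmodM /m ler_wpM2l ?cmod_ge0 // cmod_prod.
  apply: ler_prod => a _; rewrite cmod_ge0 sub0r cmodN /= /mu.
  by case: (ltP (cmod a) r) => [/ltW|].
have m1 : 0 < m by apply: lt_le_trans m0; rewrite divr_gt0.
have eQ : entire Q.
  rewrite /Q; elim: (map co s) => [|c l IH].
    by apply: entire_ext (entire_cst 1) => u; rewrite big_nil.
  apply: (@entire_ext _ (fun u => (1 - c * u) * \prod_(c <- l) (1 - c * u))).
    by move=> u; rewrite big_cons.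
  apply: (entireM _ IH); apply: entireB; first exact: entire_cst.
  by apply: entireM; [exact: entire_cst|exact: entire_id].
have QB u : cmod u <= r -> cmod (Q u) <= (B + 1) / m.
  apply: (entire_maxmod_disc (ltW r0) eQ) => v vr.
  have vr' : cmod v <= r by rewrite vr.
  rewrite ler_pdivlMr // mulrC -PQ //.
  have := PD v vr'; have := DB v vr'; have := cmodDB P.[v] (D v); rewrite cmodB; lra.
have QG u : cmod u <= r -> cmod (G u * Q u) <= (A + 1) / m.
  apply: (@qentire_maxmod_disc _ (fun u => G u * Q u) _ _ (ltW r0)); first exact: qentireM qG (qentire_entire eQ).
  move=> v vr; have vr' : cmod v <= r by rewrite vr.
  rewrite ler_pdivlMr // cmodM -mulrA [_ * m]mulrC -PQ // -cmodM.
  have -> : G v * P.[v] = F v - G v * (D v - P.[v]) by rewrite FE; ring.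
  apply: (le_trans (cmodDl _ _)); apply: lerD; first exact: FA.
  rewrite cmodM; apply: le_trans eK; apply: ler_pM; rewrite ?cmod_ge0 ?GK ?PD //.
have B1 : 1 <= (B + 1) / m.
  have := QB 0; rewrite cmod0 => /(_ (ltW r0)).
  have -> : Q 0 = 1 by rewrite /Q big1_seq // => c _; rewrite mulr0 subr0.
  by rewrite cmod1.
have := @zero_free_lower R (map co s) r ((B + 1) / m) r0 B1 _ QB z zr.
have csr c : c \in map co s -> cmod c * r <= 1.
  move=> /mapP[a _ ->]; rewrite /co; case: (ltP (cmod a) r) => ar.
    rewrite cmodM cmod_conj cmodR ger0_norm ?invr_ge0 ?exprn_ge0 ?(ltW r0) //.
    have -> : cmod a * r ^- 2 * r = cmod a / r by field; rewrite gt_eqF.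
    by rewrite ler_pdivrMr // mul1r ltW.
  by rewrite cmodV mulrC ler_pdivrMr ?mul1r // (lt_le_trans r0).
move=> /(_ csr); rewrite -/(Q z) => Ql.
have zr' : cmod z <= r by apply: (le_trans zr); lra.
have := QG z zr'; rewrite cmodM => Gl.
have Bm0 : 0 < ((B + 1) / m) ^+ 2 by rewrite exprn_gt0 // (lt_le_trans ltr01).
have Qz0 : 0 < cmod (Q z) by apply: lt_le_trans Ql; rewrite invr_gt0.
apply: (@le_trans _ _ ((A + 1) / m / cmod (Q z))); first by rewrite ler_pdivlMr.
apply: (@le_trans _ _ ((A + 1) / m * ((B + 1) / m) ^+ 2)).
  rewrite ler_wpM2l //; first by rewrite divr_ge0 // ?ltW //; lra.
  by rewrite -[leRHS]invrK lef_pV2 ?posrE ?invr_gt0.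
have -> : (A + 1) / m * ((B + 1) / m) ^+ 2 = (A + 1) * (B + 1) ^+ 2 * m^-1 ^+ 3.
  by rewrite !expr2 !exprS expr0; field; rewrite gt_eqF.
have [A1 B1'] : 0 <= A + 1 /\ 0 <= B + 1 by split; lra.
rewrite ler_wpM2l ?mulr_ge0 ?sqr_ge0 //.
rewrite lerXn2r ?nnegrE ?invr_ge0 ?divr_ge0 ?(ltW m1) ?(ltW d0) //.
by rewrite -[leRHS]invrK lef_pV2 ?posrE ?invr_gt0 ?divr_gt0 // invf_div.
Qed.

Lemma sqrtD x y : 0 <= x -> 0 <= y -> Num.sqrt (x + y) <= Num.sqrt x + Num.sqrt y :> R.
Proof.
move=> x0 y0; rewrite -(@ler_pXn2r _ 2) ?nnegrE ?addr_ge0 ?sqrtr_ge0 //.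
rewrite sqrrD !sqr_sqrtr ?addr_ge0 // lerD2r lerDl.
by rewrite mulrn_wge0 // mulr_ge0 ?sqrtr_ge0.
Qed.

Lemma order_half_bound f : order_half f -> exists2 K : R, 0 <= K &
  forall z r, 0 <= r -> cmod z <= r -> cmod (f z) <= expR (K * (1 + Num.sqrt r)).
Proof.
move=> [K K0 fK]; exists K => // z r r0 zr; apply: (le_trans (fK z)).
by rewrite ler_expR ler_wpM2l // lerD2l ler_wsqrtr.
Qed.

(** quotient_bound is applied on discs centred at a whose radius is comparable
    to |z - a|. *)
Lemma order_half_quotient F G D a : entire D -> qentire G ->
  (forall z, F z = G z * D z) -> D a != 0 -> order_half F -> order_half D ->
  order_half G.
Proof.
move=> eD qG FE Da /order_half_bound[KF KF0 FB] /order_half_bound[KD KD0 DB].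
have d0 : 0 < cmod (D a) by rewrite cmod_gt0.
pose L := Num.sqrt (3 + cmod a) : R.
have L0 : 0 <= L by apply: sqrtr_ge0.
(* all exponents below are at most K (1 + sqrt |z - a|) *)
pose K := 3 * (KF + 2 * KD) * (1 + L) + 3 + `|ln ((2 / cmod (D a)) ^+ 3)| .
have S0 (x : R) : 0 <= Num.sqrt x by apply: sqrtr_ge0.
have Kp : 0 <= K by rewrite /K addr_ge0 // addr_ge0 // mulr_ge0 ?mulr_ge0 ?addr_ge0 ?mulr_ge0.
exists (K * (2 + Num.sqrt (cmod a))) => [|z]; first by rewrite mulr_ge0 // addr_ge0 ?S0.
pose z' : C := z - a; pose rr := 3 * (cmod z' + 1).
have rr0 : 0 < rr by rewrite /rr; have := cmod_ge0 z'; lra.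
have bd u : cmod u <= rr -> cmod (u + a) <= 3 * cmod z' + (3 + cmod a).
  by move=> ur; have := cmodD u a; rewrite /rr in ur; lra.
have q0 : 0 <= 3 * cmod z' + (3 + cmod a).
  by have := cmod_ge0 z'; have := cmod_ge0 a; lra.
pose S : R := Num.sqrt (3 * cmod z' + (3 + cmod a)).
have SL : S <= 2 * Num.sqrt (cmod z') + L.
  apply: le_trans (sqrtD _ _) _; rewrite ?addr_ge0 ?mulr_ge0 ?cmod_ge0 //.
  rewrite lerD2r -[leRHS]ger0_norm ?mulr_ge0 // -sqrtr_sqr ler_wsqrtr //.
  by rewrite exprMn sqr_sqrtr ?cmod_ge0 // ler_wpM2r ?cmod_ge0 //; lra.
have sz' : Num.sqrt (cmod z') <= Num.sqrt (cmod z) + Num.sqrt (cmod a).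
  apply: le_trans (ler_wsqrtr (cmodDl z a)) _; exact: sqrtD (cmod_ge0 _) (cmod_ge0 _).
have := @quotient_bound (fun u => F (u + a)) (fun u => G (u + a)) (fun u => D (u + a)) rr
  (expR (KF * (1 + S))) (expR (KD * (1 + S))) (entire_shift a eD) (qentire_shift a qG)
  (fun u => FE (u + a)) rr0 (expR_ge0 _) (expR_ge0 _) _ _ _ z' _.
rewrite add0r Da /z' subrK => /(_ isT) H.
apply: le_trans (H _ _ _) _.
- by move=> u /bd ur; apply: FB.
- by move=> u /bd ur; apply: DB.
- by rewrite -/z' /rr; lra.
have e1 (x : R) : 0 <= x -> expR x + 1 <= expR (x + 1).
  move=> x0; rewrite expRD; have h1 := expR_ge1Dx (1 : R); have h2 := expR_ge1Dx x.
  move: (expR x) (expR 1) h1 h2 => u v h1 h2.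
  have : 0 <= (u - 1) * (v - 2) by rewrite mulr_ge0 //; lra.
  lra.
have p1 : 0 <= KF * (1 + S) by rewrite mulr_ge0 // addr_ge0 ?S0.
have p2 : 0 <= KD * (1 + S) by rewrite mulr_ge0 // addr_ge0 ?S0.
apply: (@le_trans _ _ (expR (KF * (1 + S) + 1) * expR (KD * (1 + S) + 1) ^+ 2 * (2 / cmod (D a)) ^+ 3)).
  rewrite ler_wpM2r ?exprn_ge0 ?divr_ge0 ?cmod_ge0 //.
  apply: ler_pM; rewrite ?addr_ge0 ?sqr_ge0 ?expR_ge0 ?e1 //.
  by rewrite lerXn2r ?nnegrE ?addr_ge0 ?expR_ge0 ?e1.
have c0 : 0 < (2 / cmod (D a)) ^+ 3 by rewrite exprn_gt0 // divr_gt0.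
rewrite -[X in _ * X](lnK c0) -expRM_natl -!expRD ler_expR.
have := ler_norm (ln ((2 / cmod (D a)) ^+ 3)); set l := ln _ => hl.
have h1 : KF * (1 + S) <= KF * (3 * (1 + L) * (1 + Num.sqrt (cmod z'))).
  by rewrite ler_wpM2l //; have := S0 (cmod z'); have := mulr_ge0 L0 (S0 (cmod z')); lra.
have h2 : KD * (1 + S) <= KD * (3 * (1 + L) * (1 + Num.sqrt (cmod z'))).
  by rewrite ler_wpM2l //; have := S0 (cmod z'); have := mulr_ge0 L0 (S0 (cmod z')); lra.
have h3 : 1 + Num.sqrt (cmod z') <= (2 + Num.sqrt (cmod a)) * (1 + Num.sqrt (cmod z)).
  by have := S0 (cmod z); have := S0 (cmod a); have := mulr_ge0 (S0 (cmod z)) (S0 (cmod a)); lra.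
apply: (@le_trans _ _ (K * (1 + Num.sqrt (cmod z')))); last first.
  by rewrite -mulrA ler_wpM2l.
have := S0 (cmod z'); set s := Num.sqrt (cmod z') in h1 h2 *; rewrite /K -/l => s0.
have : `|l| <= `|l| * (1 + s) by rewrite ler_peMr // lerDl.
have : 3 <= 3 * (1 + s) by lra.
lra.
Qed.

(** The order of G is 1/2, so its bound outside the sector extends to the plane
    by phragmen_lindelof. *)
Theorem quotient_constant F G D a r M : entire D -> qentire G ->
  (forall z, F z = G z * D z) -> D a != 0 -> order_half F -> order_half D ->
  (forall z, r <= cmod z -> complex.Re z <= `|complex.Im z| -> cmod (G z) <= M) ->
  forall z, G z = G 0.
Proof.
move=> eD qG FE Da oF oD GM.
have [K K0 GK] := cont_bounded_disc r (qentire_cont qG).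
apply: (@qentire_liouville _ _ (K + `|M| + 1) qG).
apply: phragmen_lindelof => //.
- exact: (order_half_quotient eD qG FE Da).
- by have := normr_ge0 M; lra.
- move=> z zs; have [zr|/ltW zr] := leP (cmod z) r.
    by have := GK z zr; have := normr_ge0 M; lra.
  by have := GM z zr zs; have := ler_norm M; lra.
Qed.
End QuotientGrowth.

(** * Integration of complex-valued functions on the line *)

Section ComplexIntegral.
Variable R : realType.
Local Notation C := R[i].
Local Notation mu := (@lebesgue_measure R).
Local Notation Re := complex.Re.
Local Notation Im := complex.Im.
Implicit Types (D E : set (measurableTypeR R)) (f g : R -> C) (u v : R -> R) (a b c x : R) (k : C).

Definition cmeasurable D f :=
  measurable_fun D (fun x => Re (f x)) /\ measurable_fun D (fun x => Im (f x)).

Definition rintegrable D u := mu.-integrable D (EFin \o u).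

Lemma cintegrable_meas D f : cintegrable D f -> cmeasurable D f.
Proof.
by move=> [/(measurable_int mu)/measurable_EFinP h1 /(measurable_int mu)/measurable_EFinP h2].
Qed.

Lemma measurable_cmod D f : measurable D -> cmeasurable D f ->
  measurable_fun D (fun x => cmod (f x)).
Proof.
move=> mD [h1 h2].
have -> : (fun x => cmod (f x)) = Num.sqrt \o (fun x => Re (f x) ^+ 2 + Im (f x) ^+ 2).
  by apply/funext => x; rewrite /= cmodE.
apply: measurableT_comp.
  by apply: continuous_measurable_fun => x; exact: sqrt_continuous.
by apply: measurable_funD; apply: measurable_funX.
Qed.

Lemma cmeasurableD D f g : measurable D -> cmeasurable D f -> cmeasurable D g ->
  cmeasurable D (fun x => f x + g x).
Proof.
move=> mD [f1 f2] [g1 g2]; split.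
  by under [X in measurable_fun _ X]eq_fun do rewrite cReD; exact: measurable_funD.
by under [X in measurable_fun _ X]eq_fun do rewrite cImD; exact: measurable_funD.
Qed.

Lemma cmeasurableM D f g : measurable D -> cmeasurable D f -> cmeasurable D g ->
  cmeasurable D (fun x => f x * g x).
Proof.
move=> mD [f1 f2] [g1 g2]; split.
  under [X in measurable_fun _ X]eq_fun do rewrite cReM.
  by apply: measurable_funB; exact: measurable_funM.
under [X in measurable_fun _ X]eq_fun do rewrite cImM.
by apply: measurable_funD; exact: measurable_funM.
Qed.

Lemma cmeasurableS D E f : measurable E -> D `<=` E -> cmeasurable E f -> cmeasurable D f.
Proof. by move=> mE DE [h1 h2]; split; apply: measurable_funS; eassumption. Qed.

Lemma rintegrable_cts a b u : {within `[a, b], continuous u} -> rintegrable `[a, b] u.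
Proof. by move=> cu; apply: continuous_compact_integrable => //; exact: segment_compact. Qed.

Lemma rintegrable_cst a b c : rintegrable `[a, b] (fun=> c).
Proof. by apply: rintegrable_cts => x; exact: cvg_cst. Qed.

Lemma rintegrable_le D u v : measurable D -> measurable_fun D u ->
  (forall x, D x -> `|u x| <= v x) -> rintegrable D v -> rintegrable D u.
Proof.
move=> mD mu' uv iv; apply: le_integrable iv => //; first exact/measurable_EFinP.
by move=> x Dx /=; rewrite lee_fin (le_trans (uv x Dx)) // ler_norm.
Qed.

Lemma cintegrable_le D f u : measurable D -> cmeasurable D f ->
  (forall x, D x -> cmod (f x) <= u x) -> rintegrable D u -> cintegrable D f.
Proof.
move=> mD [m1 m2] fu iu; split; apply: (@rintegrable_le D _ u) => // x Dx.
  exact: le_trans (Re_le_cmod _) (fu x Dx).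
exact: le_trans (Im_le_cmod _) (fu x Dx).
Qed.

Lemma rintegrableD D u v : measurable D -> rintegrable D u -> rintegrable D v ->
  rintegrable D (fun x => u x + v x).
Proof. by move=> mD iu iv; have := integrableD mD iu iv. Qed.

Lemma rintegrableZ D u a : measurable D -> rintegrable D u -> rintegrable D (fun x => a * u x).
Proof. by move=> mD iu; have := integrableZl mD a iu. Qed.

Lemma rintegrable_cmod D f : measurable D -> cintegrable D f -> rintegrable D (fun x => cmod (f x)).
Proof.
move=> mD cf; have [i1 i2] := cf.
apply: (@rintegrable_le D _ (fun x => `|Re (f x)| + `|Im (f x)|)) => //.
- exact: measurable_cmod (cintegrable_meas cf).
- by move=> x _; rewrite ger0_norm ?cmod_ge0 ?cmod_le_ReIm.
- by apply: rintegrableD => //; exact: integrable_norm.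
Qed.

Lemma cintegrableD D f g : measurable D -> cintegrable D f -> cintegrable D g ->
  cintegrable D (fun x => f x + g x).
Proof.
move=> mD cf cg; apply: (@cintegrable_le D _ (fun x => cmod (f x) + cmod (g x))) => //.
- by apply: cmeasurableD => //; exact: cintegrable_meas.
- by move=> x _; exact: cmodD.
- by apply: rintegrableD => //; exact: rintegrable_cmod.
Qed.

Lemma cintegrableZ D f k : measurable D -> cintegrable D f -> cintegrable D (fun x => k * f x).
Proof.
move=> mD cf; apply: (@cintegrable_le D _ (fun x => cmod k * cmod (f x))) => //.
- by apply: cmeasurableM => //; exact: cintegrable_meas.
- by move=> x _; rewrite cmodM.
- by apply: rintegrableZ => //; exact: rintegrable_cmod.
Qed.

Lemma cintegrableM_bounded D f g M : measurable D -> cmeasurable D f ->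
  (forall x, D x -> cmod (f x) <= M) -> cintegrable D g -> cintegrable D (fun x => f x * g x).
Proof.
move=> mD mf fM cg; apply: (@cintegrable_le D _ (fun x => M * cmod (g x))) => //.
- by apply: cmeasurableM => //; exact: cintegrable_meas.
- by move=> x Dx; rewrite cmodM ler_wpM2r ?cmod_ge0 ?fM.
- by apply: rintegrableZ => //; exact: rintegrable_cmod.
Qed.

Lemma cintegrableS D E f : measurable E -> measurable D -> D `<=` E ->
  cintegrable E f -> cintegrable D f.
Proof. by move=> mE mD DE [h1 h2]; split; apply: integrableS mE mD DE _. Qed.

Lemma cintegralD D f g : measurable D -> cintegrable D f -> cintegrable D g ->
  cintegral D (fun x => f x + g x) = cintegral D f + cintegral D g.
Proof.
move=> mD [f1 f2] [g1 g2]; apply: complex_eq; rewrite ?cReD ?cImD /= -RintegralD //.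
  by congr (Rintegral _ _ _); apply/funext => x; rewrite cReD.
by congr (Rintegral _ _ _); apply/funext => x; rewrite cImD.
Qed.

Lemma cintegralZ D f k : measurable D -> cintegrable D f ->
  cintegral D (fun x => k * f x) = k * cintegral D f.
Proof.
move=> mD [f1 f2]; apply: complex_eq; rewrite ?cReM ?cImM /= -!RintegralZl //.
  rewrite -RintegralB //; [|exact: rintegrableZ|exact: rintegrableZ].
  by congr (Rintegral _ _ _); apply/funext => x; rewrite cReM.
rewrite -RintegralD //; [|exact: rintegrableZ|exact: rintegrableZ].
by congr (Rintegral _ _ _); apply/funext => x; rewrite cImM.
Qed.

(** Multiplication by a constant of modulus 1 makes the integral equal to its
    modulus, which is then the integral of a real part. *)
Lemma cintegral_norm D f : measurable D -> cintegrable D f ->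
  cmod (cintegral D f) <= \int[mu]_(x in D) cmod (f x).
Proof.
move=> mD cf; set I := cintegral D f.
have [->|I0] := eqVneq I 0.
  by rewrite cmod0; apply: Rintegral_ge0 => x _; exact: cmod_ge0.
pose k := I^*%C / (cmod I)%:C.
have cI : cmod I != 0 by rewrite cmod_eq0.
have k1 : cmod k = 1.
  by rewrite cmodM cmodV cmod_conj cmodR ger0_norm ?cmod_ge0 // divff.
have kI : k * I = (cmod I)%:C.
  rewrite /k mulrAC [_^*%C * _]mulrC mul_conj expr2 rmorphM /= mulfK //.
  by rewrite -cmod_eq0 cmodR normr_eq0.
have -> : cmod I = Re (cintegral D (fun x => k * f x)).
  by rewrite cintegralZ // kI.
have ck := cintegrableZ k mD cf.
apply: le_Rintegral => //; first by case: ck.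
  exact: rintegrable_cmod.
move=> x _; apply: (le_trans (ler_norm _)); apply: (le_trans (Re_le_cmod _)).
by rewrite cmodM k1 mul1r.
Qed.

Lemma cintegral_norm_le D f u : measurable D -> cintegrable D f -> rintegrable D u ->
  (forall x, D x -> cmod (f x) <= u x) -> cmod (cintegral D f) <= \int[mu]_(x in D) u x.
Proof.
move=> mD cf iu fu; apply: (le_trans (cintegral_norm mD cf)).
by apply: le_Rintegral => //; exact: rintegrable_cmod.
Qed.

Lemma eq_cintegral D f g : (forall x, D x -> f x = g x) -> cintegral D f = cintegral D g.
Proof.
move=> fg; rewrite /cintegral; congr (_ +i* _);
  by apply: eq_Rintegral => x; rewrite inE => /fg ->.
Qed.

Lemma eq_cintegrable D f g : measurable D -> (forall x, D x -> f x = g x) ->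
  cintegrable D f -> cintegrable D g.
Proof.
move=> mD fg [h1 h2]; split; [apply: eq_integrable h1|apply: eq_integrable h2] => // x;
  by rewrite inE => /fg /= ->.
Qed.

Lemma ae_imp (P Q : R -> Prop) : (forall x, P x -> Q x) ->
  {ae mu, forall x, P x} -> {ae mu, forall x, Q x}.
Proof. by move=> PQ; apply: filterS; first exact: (ae_filter_ringOfSetsType mu). Qed.

Lemma ae_and (P Q : R -> Prop) : {ae mu, forall x, P x} -> {ae mu, forall x, Q x} ->
  {ae mu, forall x, P x /\ Q x}.
Proof. by apply: filterS2; first exact: (ae_filter_ringOfSetsType mu). Qed.

Lemma cintegral_ae D f g : measurable D -> cmeasurable D f -> cmeasurable D g ->
  {ae mu, forall x, D x -> f x = g x} -> cintegral D f = cintegral D g.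
Proof.
move=> mD [f1 f2] [g1 g2] fg; rewrite /cintegral; congr (_ +i* _); congr fine;
  apply: ae_eq_integral => //; try exact/measurable_EFinP;
  by apply: ae_imp fg => x h Dx /=; rewrite h.
Qed.

Lemma cintegrable_ae D f g : measurable D -> cintegrable D f -> cmeasurable D g ->
  {ae mu, forall x, D x -> f x = g x} -> cintegrable D g.
Proof.
move=> mD cf mg fg.
have [m1 m2] := cintegrable_meas cf; have [g1 g2] := mg; have [i1 i2] := cf.
split; apply/integrableP; split; try exact/measurable_EFinP.
  have /integrableP[_] := i1; congr (_ < _)%E; apply: ae_eq_integral => //.
  - by apply: measurableT_comp => //; exact/measurable_EFinP.
  - by apply: measurableT_comp => //; exact/measurable_EFinP.
  - by apply: ae_imp fg => x h Dx /=; rewrite h.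
have /integrableP[_] := i2; congr (_ < _)%E; apply: ae_eq_integral => //.
- by apply: measurableT_comp => //; exact/measurable_EFinP.
- by apply: measurableT_comp => //; exact/measurable_EFinP.
- by apply: ae_imp fg => x h Dx /=; rewrite h.
Qed.

Lemma itv_sub a b c x : a <= b -> c <= x -> `[b, c] `<=` `[a, x].
Proof. by move=> ab cx y /=; rewrite !in_itv /= => /andP[? ?]; apply/andP; split; lra. Qed.

Lemma cint_sub a b c x f : a <= b -> c <= x -> cintegrable `[a, x] f -> cintegrable `[b, c] f.
Proof. by move=> ab cx; apply: cintegrableS => //; exact: itv_sub. Qed.

Lemma rint_sub a b c x u : a <= b -> c <= x -> rintegrable `[a, x] u -> rintegrable `[b, c] u.
Proof. by move=> ab cx iu; apply: integrableS iu => //; exact: itv_sub. Qed.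

Lemma Rint_split a b c u : a <= b -> b <= c -> rintegrable `[a, c] u ->
  \int[mu]_(x in `[a, c]) u x = \int[mu]_(x in `[a, b]) u x + \int[mu]_(x in `[b, c]) u x.
Proof.
move=> ab bc iu.
have := @Rintegral_itvB R u (BLeft a) (BRight c) b iu; rewrite !bnd_simp => /(_ ab bc).
have iu' : rintegrable `]b, c] u.
  apply: integrableS iu => //; move=> y /=; rewrite !in_itv /= => /andP[? ?]; apply/andP; split; lra.
rewrite (Rintegral_itv_obnd_cbnd iu'); lra.
Qed.

Lemma cint_split a b c f : a <= b -> b <= c -> cintegrable `[a, c] f ->
  cintegral `[a, c] f = cintegral `[a, b] f + cintegral `[b, c] f.
Proof.
by move=> ab bc [h1 h2]; apply: complex_eq; rewrite ?cReD ?cImD /=; exact: Rint_split.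
Qed.

Lemma cint_pt a f : cintegral `[a, a] f = 0.
Proof. by rewrite /cintegral set_itv1 !Rintegral_set1. Qed.

Lemma Rint_pt a u : \int[mu]_(x in `[a, a]) u x = 0.
Proof. by rewrite set_itv1 Rintegral_set1. Qed.

Lemma Rint_le_itv a b c x u : a <= b -> b <= c -> c <= x -> rintegrable `[a, x] u ->
  (forall y, `[a, x]%classic y -> 0 <= u y) -> \int[mu]_(x in `[b, c]) u x <= \int[mu]_(x in `[a, x]) u x.
Proof.
move=> ab bc cx iu u0.
rewrite (Rint_split ab (le_trans bc cx) iu) (Rint_split bc cx (rint_sub ab (lexx x) iu)).
rewrite addrCA lerDl addr_ge0 //; apply: Rintegral_ge0 => y yy; apply: u0; move: yy => /=;
  rewrite !in_itv /= => /andP[? ?]; apply/andP; split; lra.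
Qed.

Lemma Rint_cst a b c : a <= b -> \int[mu]_(x in `[a, b]) c = c * (b - a).
Proof.
move=> ab; rewrite Rintegral_cst //=; congr (_ * _).
rewrite lebesgue_measure_itv /= lte_fin; case: ltP => h //=.
by have -> : a = b by [apply/eqP; rewrite eq_le ab]; rewrite subrr.
Qed.

Definition ccts a b f := {within `[a, b], continuous (fun x => Re (f x))} /\
   {within `[a, b], continuous (fun x => Im (f x))}.

Lemma ccts_meas a b f : ccts a b f -> cmeasurable `[a, b] f.
Proof. by move=> [h1 h2]; split; exact: subspace_continuous_measurable_fun. Qed.

Lemma rcts_bounded a b u : a <= b -> {within `[a, b], continuous u} ->
  exists2 M, 0 <= M & forall x, x \in `[a, b] -> `|u x| <= M.
Proof.
move=> ab cu; have [c1 _ h1] := EVT_max ab cu; have [c2 _ h2] := EVT_min ab cu.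
exists (Num.max `|u c1| `|u c2|) => [|x xab]; first by rewrite le_max normr_ge0.
have := h1 x xab; have := h2 x xab; have := ler_norm (u c1); have := ler_norm (- u c2).
rewrite normrN => ? ? ? ?; rewrite le_max !ler_norml.
have [u0|u0] := leP 0 (u x); [apply/orP; left|apply/orP; right]; apply/andP; split; lra.
Qed.

Lemma ccts_bounded a b f : a <= b -> ccts a b f ->
  exists2 M, 0 <= M & forall x, x \in `[a, b] -> cmod (f x) <= M.
Proof.
move=> ab [/(rcts_bounded ab)[M M0 MP] /(rcts_bounded ab)[N N0 NP]].
exists (M + N) => [|x xab]; first by rewrite addr_ge0.
by rewrite (le_trans (cmod_le_ReIm _)) // lerD ?MP ?NP.
Qed.

Lemma ccts_integrable a b f : a <= b -> ccts a b f -> cintegrable `[a, b] f.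
Proof.
move=> ab cf; have [M M0 MP] := ccts_bounded ab cf.
apply: (@cintegrable_le _ _ (fun=> M)) => //; first exact: ccts_meas.
exact: rintegrable_cst.
Qed.

Lemma cctsD a b f g : ccts a b f -> ccts a b g -> ccts a b (fun x => f x + g x).
Proof.
move=> [f1 f2] [g1 g2]; split => x.
  by under [X in _ X]eq_fun do rewrite cReD; apply: cvgD; [exact: f1|exact: g1].
by under [X in _ X]eq_fun do rewrite cImD; apply: cvgD; [exact: f2|exact: g2].
Qed.

Lemma cctsM a b f g : ccts a b f -> ccts a b g -> ccts a b (fun x => f x * g x).
Proof.
move=> [f1 f2] [g1 g2]; split => x.
  under [X in _ X]eq_fun do rewrite cReM.
  by apply: cvgB; apply: cvgM; [exact: f1|exact: g1|exact: f2|exact: g2].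
under [X in _ X]eq_fun do rewrite cImM.
by apply: cvgD; apply: cvgM; [exact: f1|exact: g2|exact: f2|exact: g1].
Qed.

Lemma ccts_cst a b k : ccts a b (fun=> k).
Proof. by split => x; apply: cvg_cst. Qed.

Lemma ccts_int a b f : a <= b -> cintegrable `[a, b] f -> ccts a b (fun x => cintegral `[a, x] f).
Proof. by move=> ab [h1 h2]; split; exact: parameterized_integral_continuous. Qed.

End ComplexIntegral.

(** * Absolutely continuous functions *)

Section AbsolutelyContinuous.
Variables (R : realType) (T : R).
Hypothesis T0 : 0 <= T.
Local Notation C := R[i].
Local Notation mu := (@lebesgue_measure R).
Local Notation Re := complex.Re.
Local Notation Im := complex.Im.
Implicit Types (f g : R -> C) (u v : R -> R) (a b c x y : R) (k : C).
Local Notation ac := (ac_with_deriv T).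

(** Bisecting an interval into two parts of equal nu-length halves the bound on
    the increment of h. After n bisections the increment is at most 2^-n times
    the first bound. *)
Lemma bisect_const (h : R -> C) (nu : R -> R) : {within `[0, T], continuous nu} ->
  (forall x y, 0 <= x -> x <= y -> y <= T -> nu x <= nu y) ->
  (forall x y, 0 <= x -> x <= y -> y <= T -> cmod (h y - h x) <= (nu y - nu x) ^+ 2) ->
  forall x, x \in `[0, T] -> h x = h 0.
Proof.
move=> cnu mnu hnu.
have key n : forall x y, 0 <= x -> x <= y -> y <= T ->
    cmod (h y - h x) <= (nu y - nu x) ^+ 2 * 2^-1 ^+ n.
  elim: n => [|n IH] x y x0 xy yT; first by rewrite expr0 mulr1 hnu.
  have cnu' : {within `[x, y], continuous nu}.
    by apply: continuous_subspaceW cnu; exact: itv_sub.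
  have nxy := mnu x y x0 xy yT.
  have [|c] := @IVT R nu x y ((nu x + nu y) / 2) xy cnu'.
    by rewrite (min_idPl nxy) (max_idPr nxy); apply/andP; split; lra.
  rewrite in_itv /= => /andP[xc cy] nc.
  have h1 := IH x c x0 xc (le_trans cy yT).
  have h2 := IH c y (le_trans x0 xc) cy yT.
  apply: (le_trans (le_cmod_dist _ (h c) _)); rewrite (exprSr 2^-1).
  move: h1 h2; rewrite nc; set p := 2^-1 ^+ n.
  set A := nu x; set B := nu y => h1 h2.
  have -> : (B - A) ^+ 2 * (p / 2) = ((A + B) / 2 - A) ^+ 2 * p + (B - (A + B) / 2) ^+ 2 * p.
    by field.
  by rewrite addrC; apply: lerD.
move=> x; rewrite in_itv /= => /andP[x0 xT]; apply/eqP; rewrite -subr_eq0 -cmod_eq0.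
rewrite eq_le cmod_ge0 andbT leNgt; apply/negP => h0.
set M := (nu x - nu 0) ^+ 2 + 1.
have M0 : 0 < M by rewrite ltr_pwDr // sqr_ge0.
have [n nP] := half_pow_small (divr_gt0 h0 M0).
have := key n 0 x (lexx 0) x0 xT; rewrite ltr_pdivlMr // in nP.
have : 0 <= 2^-1 ^+ n :> R by rewrite exprn_ge0 // invr_ge0.
rewrite /M in nP; set p := _ ^+ n in nP *; move: nP; lra.
Qed.

Lemma ac_int f g : ac f g -> cintegrable `[0, T] g. Proof. by case. Qed.

Lemma ac_incr f g x y : ac f g -> 0 <= x -> x <= y -> y <= T ->
  f y - f x = cintegral `[x, y] g.
Proof.
move=> [ig fg] x0 xy yT.
have xI : x \in `[0, T] by rewrite in_itv /=; apply/andP; split; lra.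
have yI : y \in `[0, T] by rewrite in_itv /=; apply/andP; split; lra.
rewrite (fg x xI) (fg y yI).
by rewrite (cint_split x0 xy (cint_sub (lexx 0) yT ig)); ring.
Qed.

Lemma rint_cmod_sub g x y : cintegrable `[0, T] g -> 0 <= x -> y <= T ->
  rintegrable `[x, y] (fun t => cmod (g t)).
Proof. by move=> ig x0 yT; apply: rintegrable_cmod => //; exact: cint_sub ig. Qed.

Lemma ac_incr_norm f g x y : ac f g -> 0 <= x -> x <= y -> y <= T ->
  cmod (f y - f x) <= \int[mu]_(t in `[x, y]) cmod (g t).
Proof.
move=> fg x0 xy yT; rewrite (ac_incr fg) //; apply: cintegral_norm => //.
exact: cint_sub (ac_int fg).
Qed.

Lemma eq_ccts a b f g : (forall x, x \in `[a, b] -> f x = g x) -> ccts a b f -> ccts a b g.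
Proof.
move=> fg [h1 h2]; split.
  have E : {in `[a, b]%classic, (fun x => Re (f x)) =1 (fun x => Re (g x))}.
    by move=> x; rewrite inE => /fg ->.
  exact: subspace_eq_continuous E h1.
have E : {in `[a, b]%classic, (fun x => Im (f x)) =1 (fun x => Im (g x))}.
  by move=> x; rewrite inE => /fg ->.
exact: subspace_eq_continuous E h2.
Qed.

Lemma ac_cts f g : ac f g -> ccts 0 T f.
Proof.
move=> [ig fg]; apply: (@eq_ccts _ _ (fun x => f 0 + cintegral `[0, x] g)).
  by move=> x /fg ->.
by apply: cctsD; [exact: ccts_cst|exact: ccts_int].
Qed.

Lemma ac_primitive k g : cintegrable `[0, T] g -> ac (fun x => k + cintegral `[0, x] g) g.
Proof. by move=> ig; split=> // x _; rewrite cint_pt addr0. Qed.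

Lemma ac_eq_deriv f g g' : ac f g -> cmeasurable `[0, T] g' ->
  {ae mu, forall x, x \in `[0, T] -> g x = g' x} -> ac f g'.
Proof.
move=> [ig fg] mg gg'; split; first exact: (cintegrable_ae _ ig).
move=> x xT; rewrite fg //; congr (_ + _); move: xT; rewrite in_itv /= => /andP[x0 xT].
have sub := itv_sub (lexx 0) xT.
apply: cintegral_ae => //.
- by apply: cmeasurableS sub (cintegrable_meas ig).
- by apply: cmeasurableS sub mg.
- by apply: ae_imp gg' => y gy /sub yT; exact: gy.
Qed.

Lemma ac_cst k : ac (fun=> k) (fun=> 0).
Proof.
split; first by apply: ccts_integrable => //; exact: ccts_cst.
by move=> x _; rewrite /cintegral !Rintegral_cst // !mul0r addr0.
Qed.

Lemma acD f g f' g' : ac f g -> ac f' g' ->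
  ac (fun x => f x + f' x) (fun x => g x + g' x).
Proof.
move=> [ig fg] [ig' fg']; split; first exact: cintegrableD.
move=> x xT; rewrite fg // fg' // addrACA -cintegralD //.
  by move: xT; rewrite in_itv /= => /andP[x0 xT]; exact: cint_sub ig.
by move: xT; rewrite in_itv /= => /andP[x0 xT]; exact: cint_sub ig'.
Qed.

Lemma acZ k f g : ac f g -> ac (fun x => k * f x) (fun x => k * g x).
Proof.
move=> [ig fg]; split; first exact: cintegrableZ.
move=> x xT; rewrite fg // mulrDr -cintegralZ //.
by move: xT; rewrite in_itv /= => /andP[x0 xT]; exact: cint_sub ig.
Qed.

Lemma acB f g f' g' : ac f g -> ac f' g' ->
  ac (fun x => f x - f' x) (fun x => g x - g' x).
Proof.
move=> h1 /(acZ (-1)) h2.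
have [i1 i2] := acD h1 h2; split.
  by apply: eq_cintegrable i1 => // x _; rewrite mulN1r.
move=> x xT; have := i2 x xT; rewrite !mulN1r => ->; congr (_ + _).
by apply: eq_cintegral => y _; rewrite mulN1r.
Qed.

Lemma ac_mul_int f g : ccts 0 T f -> cintegrable `[0, T] g -> cintegrable `[0, T] (fun x => f x * g x).
Proof.
move=> cf ig; have [M _ MP] := ccts_bounded T0 cf.
by apply: (cintegrableM_bounded (M := M)) => //; exact: ccts_meas.
Qed.

(** The difference h between the product and the integral of its expected
    derivative satisfies |h(b) - h(a)| <= (nu(b) - nu(a))^2, where nu is the
    integral of |g| + |g'|; so bisect_const applies. *)
Lemma acM f g f' g' : ac f g -> ac f' g' ->
  ac (fun x => f x * f' x) (fun x => g x * f' x + f x * g' x).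
Proof.
move=> fg fg'; have [cf cf'] := (ac_cts fg, ac_cts fg').
have [ig ig'] := (ac_int fg, ac_int fg').
have i1 : cintegrable `[0, T] (fun x => g x * f' x).
  apply: (@eq_cintegrable _ _ (fun x => f' x * g x)) => //.
    by move=> x _; rewrite mulrC.
  exact: ac_mul_int.
have i2 := ac_mul_int cf ig'.
have i12 := cintegrableD (measurable_itv _) i1 i2.
split=> // x xT.
pose w t := cmod (g t) + cmod (g' t).
have iw : rintegrable `[0, T] w by apply: rintegrableD => //; exact: rintegrable_cmod.
pose nu x := \int[mu]_(t in `[0, x]) w t.
have w0 t : 0 <= w t by rewrite addr_ge0 ?cmod_ge0.
have nuE a b : 0 <= a -> a <= b -> b <= T -> nu b - nu a = \int[mu]_(t in `[a, b]) w t.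
  by move=> a0 ab bT; rewrite /nu (Rint_split a0 ab (rint_sub (lexx 0) bT iw)); ring.
pose h x := f x * f' x - cintegral `[0, x] (fun x => g x * f' x + f x * g' x).
suff : h x = h 0 by rewrite /h cint_pt subr0 => /eqP; rewrite subr_eq => /eqP.
apply: (@bisect_const h nu) => //.
- exact: parameterized_integral_continuous.
- move=> a b a0 ab bT; rewrite -subr_ge0 nuE //; apply: Rintegral_ge0 => t _; exact: w0.
move=> a b a0 ab bT.
have sub := itv_sub a0 bT.
have iab e : cintegrable `[0, T] e -> cintegrable `[a, b] e by exact: cint_sub.
have -> : h b - h a = cintegral `[a, b] (fun t => (f' b - f' t) * g t + (f a - f t) * g' t).
  rewrite cintegralD //; last 2 first.
  - apply: (@eq_cintegrable _ _ (fun t => f' b * g t - g t * f' t)) => //.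
      by move=> t _; ring.
    apply: (@eq_cintegrable _ _ (fun t => f' b * g t + -1 * (g t * f' t))) => //.
      by move=> t _; ring.
    by apply: cintegrableD => //; apply: cintegrableZ => //; exact: iab.
  - apply: (@eq_cintegrable _ _ (fun t => f a * g' t + -1 * (f t * g' t))) => //.
      by move=> t _; ring.
    by apply: cintegrableD => //; apply: cintegrableZ => //; exact: iab.
  have -> : cintegral `[a, b] (fun t => (f' b - f' t) * g t) =
      f' b * (f b - f a) - cintegral `[a, b] (fun t => g t * f' t).
    rewrite (ac_incr fg) // -cintegralZ //; last exact: iab.
    rewrite -[X in _ = _ - X]mul1r -mulNr -cintegralZ //; last exact: iab.
    rewrite -cintegralD //; try by apply: cintegrableZ => //; exact: iab.
    by apply: eq_cintegral => t _; ring.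
  have -> : cintegral `[a, b] (fun t => (f a - f t) * g' t) =
      f a * (f' b - f' a) - cintegral `[a, b] (fun t => f t * g' t).
    rewrite (ac_incr fg') // -cintegralZ //; last exact: iab.
    rewrite -[X in _ = _ - X]mul1r -mulNr -cintegralZ //; last exact: iab.
    rewrite -cintegralD //; try by apply: cintegrableZ => //; exact: iab.
    by apply: eq_cintegral => t _; ring.
  rewrite /h (cint_split a0 ab) //; last exact: cint_sub i12.
  rewrite (@cintegralD _ `[a, b]) //; [|exact: iab|exact: iab].
  by ring.
have bound e e' s t : ac e e' -> (forall x, cmod (e' x) <= w x) -> a <= s -> s <= t -> t <= b ->
    cmod (e t - e s) <= nu b - nu a.
  move=> ee ew as_ st tb; apply: (le_trans (ac_incr_norm ee _ st _)); rewrite ?(le_trans a0 as_) ?(le_trans tb bT) //.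
  rewrite nuE //; apply: (@le_trans _ _ (\int[mu]_(x in `[s, t]) w x)).
    apply: le_Rintegral => //; [|exact: rint_sub (le_trans a0 as_) (le_trans tb bT) iw].
    exact: rint_cmod_sub (ac_int ee) (le_trans a0 as_) (le_trans tb bT).
  by apply: Rint_le_itv => //; exact: rint_sub iw.
have gw t : cmod (g t) <= w t by rewrite lerDl cmod_ge0.
have gw' t : cmod (g' t) <= w t by rewrite lerDr cmod_ge0.
have N0 : 0 <= nu b - nu a by rewrite nuE //; apply: Rintegral_ge0 => t _; exact: w0.
rewrite expr2 [X in _ * X]nuE // -RintegralZl //; last exact: rint_sub iw.
apply: cintegral_norm_le => //.
- apply: (@eq_cintegrable _ _ (fun t => (f' b * g t + f a * g' t) + -1 * (g t * f' t + f t * g' t))) => //.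
    by move=> t _; ring.
  apply: cintegrableD => //; last by apply: cintegrableZ => //; exact: iab.
  by apply: cintegrableD => //; apply: cintegrableZ => //; exact: iab.
- by apply: rintegrableZ => //; exact: rint_sub iw.
move=> t /=; rewrite in_itv /= => /andP[at_ tb].
apply: (le_trans (cmodD _ _)); rewrite !cmodM /w mulrDr; apply: lerD.
  by rewrite ler_wpM2r ?cmod_ge0 //; exact: bound fg' gw' _ tb _.
by rewrite ler_wpM2r ?cmod_ge0 // cmodB; exact: bound fg gw _ at_ tb.
Qed.

Lemma is_derive_cts (u v : R -> R) : (forall x, is_derive x 1 u (v x)) -> continuous u.
Proof. by move=> duv x; apply: differentiable_continuous; apply/derivable1_diffP; have [] := duv x. Qed.

Lemma ac_C1 f g : (forall x, is_derive x 1 (fun t => Re (f t)) (Re (g x))) ->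
  (forall x, is_derive x 1 (fun t => Im (f t)) (Im (g x))) ->
  ccts 0 T g -> ac f g.
Proof.
move=> d1 d2 cg; split; first exact: ccts_integrable.
move=> x; rewrite in_itv /= => /andP[x0 xT].
have [->|xn] := eqVneq x 0; first by rewrite cint_pt addr0.
have x0' : 0 < x by rewrite lt_def xn.
have main u v : (forall x, is_derive x 1 u (v x)) -> {within `[0, T], continuous v} ->
    \int[mu]_(t in `[0, x]) v t = u x - u 0.
  move=> duv cv; rewrite /Rintegral (@continuous_FTC2 _ v u) //.
  - by apply: continuous_subspaceW cv; exact: itv_sub.
  - have cu := is_derive_cts duv; split.
    + by move=> y _; have [] := duv y.
    + exact: cvg_at_right_filter (cu 0).
    + exact: cvg_at_left_filter (cu x).
  - by move=> y _; rewrite derive1E; have [_ ->] := duv y.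
apply: complex_eq; rewrite ?cReD ?cImD /=.
  by rewrite (main _ _ d1 cg.1) addrC subrK.
by rewrite (main _ _ d2 cg.2) addrC subrK.
Qed.

Lemma cont_ccts f : continuous (fun x => Re (f x)) -> continuous (fun x => Im (f x)) -> ccts 0 T f.
Proof. by move=> c1 c2; split; exact: continuous_subspaceT. Qed.

Lemma ac_cexp k : ac (fun x => cexp (k * x%:C)) (fun x => k * cexp (k * x%:C)).
Proof.
set a := Re k; set b := Im k.
have RE x : Re (k * x%:C) = a * x by rewrite mulrC cReZ mulrC.
have IE x : Im (k * x%:C) = b * x by rewrite mulrC cImZ mulrC.
have d1 x : is_derive x 1 (fun t => expR (a * t) * cos (b * t))
   (a * (expR (a * x) * cos (b * x)) - b * (expR (a * x) * sin (b * x))).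
  have da : is_derive x 1 (fun t => a * t) a by apply: is_derive_eq; rewrite /GRing.scale /= mulr1.
  have db : is_derive x 1 (fun t => b * t) b by apply: is_derive_eq; rewrite /GRing.scale /= mulr1.
  have de := is_derive1_comp (is_derive_expR (a * x)) da.
  have dc := is_derive1_comp (is_derive_cos (b * x)) db.
  apply: (is_derive_eq (is_deriveM de dc)); rewrite /GRing.scale /=; ring.
have d2 x : is_derive x 1 (fun t => expR (a * t) * sin (b * t))
   (a * (expR (a * x) * sin (b * x)) + b * (expR (a * x) * cos (b * x))).
  have da : is_derive x 1 (fun t => a * t) a by apply: is_derive_eq; rewrite /GRing.scale /= mulr1.
  have db : is_derive x 1 (fun t => b * t) b by apply: is_derive_eq; rewrite /GRing.scale /= mulr1.
  have de := is_derive1_comp (is_derive_expR (a * x)) da.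
  have dc := is_derive1_comp (is_derive_sin (b * x)) db.
  apply: (is_derive_eq (is_deriveM de dc)); rewrite /GRing.scale /=; ring.
have e1 : (fun x => Re (cexp (k * x%:C))) = (fun t => expR (a * t) * cos (b * t)).
  by apply/funext => x; rewrite /cexp RE IE.
have e2 : (fun x => Im (cexp (k * x%:C))) = (fun t => expR (a * t) * sin (b * t)).
  by apply/funext => x; rewrite /cexp RE IE.
apply: ac_C1.
- by move=> x; rewrite e1 cReM /cexp RE IE /=; exact: d1.
- move=> x; rewrite e2 cImM /cexp RE IE /= ; exact: d2.
- apply: cctsM; first exact: ccts_cst.
  apply: cont_ccts.
    by rewrite e1; exact: is_derive_cts d1.
  by rewrite e2; exact: is_derive_cts d2.
Qed.

End AbsolutelyContinuous.

(** * Riemann-Stieltjes forms *)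

Section RiemannStieltjes.
Variables (R : realType) (T : R).
Hypothesis T0 : 0 < T.
Local Notation C := R[i].
Local Notation mu := (@lebesgue_measure R).
Local Notation Re := complex.Re.
Local Notation Im := complex.Im.
Implicit Types (s y dy : R -> C) (v : R -> R).
Local Notation ac := (ac_with_deriv T).

(** In the applications v is the total variation of s. Since s = v - (v - s),
    real and imaginary parts of s are differences of nondecreasing functions,
    which gives measurability and one-sided limits. *)
Definition incr_dominated s v := forall x y : R, 0 <= x -> x <= y -> y <= T -> cmod (s y - s x) <= v y - v x.

Lemma real_bv_dominated (f : R -> R) : bounded_variation 0 T f ->
  exists v : R -> R, forall x y : R, 0 <= x -> x <= y -> y <= T -> `|f y - f x| <= v y - v x.
Proof.
move=> bf; exists (fun x => fine (total_variation 0 x f)) => x y x0 xy yT.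
have fin z : 0 <= z -> z <= T -> total_variation 0 z f \is a fin_num.
  move=> z0 zT; apply/bounded_variationP => //.
  exact: (bounded_variationl z0 zT bf).
have E := @total_variationD R 0 y x f x0 xy.
have fy := fin y (le_trans x0 xy) yT; have fx := fin x x0 (le_trans xy yT).
have fxy : total_variation x y f \is a fin_num.
  by move: fy; rewrite E fin_numD => /andP[].
rewrite E fineD // [leRHS]addrC addKr -lee_fin fineK //.
exact: total_variation_ge.
Qed.

Lemma bv_dominated s : cbounded_variation 0 T s -> exists v, incr_dominated s v.
Proof.
move=> [/real_bv_dominated[v1 h1] /real_bv_dominated[v2 h2]].
exists (fun x => v1 x + v2 x) => x y x0 xy yT.
apply: (le_trans (cmod_le_ReIm _)); rewrite cReB cImB.
by have := lerD (h1 x y x0 xy yT) (h2 x y x0 xy yT); rewrite /=; lra.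
Qed.

Lemma dominated_bounded s v : incr_dominated s v ->
  forall x : R, x \in `[0, T] -> cmod (s x) <= cmod (s 0) + (v T - v 0).
Proof.
move=> sv x; rewrite in_itv /= => /andP[x0 xT].
have h := sv 0 x (lexx 0) x0 xT; have := sv x T x0 xT (lexx T).
have := cmod_ge0 (s T - s x); have := cmodDB (s x) (s 0); lra.
Qed.

Lemma nondecreasing_on_measurable (f : R -> R) :
  (forall x y : R, 0 <= x -> x <= y -> y <= T -> f x <= f y) -> measurable_fun `[0, T] f.
Proof.
move=> ndf; pose cl (x : R) := Num.max 0 (Num.min x T).
have cl0 x : 0 <= cl x by rewrite le_max lexx.
have clT x : cl x <= T by rewrite ge_max (ltW T0) ge_min lexx orbT.
have m : measurable_fun `[0, T] (f \o cl).
  apply: nondecreasing_measurable => // x y xy; apply: ndf => //.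
  by rewrite le_max2 // le_min2.
apply: eq_measurable_fun m => x; rewrite inE /= in_itv /= => /andP[x0 xT].
by rewrite /cl (min_idPl xT) (max_idPr x0).
Qed.

Lemma dominated_measurable s v : incr_dominated s v -> cmeasurable `[0, T] s.
Proof.
move=> sv.
have part (u : C -> R) : (forall z w, u (z - w) = u z - u w) -> (forall z, `|u z| <= cmod z) ->
    measurable_fun `[0, T] (fun x => u (s x)).
  move=> uB ub.
  have -> : (fun x => u (s x)) = (fun x => v x - (v x - u (s x))).
    by apply/funext => x; rewrite opprB addrCA subrr addr0.
  apply: measurable_funB; apply: nondecreasing_on_measurable => x y x0 xy yT.
    by rewrite -subr_ge0; exact: le_trans (cmod_ge0 _) (sv x y x0 xy yT).
  have := le_trans (ub _) (sv x y x0 xy yT); rewrite uB ler_norml => /andP[_]; lra.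
by split; apply: part; [exact: cReB|exact: Re_le_cmod|exact: cImB|exact: Im_le_cmod].
Qed.

Lemma dominated_right_lim s v (e : R) : incr_dominated s v -> 0 < e ->
  exists2 d : R, 0 < d & forall t, 0 < t -> t < d -> t <= T -> cmod (s t - right_lim s 0) <= e.
Proof.
move=> sv e0.
have part (u : C -> R) : (forall z w, u (z - w) = u z - u w) -> (forall z, `|u z| <= cmod z) ->
    cvg (u (s t) @[t --> (0:R)^'+]).
  move=> uB ub.
  have mono (f : R -> R) : (forall x y : R, 0 <= x -> x <= y -> y <= T -> f x <= f y) ->
      cvg (f t @[t --> (0:R)^'+]).
    move=> ndf; apply/cvg_ex; eexists.
    apply: (@nondecreasing_at_right_cvgr R f 0 (BLeft T)).
    - by rewrite bnd_simp.
    - move=> x y; rewrite !in_itv /= => /andP[x0 xT] /andP[y0 yT] xy.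
      by apply: ndf => //; exact: ltW.
    - exists (f 0) => _ [x /= + <-]; rewrite in_itv /= => /andP[x0 xT].
      by apply: ndf => //; exact: ltW.
  have -> : (fun t => u (s t)) = (fun t => v t - (v t - u (s t))).
    by apply/funext => x; rewrite opprB addrCA subrr addr0.
  apply: is_cvgB; apply: mono => x y x0 xy yT.
    by rewrite -subr_ge0; exact: le_trans (cmod_ge0 _) (sv x y x0 xy yT).
  have := le_trans (ub _) (sv x y x0 xy yT); rewrite uB ler_norml => /andP[_]; lra.
have c1 := part _ (@cReB R) (@Re_le_cmod R); have c2 := part _ (@cImB R) (@Im_le_cmod R).
have e2 : 0 < e / 2 by rewrite divr_gt0.
move: c1 => /cvgrPdist_le/(_ _ e2); rewrite near_withinE => -[d1 /= d10 h1].
move: c2 => /cvgrPdist_le/(_ _ e2); rewrite near_withinE => -[d2 /= d20 h2].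
exists (Num.min d1 d2); first by rewrite lt_min d10.
move=> t t0; rewrite lt_min => /andP[t1 t2] tT.
have := h1 t; have := h2 t; rewrite /ball_ /= sub0r normrN gtr0_norm // => /(_ t2 t0) k2 /(_ t1 t0) k1.
apply: (le_trans (cmod_le_ReIm _)); rewrite cReB cImB /= distrC [X in _ + X]distrC.
by rewrite (splitr e) lerD.
Qed.

Lemma partition_nodes p : itv_partition 0 T p -> let N := nth T (0 :: p) in
  [/\ N 0%N = 0, N (size p) = T, forall n, (n < size p)%N -> N n <= N n.+1 &
      forall n, (n <= size p)%N -> 0 <= N n /\ N n <= T].
Proof.
move=> [pp /eqP lp] N.
have N1 n : (n < size p)%N -> N n <= N n.+1.
  by move=> np; apply: ltW; move/(pathP T) : pp => /(_ n np).
have NT : N (size p) = T by rewrite /N -[size p]/(size (0 :: p)).-1 nth_last.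
split; [by []|exact: NT|exact: N1|move=> n np; split].
  elim: n np => [|n IH] np //; apply: (le_trans _ (N1 n np)); apply: IH; exact: ltnW.
have mono k : (n + k <= size p)%N -> N n <= N (n + k)%N.
  elim: k => [|k IH] nk; first by rewrite addn0.
  by rewrite addnS in nk *; apply: le_trans (IH (ltnW nk)) (N1 _ nk).
by rewrite -NT -(subnKC np); apply: mono; rewrite subnKC.
Qed.

(** Uniqueness of the Riemann-Stieltjes integral needs arbitrarily fine tagged
    partitions. *)
Lemma fine_partition_exists (delta : R) : 0 < delta ->
  exists p tau, tagged_partition 0 T delta p tau.
Proof.
move=> d0; pose m := (Num.bound (T / delta)).+1.
have m0 : 0 < m%:R :> R by rewrite ltr0n.
have Tm : T / m%:R < delta.
  rewrite ltr_pdivrMr // mulrC -ltr_pdivrMr //.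
  have := @archi_boundP R (T / delta); rewrite divr_ge0 ?ltW // => /(_ isT) H.
  by rewrite (lt_trans H) // ltr_nat.
clearbody m.
have mn : (0 < m)%N by rewrite -(ltr0n R).
pose p := mkseq (fun k => T * k.+1%:R / m%:R) m.
have nodeE n : (n <= m)%N -> nth T (0 :: p) n = T * n%:R / m%:R.
  by case: n => [|n] nm; [rewrite /= mulr0 mul0r|rewrite /= nth_mkseq].
have step n : (n < m)%N -> nth T (0 :: p) n.+1 - nth T (0 :: p) n = T / m%:R.
  by move=> nm; rewrite !nodeE ?(ltnW nm) // -natr1; field; rewrite gt_eqF.
have Tm0 : 0 < T / m%:R by rewrite divr_gt0.
exists p, (nth T (0 :: p)); split.
  split.
    apply/(pathP T) => n; rewrite size_mkseq => nm.
    by have := step n nm; rewrite -subr_gt0 /= => ->.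
  rewrite (last_nth T) size_mkseq nodeE // mulfK // gt_eqF //.
move=> node n; rewrite size_mkseq => nm; rewrite step //; split=> //.
by rewrite lexx /= -subr_ge0 step // ltW.
Qed.

Lemma is_rs_integral_unique y s (I I' : C) :
  is_rs_integral 0 T y s I -> is_rs_integral 0 T y s I' -> I = I'.
Proof.
move=> H H'; apply/eqP; rewrite -subr_eq0 -cmod_eq0; apply/negPn/negP => n0.
have e0 : 0 < cmod (I - I') / 2 by rewrite divr_gt0 // lt_def n0 cmod_ge0.
have [d d0 dP] := H _ e0; have [d' d'0 d'P] := H' _ e0.
have [p [tau [pp pt]]] := @fine_partition_exists (Num.min d d') ltac:(by rewrite lt_min d0).
have := dP p tau; have := d'P p tau; rewrite !cmod_norm !ltcR.
have t1 : tagged_partition 0 T d p tau.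
  by split=> // node n np; have [? +] := pt n np; rewrite lt_min => /andP[].
have t2 : tagged_partition 0 T d' p tau.
  by split=> // node n np; have [? +] := pt n np; rewrite lt_min => /andP[].
move=> /(_ t2) h2 /(_ t1) h1.
have := le_cmod_dist I (rs_sum 0 T y s p tau) I'; rewrite (cmodB I (rs_sum _ _ _ _ _ _)); lra.
Qed.

(** On a cell [a, b] the tagged term minus the claimed contribution is (y(tau) -
    y(a)) (s(b) - s(a)) minus the integral of (s(b) - s) dy, at most 2 M delta
    (v(b) - v(a)) in modulus; these bounds telescope. *)
Lemma rs_integral_parts y dy s v M : ac y dy -> ccts 0 T dy ->
  (forall t, t \in `[0, T] -> cmod (dy t) <= M) -> incr_dominated s v ->
  is_rs_integral 0 T y s (y T * s T - y 0 * s 0 - cintegral `[0, T] (fun t => s t * dy t)).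
Proof.
move=> yd cdy dyM sv e e0.
have T00 := ltW T0.
have M0 : 0 <= M by apply: le_trans (cmod_ge0 _) (dyM 0 _); rewrite in_itv /= lexx.
set V := v T - v 0.
have V0 : 0 <= V by apply: le_trans (cmod_ge0 _) (sv 0 T (lexx _) T00 (lexx _)).
have K0 : 0 < 2 * M * V + 1 by rewrite ltr_pwDr // !mulr_ge0.
exists (e / (2 * M * V + 1)); first by rewrite divr_gt0.
set delta := e / _.
have dE : delta * (2 * M * V + 1) = e by rewrite /delta divfK // gt_eqF.
have delta0 : 0 < delta by rewrite divr_gt0.
move=> p tau [pp pt]; rewrite cmod_norm ltcR.
have [N0 NT N1 NI] := partition_nodes pp.
set N := nth T (0 :: p) in N0 NT N1 NI.
have isd : cintegrable `[0, T] (fun t => s t * dy t).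
  apply: (cintegrableM_bounded (M := cmod (s 0) + V)) => //.
  - exact: dominated_measurable sv.
  - by move=> x xT; apply: dominated_bounded sv _ xT.
  - exact: ccts_integrable.
pose err n := y (tau n) * (s (N n.+1) - s (N n)) -
  (y (N n.+1) * s (N n.+1) - y (N n) * s (N n) - cintegral `[N n, N n.+1] (fun t => s t * dy t)).
have tele : \sum_(0 <= n < size p) (y (N n.+1) * s (N n.+1) - y (N n) * s (N n)) =
    y T * s T - y 0 * s 0.
  rewrite (telescope_sumr (fun n => y (N n) * s (N n))) //; by rewrite NT N0.
have telei : \sum_(0 <= n < size p) cintegral `[N n, N n.+1] (fun t => s t * dy t) =
    cintegral `[0, T] (fun t => s t * dy t).
  rewrite -[X in _ = cintegral `[_, X] _]NT.
  have : (size p <= size p)%N by [].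
  elim: {1 3 4}(size p) => [|m IH] mp; first by rewrite big_geq // N0 cint_pt.
  rewrite big_nat_recr //= IH ?(ltnW mp) // [RHS](@cint_split _ 0 (N m)) ?N1 //.
  - by have [] := NI m (ltnW mp).
  - by apply: cint_sub isd => //; have [] := NI m.+1 mp.
have -> : rs_sum 0 T y s p tau - (y T * s T - y 0 * s 0 -
    cintegral `[0, T] (fun t => s t * dy t)) = \sum_(0 <= n < size p) err n.
  by rewrite -tele -telei /rs_sum /err -/N !sumrB.
have errB n : (n < size p)%N -> cmod (err n) <= 2 * M * delta * (v (N n.+1) - v (N n)).
  move=> np; have [tn dn] := pt n np; rewrite -/N in tn dn.
  have [a0 aT] := NI n (ltnW np); have [b0 bT] := NI n.+1 np; have ab := N1 n np.
  move/andP: tn => [ta tb]; set a := N n in a0 aT ab ta dn *; set b := N n.+1 in b0 bT ab tb dn *.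
  have iab : cintegrable `[a, b] (fun t => s t * dy t) by exact: cint_sub isd.
  have idab : cintegrable `[a, b] dy by exact: cint_sub (ccts_integrable T00 cdy).
  have -> : err n = (y (tau n) - y a) * (s b - s a) - cintegral `[a, b] (fun t => (s b - s t) * dy t).
    have -> : cintegral `[a, b] (fun t => (s b - s t) * dy t) =
       s b * (y b - y a) - cintegral `[a, b] (fun t => s t * dy t).
      rewrite (ac_incr yd) // -cintegralZ //.
      rewrite -[X in _ = _ - X]mul1r -mulNr -cintegralZ //.
      rewrite -cintegralD //; try exact: cintegrableZ.
      by apply: eq_cintegral => t _; ring.
    by rewrite /err -/a -/b; ring.
  have dyM' x z : a <= x -> z <= b -> forall t, `[x, z]%classic t -> cmod (dy t) <= M.
    move=> ax zb t /=; rewrite in_itv /= => /andP[? ?]; apply: dyM; rewrite in_itv /=.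
    apply/andP; split; lra.
  have h1 : cmod (y (tau n) - y a) <= M * delta.
    rewrite (ac_incr yd) // ?(le_trans tb) //.
    apply: (le_trans (cintegral_norm_le (measurable_itv _) _ (rintegrable_cst _ _ _) (dyM' a (tau n) (lexx a) tb))).
      by apply: cint_sub idab.
    rewrite Rint_cst // ler_wpM2l //; lra.
  have h2 : cmod (s b - s a) <= v b - v a by apply: sv.
  have h3 : cmod (cintegral `[a, b] (fun t => (s b - s t) * dy t)) <= (v b - v a) * M * delta.
    apply: (@le_trans _ _ (\int[mu]_(t in `[a, b]) ((v b - v a) * M))).
      apply: cintegral_norm_le => //.
      - apply: (@eq_cintegrable _ _ (fun t => s b * dy t + -1 * (s t * dy t))) => //.
          by move=> t _; ring.
        by apply: cintegrableD => //; exact: cintegrableZ.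
      - exact: rintegrable_cst.
      - move=> t tab; rewrite cmodM; apply: ler_pM; rewrite ?cmod_ge0 //; last exact: (dyM' a b).
        move: tab; rewrite /= in_itv /= => /andP[at_ tb'].
        have := sv t b (le_trans a0 at_) tb' bT.
        have := sv a t a0 at_ (le_trans tb' bT); have := cmod_ge0 (s t - s a); lra.
    have vba : 0 <= v b - v a by apply: le_trans (cmod_ge0 _) h2.
    by rewrite Rint_cst // ler_wpM2l ?mulr_ge0 // ltW.
  apply: (le_trans (cmodDl _ _)); rewrite cmodM.
  have := ler_pM (cmod_ge0 _) (cmod_ge0 _) h1 h2; lra.
apply: (@le_lt_trans _ _ (2 * M * delta * V)).
  rewrite (le_trans (cmod_sum _ _ _)) //.
  apply: (@le_trans _ _ (\sum_(0 <= n < size p) 2 * M * delta * (v (N n.+1) - v (N n)))).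
    by rewrite big_nat [leRHS]big_nat; apply: ler_sum => n /andP[_ np]; exact: errB.
  by rewrite -mulr_sumr (telescope_sumr (fun n => v (N n))) // NT N0.
have := mulr_ge0 (mulr_ge0 (ler0n R 2) M0) V0; lra.
Qed.

Lemma U_parts y dy s : ac y dy -> ccts 0 T dy -> cbounded_variation 0 T s ->
  U T s y = y T * s T - y 0 * s 0 - cintegral `[0, T] (fun t => s t * dy t).
Proof.
move=> yd cdy /bv_dominated[v sv]; have [M _ MP] := ccts_bounded (ltW T0) cdy.
have H := rs_integral_parts yd cdy MP sv.
rewrite /U /rs_integral; apply: (xget_unique _ H) => I HI.
exact: is_rs_integral_unique HI H.
Qed.

(** Subtracting the constant s(0+) from s in the formula of U_parts isolates the
    mass at 0. *)
Lemma U_jump y dy s : ac y dy -> ccts 0 T dy -> cbounded_variation 0 T s ->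
  U T s y = jump0 s * y 0 + (s T - right_lim s 0) * y T -
     cintegral `[0, T] (fun t => (s t - right_lim s 0) * dy t).
Proof.
move=> yd cdy bs; rewrite (U_parts yd cdy bs); have [v sv] := bv_dominated bs.
set s0 := right_lim s 0.
have T00 := ltW T0.
have idy := ccts_integrable T00 cdy.
have isd : cintegrable `[0, T] (fun t => s t * dy t).
  apply: (cintegrableM_bounded (M := cmod (s 0) + (v T - v 0))) => //.
  - exact: dominated_measurable sv.
  - by move=> x xT; apply: dominated_bounded sv _ xT.
have -> : cintegral `[0, T] (fun t => (s t - s0) * dy t) =
    cintegral `[0, T] (fun t => s t * dy t) - s0 * (y T - y 0).
  rewrite (ac_incr yd) // -mulNr -cintegralZ // -cintegralD //; last exact: cintegrableZ.
  by apply: eq_cintegral => t _; ring.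
by rewrite /jump0 -/s0; ring.
Qed.
End RiemannStieltjes.

(** * Solutions of the Sturm-Liouville equation *)

Section Solutions.
Variables (R : realType) (T : R).
Hypothesis T0 : 0 < T.
Local Notation C := R[i].
Local Notation mu := (@lebesgue_measure R).
Local Notation Re := complex.Re.
Local Notation Im := complex.Im.
Local Notation ac := (ac_with_deriv T).
Implicit Types (q y dy s f g : R -> C) (l k a b : C) (x r : R).

Lemma ae_neq (c : R) : {ae mu, forall x, x != c}.
Proof.
exists [set c]; split => //=; first exact: lebesgue_measure_set1.
by move=> x /= /negP; rewrite negbK => /eqP.
Qed.

Lemma ae_oo_cc (P : R -> Prop) : {ae mu, forall x, x \in `]0, T[ -> P x} ->
  {ae mu, forall x, x \in `[0, T] -> P x}.
Proof.
move=> /ae_and/(_ (ae_neq 0))/ae_and/(_ (ae_neq T)); apply: ae_imp => x [[h x0] xT].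
rewrite in_itv /= => /andP[h0 hT]; apply: h; rewrite in_itv /= !lt_neqAle h0 hT xT.
by rewrite eq_sym x0.
Qed.

(** Extension by 0, integrable on the closed interval. *)
Definition trunc q : R -> C := fun x => if x \in `]0, T[ then q x else 0.

Lemma trunc_integrable q : cintegrable `]0, T[ q -> cintegrable `[0, T] (trunc q).
Proof.
have part (u : R -> R) : mu.-integrable `]0, T[ (EFin \o u) ->
    mu.-integrable `[0, T] (EFin \o (fun x => if x \in `]0, T[ then u x else 0)).
  move=> iu; apply: (@integrableS _ _ _ _ setT) => //.
  have [h _] := @integrable_mkcond _ _ R mu `]0, T[%classic (EFin \o u) (measurable_itv _).
  move: (h iu).
  apply: eq_integrable => // x _; rewrite /patch /=.
  by rewrite mem_setE; case: ifP.
move=> [h1 h2]; split.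
  by have := part _ h1; congr (_.-integrable _ _); apply/funext => x; rewrite /= /trunc; case: ifP.
by have := part _ h2; congr (_.-integrable _ _); apply/funext => x; rewrite /= /trunc; case: ifP.
Qed.

(** The equation with the second derivative written out; sl_solutionP relates it
    to sl_solution. *)
Definition slsol q l y dy := ac y dy /\ ac dy (fun x => (q x - l) * y x).

Lemma qy_integrable q l y : cintegrable `[0, T] q -> ccts 0 T y ->
  cintegrable `[0, T] (fun x => (q x - l) * y x).
Proof.
move=> iq cy; apply: (@eq_cintegrable _ _ (fun x => y x * (q x + - l))) => //.
  by move=> x _; rewrite mulrC.
apply: (ac_mul_int (ltW T0)) => //; apply: cintegrableD => //.
by apply: ccts_integrable; [exact: ltW|exact: ccts_cst].
Qed.

Lemma sl_solutionP q l y dy : cintegrable `]0, T[ q ->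
  sl_solution T q l y dy <-> slsol (trunc q) l y dy.
Proof.
move=> /trunc_integrable iq; split.
  move=> [ydy [d2y dd qd]]; split=> //; apply: (ac_eq_deriv dd).
    apply: cintegrable_meas; apply: qy_integrable => //. exact (ac_cts (ltW T0) ydy).
  apply: ae_oo_cc; apply: ae_imp qd => x h xT; have := h xT; rewrite /trunc xT => /eqP.
  rewrite addrC subr_eq => /eqP E; rewrite mulrBl E; ring.
move=> [ydy dd]; split=> //; exists (fun x => (trunc q x - l) * y x) => //.
apply: ae_imp (ae_neq 0) => x _ xT; rewrite /trunc xT; ring.
Qed.

Variable q : R -> C.
Hypothesis iq : cintegrable `[0, T] q.

Lemma slsol_lin l a b y dy z dz : slsol q l y dy -> slsol q l z dz ->
  slsol q l (fun x => a * y x + b * z x) (fun x => a * dy x + b * dz x).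
Proof.
move=> [h1 h2] [h3 h4]; split; first by apply: acD; exact: acZ.
have := acD (acZ a h2) (acZ b h4); congr ac_with_deriv.
by apply/funext => x; ring.
Qed.

Lemma slsol_cts l y dy : slsol q l y dy -> ccts 0 T y /\ ccts 0 T dy.
Proof. by move=> [h1 h2]; split; [exact: (ac_cts (ltW T0) h1)|exact: (ac_cts (ltW T0) h2)]. Qed.

Lemma ac_zero_const f g : ac f g -> (forall x, g x = 0) -> forall x, x \in `[0, T] -> f x = f 0.
Proof.
move=> [_ fg] g0 x xT; rewrite fg // (@eq_cintegral _ _ _ (fun=> 0)) //.
have [_ h] := @ac_cst R T (ltW T0) 0; have := h x xT; rewrite add0r => <-.
by rewrite addr0.
Qed.

Lemma wronskian l y dy z dz : slsol q l y dy -> slsol q l z dz ->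
  forall x, x \in `[0, T] -> y x * dz x - dy x * z x = y 0 * dz 0 - dy 0 * z 0.
Proof.
move=> [h1 h2] [h3 h4].
have := acB (acM (ltW T0) h1 h4) (acM (ltW T0) h2 h3).
by move/ac_zero_const; apply => x; ring.
Qed.

(** Cramer's rule, with coefficients that are constant Wronskians. *)
Lemma slsol_basis l y dy y1 dy1 y2 dy2 :
  slsol q l y dy -> slsol q l y1 dy1 -> slsol q l y2 dy2 ->
  y1 0 = 1 -> dy1 0 = 0 -> y2 0 = 0 -> dy2 0 = 1 ->
  forall x, x \in `[0, T] ->
    y x = y 0 * y1 x + dy 0 * y2 x /\ dy x = y 0 * dy1 x + dy 0 * dy2 x.
Proof.
move=> s s1 s2 a1 b1 a2 b2 x xT.
have := wronskian s1 s2 xT; rewrite a1 b1 a2 b2 mulr0 subr0 mulr1 => W.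
have := wronskian s s1 xT; rewrite a1 b1 mulr0 sub0r mulr1 => W1.
have := wronskian s s2 xT; rewrite a2 b2 mulr0 subr0 mulr1 => W2.
rewrite -W2; have -> : dy 0 = - (y x * dy1 x - dy x * y1 x) by rewrite W1 opprK.
split.
  transitivity (y x * (y1 x * dy2 x - dy1 x * y2 x)); first by rewrite W mulr1.
  by ring.
transitivity (dy x * (y1 x * dy2 x - dy1 x * y2 x)); first by rewrite W mulr1.
by ring.
Qed.

(** Iterates of the pair (y, y') for the first-order system. *)
Fixpoint picard (a b : C) (n : nat) l : (R -> C) * (R -> C) :=
  if n is n'.+1 then
    let Y := picard a b n' l in
    (fun x => a + cintegral `[0, x] Y.2, fun x => b + cintegral `[0, x] (fun t => (q t - l) * Y.1 t))
  else (fun=> a, fun=> b).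

Lemma picard_ac a b n l :
  ac (picard a b n.+1 l).1 (picard a b n l).2 /\
  ac (picard a b n.+1 l).2 (fun t => (q t - l) * (picard a b n l).1 t).
Proof.
have cts m : ccts 0 T (picard a b m l).1 /\ ccts 0 T (picard a b m l).2.
  elim: m => [|m [IH1 IH2]] /=; first by split; exact: ccts_cst.
  split; apply: cctsD; [exact: ccts_cst| |exact: ccts_cst|]; apply: ccts_int.
  - exact: ltW.
  - by apply: ccts_integrable => //; exact: ltW.
  - exact: ltW.
  - exact: qy_integrable.
have [c1 c2] := cts n; split; apply: ac_primitive.
  by apply: ccts_integrable => //; exact: ltW.
exact: qy_integrable.
Qed.

Lemma picard_cts a b n l : ccts 0 T (picard a b n l).1 /\ ccts 0 T (picard a b n l).2.
Proof.
case: n => [|n]; first by split; exact: ccts_cst.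
by have [h1 h2] := picard_ac a b n l; split; [exact: (ac_cts (ltW T0) h1)|exact: (ac_cts (ltW T0) h2)].
Qed.

Lemma acX f g n : ac f g -> ac (fun x => f x ^+ n.+1) (fun x => n.+1%:R * f x ^+ n * g x).
Proof.
move=> fg; elim: n => [|n IH].
  by have := fg; congr ac_with_deriv; apply/funext => x; rewrite ?expr1 // expr0 !mul1r.
have := acM (ltW T0) fg IH; congr ac_with_deriv; apply/funext => x.
have -> : n.+2%:R = n.+1%:R + 1 :> C by rewrite natr1.
by rewrite exprS; ring.
Qed.

(** Turns factorial decay into a geometric rate. *)
Lemma pow_fact_bound (M : R) n : 0 <= M -> M ^+ n / n`!%:R <= expR (2 * M) * 2^-1 ^+ n.
Proof.
move=> M0; have M2 : 0 <= 2 * M by rewrite mulr_ge0.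
have : (2 * M) ^+ n / n`!%:R <= expR (2 * M).
  have nd : nondecreasing_seq (series (exp_coeff (2 * M))).
    apply/nondecreasing_seqP => m; rewrite seriesSr lerDl.
    by rewrite exp_coeff_ge0.
  have := nondecreasing_cvgn_le nd (is_cvg_series_exp_coeff _) n.+1.
  apply: le_trans; rewrite seriesSr lerDr.
  by apply: sumr_ge0 => i _; rewrite exp_coeff_ge0.
rewrite exprMn exprVn => h.
have p0 : 0 < 2 ^+ n :> R by rewrite exprn_gt0.
rewrite ler_pdivlMr //; apply: le_trans h; rewrite le_eqVlt; apply/orP; left; apply/eqP; ring.
Qed.

(** The integrand dominates the coefficients of the first-order system for all
    |l| <= r, so that the n-th Picard increment is at most a constant times W^n
    / n!. *)
Definition picard_weight (r : R) (x : R) := \int[mu]_(t in `[0, x]) (1 + cmod (q t) + r).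

Lemma weight_rint r : rintegrable `[0, T] (fun t => 1 + cmod (q t) + r).
Proof.
apply: rintegrableD => //; last exact: rintegrable_cst.
by apply: rintegrableD => //; [exact: rintegrable_cst|exact: rintegrable_cmod].
Qed.

Lemma cintegral_real (D : set R) (u : R -> R) :
  cintegral D (fun x => (u x)%:C) = (\int[mu]_(x in D) u x)%:C.
Proof. by rewrite /cintegral /= /Rintegral integral0. Qed.

Lemma rintegrable_complex D (u : R -> R) : rintegrable D u -> cintegrable D (fun x => (u x)%:C).
Proof. by move=> iu; split => //; exact: integrable0. Qed.

Lemma weight_pow r n x : 0 <= r -> x \in `[0, T] ->
  \int[mu]_(t in `[0, x]) (picard_weight r t ^+ n * (1 + cmod (q t) + r)) =
  picard_weight r x ^+ n.+1 / n.+1%:R /\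
  rintegrable `[0, T] (fun t => picard_weight r t ^+ n * (1 + cmod (q t) + r)).
Proof.
move=> r0 xT; set w := fun t => 1 + cmod (q t) + r; set W := picard_weight r.
have aW : ac (fun x => (W x)%:C) (fun x => (w x)%:C).
  have := ac_primitive 0 (rintegrable_complex (weight_rint r)).
  congr ac_with_deriv; apply/funext => z; rewrite add0r; exact: cintegral_real.
have cW : {within `[0, T], continuous W}.
  exact: (parameterized_integral_continuous (ltW T0) (weight_rint r)).
have i1 : rintegrable `[0, T] (fun t => W t ^+ n * w t).
  have cWn : {within `[0, T], continuous (fun t => W t ^+ n)}.
    elim: (n) => [|m IH]; first by move=> z; apply: cvg_cst.
    have -> : (fun t => W t ^+ m.+1) = (fun t => W t * W t ^+ m).
      by apply/funext => t; rewrite exprS.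
    by move=> z; apply: cvgM; [exact: cW|exact: IH].
  have [M _ MP] := rcts_bounded (ltW T0) cWn.
  apply: (@rintegrable_le _ _ _ (fun t => M * w t)) => //.
  - apply: measurable_funM; first exact: subspace_continuous_measurable_fun.
    by have /integrableP[/measurable_EFinP] := weight_rint r.
  - move=> t tT; rewrite normrM ler_pM // ?MP //.
    by rewrite ger0_norm // /w !addr_ge0 // cmod_ge0.
  - by apply: rintegrableZ => //; exact: weight_rint.
split=> //.
have n0 : (n.+1%:R : R) != 0 by rewrite pnatr_eq0.
apply: (mulIf n0); rewrite divfK // mulrC -RintegralZl //; last first.
  by apply: (rint_sub (lexx 0) _ i1); move: xT; rewrite in_itv /= => /andP[].
have [_ h] := acX n aW; have := h x xT.
have -> : W 0 = 0 by rewrite /W /picard_weight Rint_pt.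
rewrite expr0n add0r => /(congr1 (@complex.Re R)).
rewrite -rmorphXn /= => ->; congr (Rintegral _ _ _); apply/funext => t.
have -> : (n.+1%:R : C) = (n.+1%:R)%:C by rewrite rmorph_nat.
by rewrite -rmorphXn -!rmorphM /= mulrA.
Qed.
End Solutions.

(** * Existence and analytic dependence on the spectral parameter *)

Section Picard.
Variables (R : realType) (T : R).
Hypothesis T0 : 0 < T.
Local Notation C := R[i].
Local Notation mu := (@lebesgue_measure R).
Local Notation Re := complex.Re.
Local Notation Im := complex.Im.
Local Notation ac := (ac_with_deriv T).
Implicit Types (y dy s f g : R -> C) (l k a b : C) (x r : R) (F : C -> R -> C).
Variable q : R -> C.
Hypothesis iq : cintegrable `[0, T] q.

Local Notation W := (picard_weight q).
Local Notation Y a b n l := (picard q a b n l).1.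
Local Notation DY a b n l := (picard q a b n l).2.

Lemma W_ge0 r x : 0 <= r -> 0 <= W r x.
Proof. by move=> r0; apply: Rintegral_ge0 => t _; rewrite !addr_ge0 // cmod_ge0. Qed.

Lemma W_le r x : 0 <= r -> x \in `[0, T] -> W r x <= W r T.
Proof.
move=> r0; rewrite in_itv /= => /andP[x0 xT].
apply: Rint_le_itv => //; first exact: weight_rint.
by move=> t _; rewrite !addr_ge0 // cmod_ge0.
Qed.

Lemma picard_step r l f g K m x : 0 <= r -> cmod l <= r -> 0 <= K ->
  ccts 0 T f -> ccts 0 T g ->
  (forall t, t \in `[0, T] -> cmod (f t) + cmod (g t) <= K * (W r t ^+ m / m`!%:R)) ->
  x \in `[0, T] ->
  cmod (cintegral `[0, x] g) + cmod (cintegral `[0, x] (fun t => (q t - l) * f t)) <=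
    K * (W r x ^+ m.+1 / m.+1`!%:R).
Proof.
move=> r0 lr K0 cf cg fg xT; have T00 := ltW T0.
have [x0 x1] : 0 <= x /\ x <= T by move: xT; rewrite in_itv /= => /andP[].
have ig := cint_sub (lexx 0) x1 (ccts_integrable T00 cg).
have iqf := cint_sub (lexx 0) x1 (qy_integrable T0 l iq cf).
apply: (le_trans (lerD (cintegral_norm _ ig) (cintegral_norm _ iqf))) => //.
rewrite -RintegralD //; try exact: rintegrable_cmod.
have [wE wi] := weight_pow T0 iq m r0 xT.
have -> : K * (W r x ^+ m.+1 / m.+1`!%:R) =
   \int[mu]_(t in `[0, x]) (K / m`!%:R * (W r t ^+ m * (1 + cmod (q t) + r))).
  rewrite RintegralZl //; last exact: (rint_sub (lexx 0) x1 wi).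
  rewrite wE factS natrM invfM; ring.
apply: le_Rintegral => //.
- by apply: rintegrableD => //; exact: rintegrable_cmod.
- by apply: rintegrableZ => //; exact: (rint_sub (lexx 0) x1 wi).
move=> t /=; rewrite in_itv /= => /andP[t0 tx].
have tT : t \in `[0, T] by rewrite in_itv /= t0 (le_trans tx).
have h := fg t tT; rewrite cmodM.
have h1 : cmod (q t - l) <= cmod (q t) + r by apply: (le_trans (cmodDl _ _)); rewrite lerD2l.
have w1 : 1 <= 1 + cmod (q t) + r by rewrite -addrA lerDl addr_ge0 // cmod_ge0.
apply: (@le_trans _ _ ((cmod (f t) + cmod (g t)) * (1 + cmod (q t) + r))).
  rewrite mulrDl addrC; apply: lerD; last by rewrite ler_peMr ?cmod_ge0.
  by rewrite mulrC ler_wpM2l ?cmod_ge0 //; lra.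
rewrite mulrA ler_wpM2r //; first lra.
by apply: (le_trans h); rewrite mulrAC mulrA.
Qed.

Lemma picard_incr r a b n l x : 0 <= r -> cmod l <= r -> x \in `[0, T] ->
  cmod (Y a b n.+1 l x - Y a b n l x) + cmod (DY a b n.+1 l x - DY a b n l x) <=
  (cmod a + cmod b) * (W r x ^+ n.+1 / n.+1`!%:R).
Proof.
move=> r0 lr; have T00 := ltW T0.
have K0 : 0 <= cmod a + cmod b by rewrite addr_ge0 // cmod_ge0.
elim: n x => [|n IH] x xT.
  rewrite /= [a + _]addrC addrK [b + _]addrC addrK.
  apply: picard_step => //; try exact: ccts_cst.
  by move=> t tT; rewrite expr0 fact0 divr1 mulr1.
have [x0 x1] : 0 <= x /\ x <= T by move: xT; rewrite in_itv /= => /andP[].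
have [c1 c2] := picard_cts T0 iq a b n.+1 l; have [c3 c4] := picard_cts T0 iq a b n l.
have cf : ccts 0 T (fun t => Y a b n.+1 l t + -1 * Y a b n l t).
  by apply: cctsD => //; apply: cctsM => //; exact: ccts_cst.
have cg : ccts 0 T (fun t => DY a b n.+1 l t + -1 * DY a b n l t).
  by apply: cctsD => //; apply: cctsM => //; exact: ccts_cst.
have := @picard_step r l _ _ _ n.+1 x r0 lr K0 cf cg _ xT.
have -> : cintegral `[0, x] (fun t => DY a b n.+1 l t + -1 * DY a b n l t) =
    Y a b n.+2 l x - Y a b n.+1 l x.
  rewrite cintegralD //; last 2 first.
  - exact: (cint_sub (lexx 0) x1 (ccts_integrable T00 c2)).
  - apply: cintegrableZ => //; exact: (cint_sub (lexx 0) x1 (ccts_integrable T00 c4)).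
  rewrite cintegralZ //; last exact: (cint_sub (lexx 0) x1 (ccts_integrable T00 c4)).
  by rewrite /=; ring.
have -> : cintegral `[0, x] (fun t => (q t - l) * (Y a b n.+1 l t + -1 * Y a b n l t)) =
    DY a b n.+2 l x - DY a b n.+1 l x.
  have i1 := cint_sub (lexx 0) x1 (qy_integrable T0 l iq c1).
  have i3 := cint_sub (lexx 0) x1 (qy_integrable T0 l iq c3).
  transitivity (cintegral `[0, x] (fun t => (q t - l) * Y a b n.+1 l t + -1 * ((q t - l) * Y a b n l t))).
    by apply: eq_cintegral => t _; ring.
  rewrite cintegralD //; last exact: cintegrableZ.
  by rewrite cintegralZ //=; ring.
apply => t tT.
by have := IH t tT; rewrite !mulN1r.
Qed.

Definition picard_rate r a b := (cmod a + cmod b) * expR (2 * W r T).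

Lemma picard_rate_ge0 r a b : 0 <= picard_rate r a b.
Proof. by rewrite mulr_ge0 ?addr_ge0 ?cmod_ge0 // expR_ge0. Qed.

Lemma picard_cauchy r a b l n m x : 0 <= r -> cmod l <= r -> x \in `[0, T] -> (n <= m)%N ->
  cmod (Y a b m l x - Y a b n l x) <= picard_rate r a b * 2^-1 ^+ n /\
  cmod (DY a b m l x - DY a b n l x) <= picard_rate r a b * 2^-1 ^+ n.
Proof.
move=> r0 lr xT nm.
have B0 := picard_rate_ge0 r a b.
have incr (k : nat) : cmod (Y a b k.+1 l x - Y a b k l x) + cmod (DY a b k.+1 l x - DY a b k l x) <=
    picard_rate r a b * 2^-1 ^+ k.+1.
  apply: le_trans (picard_incr a b k r0 lr xT) _.
  rewrite /picard_rate -mulrA ler_wpM2l ?addr_ge0 ?cmod_ge0 //.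
  apply: le_trans (pow_fact_bound _ (W_ge0 _ r0)) _.
  rewrite ler_wpM2r ?exprn_ge0 ?invr_ge0 // ler_expR ler_wpM2l //.
  exact: W_le.
suff key : cmod (Y a b m l x - Y a b n l x) <= picard_rate r a b * (2^-1 ^+ n - 2^-1 ^+ m) /\
  cmod (DY a b m l x - DY a b n l x) <= picard_rate r a b * (2^-1 ^+ n - 2^-1 ^+ m).
  have p0 : 0 <= 2^-1 ^+ m :> R by rewrite exprn_ge0 // invr_ge0.
  have le : picard_rate r a b * (2^-1 ^+ n - 2^-1 ^+ m) <= picard_rate r a b * 2^-1 ^+ n.
    by rewrite ler_wpM2l // gerBl.
  by case: key => h1 h2; split; [exact: le_trans h1 le|exact: le_trans h2 le].
elim: m nm => [|m IH]; first by rewrite leqn0 => /eqP ->; rewrite !subrr cmod0 mulr0.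
rewrite leq_eqVlt => /orP[/eqP ->|]; first by rewrite !subrr cmod0 mulr0.
rewrite ltnS => /IH[h1 h2].
have h3 := incr m.
have E : picard_rate r a b * (2^-1 ^+ n - 2^-1 ^+ m.+1) =
    picard_rate r a b * 2^-1 ^+ m.+1 + picard_rate r a b * (2^-1 ^+ n - 2^-1 ^+ m).
  by rewrite exprSr; field.
rewrite E; split.
  apply: (le_trans (le_cmod_dist _ (Y a b m l x) _)); apply: lerD h1.
  by apply: le_trans h3; rewrite lerDl cmod_ge0.
apply: (le_trans (le_cmod_dist _ (DY a b m l x) _)); apply: lerD h2.
by apply: le_trans h3; rewrite lerDr cmod_ge0.
Qed.

Lemma ccts_ulim (f_ : nat -> R -> C) f B : (forall n, ccts 0 T (f_ n)) ->
  (forall n x, x \in `[0, T] -> cmod (f x - f_ n x) <= B * 2^-1 ^+ n) -> 0 <= B -> ccts 0 T f.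
Proof.
move=> cf ff B0.
have part (u : C -> R) : (forall z w, u (z - w) = u z - u w) -> (forall z, `|u z| <= cmod z) ->
    (forall n, {within `[0, T], continuous (fun x => u (f_ n x))}) ->
    {within `[0, T], continuous (fun x => u (f x))}.
  move=> uB ub cu; apply/subspace_continuousP => x xT; apply/cvgrPdist_le => e e0.
  have B1 : 0 < B + 1 by rewrite ltr_pwDr.
  have e4 : 0 < e / 4 / (B + 1) by rewrite !divr_gt0.
  have [n nP] := half_pow_small e4.
  have small z : z \in `[0, T] -> `|u (f z) - u (f_ n z)| <= e / 4.
    move=> zT; rewrite -uB (le_trans (ub _)) // (le_trans (ff n z zT)) //.
    rewrite ltr_pdivlMr // in nP.
    have : 0 <= 2^-1 ^+ n :> R by rewrite exprn_ge0 // invr_ge0.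
    by move: nP; set p := _ ^+ n; lra.
  have /subspace_continuousP/(_ x xT)/cvgrPdist_le := cu n.
  have e2 : 0 < e / 4 by rewrite divr_gt0.
  move=> /(_ _ e2); rewrite !near_withinE; apply: filterS => z h zT.
  have := h zT; have := small z zT; have := small x xT; rewrite /from_subspace !ler_norml.
  move=> /andP[? ?] /andP[? ?] /andP[? ?]; apply/andP; split; lra.
split; apply: part; [exact: cReB|exact: Re_le_cmod| |exact: cImB|exact: Im_le_cmod|].
  by move=> n; case: (cf n).
by move=> n; case: (cf n).
Qed.

(** A recursive predicate, since membership in the list would need decidable
    equality of the coefficient functions. *)
Fixpoint every (A : Type) (P : A -> Prop) (s : seq A) : Prop :=
  if s is a :: s' then P a /\ every P s' else True.

Lemma every_cat (A : Type) (P : A -> Prop) (s1 s2 : seq A) :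
  every P s1 -> every P s2 -> every P (s1 ++ s2).
Proof. by move=> h1 h2; elim: s1 h1 => [|a s IH] //= [Pa /IH]. Qed.

Lemma every_map (A B : Type) (P : A -> Prop) (Q : B -> Prop) (h : A -> B) (s : seq A) :
  (forall e : A, P e -> Q (h e)) -> every P s -> every Q (map h s).
Proof. by move=> PQ; elim: s => [|a s IH] //= [/PQ Pa /IH]. Qed.

(** Polynomials in the spectral parameter with coefficients that are continuous
    in x. The class contains the Picard iterates, and its members become
    polynomials in l after evaluation at x or integration against a fixed
    function. *)
Definition polyfam F := exists2 cs : seq (nat * (R -> C)),
  every (fun c => ccts 0 T c.2) cs &
  forall l x, x \in `[0, T] -> F l x = \sum_(c <- cs) l ^+ c.1 * c.2 x.

Lemma polyfam_cst f : ccts 0 T f -> polyfam (fun=> f).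
Proof.
move=> cf; exists [:: (0%N, f)] => [//|l x _].
by rewrite big_seq1 expr0 mul1r.
Qed.

Lemma polyfamD F G : polyfam F -> polyfam G -> polyfam (fun l x => F l x + G l x).
Proof.
move=> [s1 h1 e1] [s2 h2 e2]; exists (s1 ++ s2).
  exact: every_cat.
by move=> l x xT; rewrite big_cat e1 // e2.
Qed.

Lemma polyfam_mull F : polyfam F -> polyfam (fun l x => l * F l x).
Proof.
move=> [s h e]; exists [seq (c.1.+1, c.2) | c <- s].
  by apply: every_map h.
move=> l x xT; rewrite e // big_map mulr_sumr; apply: eq_bigr => c _.
by rewrite exprS mulrA.
Qed.

Lemma cintegral_bigsum (D : set (measurableTypeR R)) (cs : seq (nat * (R -> C))) g l :
  measurable D -> every (fun c => cintegrable D (fun t => g t * c.2 t)) cs ->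
  cintegral D (fun t => g t * \sum_(c <- cs) l ^+ c.1 * c.2 t) =
  \sum_(c <- cs) l ^+ c.1 * cintegral D (fun t => g t * c.2 t) /\
  cintegrable D (fun t => g t * \sum_(c <- cs) l ^+ c.1 * c.2 t).
Proof.
move=> mD; elim: cs => [|c s IH] /= h.
  have z : forall t, D t -> (0 : C) = g t * \sum_(c <- [::] : seq (nat * (R -> C))) l ^+ c.1 * c.2 t.
    by move=> t _; rewrite big_nil mulr0.
  split.
    rewrite big_nil -(eq_cintegral z) /cintegral /=.
    by rewrite /Rintegral integral0.
  by apply: (eq_cintegrable mD z); split; exact: integrable0.
have [ic /IH[E I]] := h.
have e : forall t, D t -> l ^+ c.1 * (g t * c.2 t) + g t * (\sum_(c <- s) l ^+ c.1 * c.2 t) =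
    g t * \sum_(c <- c :: s) l ^+ c.1 * c.2 t.
  by move=> t _; rewrite big_cons; ring.
split.
  rewrite -(eq_cintegral e) cintegralD //; last exact: cintegrableZ.
  by rewrite cintegralZ // E big_cons.
apply: (eq_cintegrable mD e); apply: cintegrableD => //; exact: cintegrableZ.
Qed.

Lemma polyfam_int F g a : polyfam F -> cintegrable `[0, T] g ->
  polyfam (fun l x => a + cintegral `[0, x] (fun t => g t * F l t)).
Proof.
move=> [s h e] ig.
have igc (c : nat * (R -> C)) : ccts 0 T c.2 -> cintegrable `[0, T] (fun t => g t * c.2 t).
  move=> cc; apply: (@eq_cintegrable _ _ (fun t => c.2 t * g t)) => //.
    by move=> t _; rewrite mulrC.
  exact: (ac_mul_int (ltW T0) cc ig).
exists ((0%N, fun=> a) :: [seq (c.1, fun x => cintegral `[0, x] (fun t => g t * c.2 t)) | c <- s]).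
  split; first exact: ccts_cst.
  apply: every_map h => c cc /=; apply: ccts_int; first exact: ltW.
  exact: igc.
move=> l x xT; rewrite big_cons expr0 mul1r big_map; congr (_ + _).
have [x0 x1] : 0 <= x /\ x <= T by move: xT; rewrite in_itv /= => /andP[].
rewrite -(cintegral_bigsum _ _ _).1 //; last first.
  by rewrite -[s]map_id; apply: every_map h => c /igc; exact: cint_sub.
apply: eq_cintegral => t /=; rewrite in_itv /= => /andP[t0 tx]; rewrite e //.
by rewrite in_itv /= t0 (le_trans tx).
Qed.

Lemma polyfam_entire F x : polyfam F -> x \in `[0, T] -> entire (fun l => F l x).
Proof.
move=> [s _ e] xT; apply: (@entire_ext _ (fun l => \sum_(c <- s) l ^+ c.1 * c.2 x)).
  by move=> l; rewrite e.
apply: entire_sum => c; apply: entireM; last exact: entire_cst.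
by apply: entire_exp; exact: entire_id.
Qed.

Lemma polyfam_eq F G : polyfam F -> (forall l x, x \in `[0, T] -> F l x = G l x) -> polyfam G.
Proof. by move=> [s h e] FG; exists s => // l x xT; rewrite -FG // e. Qed.

Lemma picard_polyfam a b n :
  polyfam (fun l => Y a b n l) /\ polyfam (fun l => DY a b n l).
Proof.
have i1 : cintegrable `[0, T] (fun=> 1) by apply: ccts_integrable; [exact: ltW|exact: ccts_cst].
elim: n => [|n [h1 h2]]; first by split; apply: polyfam_cst; exact: ccts_cst.
split.
  apply: (polyfam_eq (polyfam_int a h2 i1)) => l x xT /=; congr (_ + _).
  by apply: eq_cintegral => t _; rewrite mul1r.
apply: (polyfam_eq (polyfamD (polyfam_int b h1 iq)
   (polyfam_mull (polyfam_int 0 h1 (cintegrableZ (-1) (measurable_itv _) i1))))) => l x xT /=.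
have [x0 x1] : 0 <= x /\ x <= T by move: xT; rewrite in_itv /= => /andP[].
have [c1 _] := picard_cts T0 iq a b n l.
rewrite add0r -addrA; congr (_ + _).
have ic := cint_sub (lexx 0) x1 (ccts_integrable (ltW T0) c1).
have iqc : cintegrable `[0, x] (fun t => q t * Y a b n l t).
  have := qy_integrable T0 0 iq c1 => /(cint_sub (lexx 0) x1).
  by apply: eq_cintegrable => // t _; rewrite subr0.
have -> : cintegral `[0, x] (fun t => -1 * 1 * Y a b n l t) = - cintegral `[0, x] (Y a b n l).
  rewrite -[RHS]mulN1r -cintegralZ //; apply: eq_cintegral => t _; by rewrite mulr1.
rewrite mulrN -mulNr -cintegralZ // -cintegralD //; last exact: cintegrableZ.
by apply: eq_cintegral => t _; ring.
Qed.

(** The Picard iterates converge uniformly for x in [0, T] and l in a disc. The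
    limits solve the integral equations, and as limits of polynomials in l they
    are entire; the last clause is the analyticity of the linear forms after
    integration by parts. *)
Theorem cauchy_exists a b : exists y dy : C -> R -> C,
  [/\ forall l, [/\ slsol T q l (y l) (dy l), y l 0 = a & dy l 0 = b],
      forall x, x \in `[0, T] -> entire (fun l => y l x),
      forall x, x \in `[0, T] -> entire (fun l => dy l x) &
      forall s M, cmeasurable `[0, T] s -> (forall x, x \in `[0, T] -> cmod (s x) <= M) ->
        entire (fun l => cintegral `[0, T] (fun t => s t * dy l t))].
Proof.
have T00 := ltW T0.
have zT : 0 \in `[0, T] by rewrite in_itv /= lexx.
have lim (G : nat -> C -> R -> C) : (forall r l n m x, 0 <= r -> cmod l <= r -> x \in `[0, T] ->
     (n <= m)%N -> cmod (G m l x - G n l x) <= picard_rate r a b * 2^-1 ^+ n) ->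
   exists y : C -> R -> C, forall r l n x, 0 <= r -> cmod l <= r -> x \in `[0, T] ->
     cmod (y l x - G n l x) <= 2 * (picard_rate r a b * 2^-1 ^+ n).
  move=> GP.
  have ex (lx : C * R) : exists z : C, lx.2 \in `[0, T] -> forall r n, 0 <= r -> cmod lx.1 <= r ->
      cmod (z - G n lx.1 lx.2) <= 2 * (picard_rate r a b * 2^-1 ^+ n).
    case: lx => l x /=; have [xT|] := boolP (x \in `[0, T]); last by exists 0.
    have [||z zP] := @ccauchy_lim R (fun n => G n l x) (fun n => picard_rate (cmod l) a b * 2^-1 ^+ n).
    - by move=> n; rewrite mulr_ge0 ?picard_rate_ge0 // exprn_ge0 // invr_ge0.
    - by move=> n m nm; apply: GP => //; exact: cmod_ge0.
    exists z => _ r n r0 lr; apply: (le_trans (zP n)); rewrite ler_wpM2l //.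
    rewrite ler_wpM2r ?exprn_ge0 ?invr_ge0 // /picard_rate ler_wpM2l ?addr_ge0 ?cmod_ge0 //.
    rewrite ler_expR ler_wpM2l // /picard_weight; apply: le_Rintegral => //.
    + exact: weight_rint.
    + exact: weight_rint.
    + by move=> t _; rewrite lerD2l.
  have [h hP] := choice ex.
  by exists (fun l x => h (l, x)) => r l n x r0 lr xT; exact: (hP (l, x)).
have [|y yP] := lim (fun n l => Y a b n l).
  by move=> r l n m x r0 lr xT nm; have [] := picard_cauchy a b r0 lr xT nm.
have [|dy dyP] := lim (fun n l => DY a b n l).
  by move=> r l n m x r0 lr xT nm; have [] := picard_cauchy a b r0 lr xT nm.
have B0 r := picard_rate_ge0 r a b.
have cy l : ccts 0 T (y l).
  apply: (@ccts_ulim (fun n => Y a b n l) _ (2 * picard_rate (cmod l) a b)).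
  - by move=> n; have [] := picard_cts T0 iq a b n l.
  - by move=> n x xT; rewrite -mulrA; apply: yP => //; exact: cmod_ge0.
  - by rewrite mulr_ge0.
have cdy l : ccts 0 T (dy l).
  apply: (@ccts_ulim (fun n => DY a b n l) _ (2 * picard_rate (cmod l) a b)).
  - by move=> n; have [] := picard_cts T0 iq a b n l.
  - by move=> n x xT; rewrite -mulrA; apply: dyP => //; exact: cmod_ge0.
  - by rewrite mulr_ge0.
have small (z : C) (K : R) : 0 <= K -> (forall n, cmod z <= K * 2^-1 ^+ n) -> z = 0.
  move=> K0 zK; apply/eqP; rewrite -cmod_eq0; apply/negPn/negP => z0.
  have K1 : 0 < K + 1 by rewrite ltr_pwDr.
  have z1 : 0 < cmod z / (K + 1) by rewrite divr_gt0 // lt_def z0 cmod_ge0.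
  have [n] := half_pow_small z1; rewrite ltr_pdivlMr //; have := zK n.
  have : 0 <= 2^-1 ^+ n :> R by rewrite exprn_ge0 // invr_ge0.
  by set p := _ ^+ n; lra.
(* passage to the limit under the integral sign *)
have pass g (u : R -> C) (u_ : nat -> R -> C) B x : cintegrable `[0, T] g -> ccts 0 T u ->
    (forall n, ccts 0 T (u_ n)) -> 0 <= B ->
    (forall n t, t \in `[0, T] -> cmod (u t - u_ n t) <= B * 2^-1 ^+ n) -> x \in `[0, T] ->
    forall n, cmod (cintegral `[0, x] (fun t => g t * u t) - cintegral `[0, x] (fun t => g t * u_ n t))
      <= B * (\int[mu]_(t in `[0, T]) cmod (g t)) * 2^-1 ^+ n.
  move=> ig cu cu_ B1 uu xT n.
  have [x0 x1] : 0 <= x /\ x <= T by move: xT; rewrite in_itv /= => /andP[].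
  have igc v : ccts 0 T v -> cintegrable `[0, x] (fun t => g t * v t).
    move=> cv; apply: (cint_sub (lexx 0) x1).
    apply: (@eq_cintegrable _ _ (fun t => v t * g t)) => //.
      by move=> t _; rewrite mulrC.
    exact: (ac_mul_int T00 cv ig).
  have -> : cintegral `[0, x] (fun t => g t * u t) - cintegral `[0, x] (fun t => g t * u_ n t) =
      cintegral `[0, x] (fun t => g t * u t + -1 * (g t * u_ n t)).
    rewrite cintegralD //; [|exact: igc|by apply: cintegrableZ => //; exact: igc].
    by rewrite cintegralZ ?mulN1r //; exact: igc.
  have ig' := rint_cmod_sub ig (lexx 0) x1.
  apply: (@le_trans _ _ (\int[mu]_(t in `[0, x]) (B * 2^-1 ^+ n * cmod (g t)))).
    apply: cintegral_norm_le => //.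
    - by apply: cintegrableD => //; [exact: igc|apply: cintegrableZ => //; exact: igc].
    - exact: rintegrableZ.
    - move=> t /=; rewrite in_itv /= => /andP[t0 tx].
      have -> : g t * u t + -1 * (g t * u_ n t) = (u t - u_ n t) * g t by ring.
      rewrite cmodM ler_wpM2r ?cmod_ge0 // uu // in_itv /= t0 (le_trans tx) //.
  rewrite RintegralZl // mulrAC ler_wpM2r ?exprn_ge0 ?invr_ge0 // ler_wpM2l //.
  apply: Rint_le_itv => //; first exact: rintegrable_cmod.
  by move=> t _; exact: cmod_ge0.
have iql l : cintegrable `[0, T] (fun t => q t - l).
  by apply: cintegrableD => //; apply: ccts_integrable => //; exact: ccts_cst.
have i1 : cintegrable `[0, T] (fun=> 1) by apply: ccts_integrable => //; exact: ccts_cst.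
have ibound g : 0 <= \int[mu]_(t in `[0, T]) cmod (g t) by apply: Rintegral_ge0 => t _; exact: cmod_ge0.
have yE l x : x \in `[0, T] -> y l x = a + cintegral `[0, x] (dy l).
  move=> xT; apply/eqP; rewrite -subr_eq0; apply/eqP.
  set B := 2 * picard_rate (cmod l) a b; have B1 : 0 <= B by rewrite mulr_ge0.
  apply: (small _ (B + B * (\int[mu]_(t in `[0, T]) cmod 1))) => [|n].
    by rewrite addr_ge0 // mulr_ge0.
  have h1 := yP (cmod l) l n.+1 x (cmod_ge0 _) (lexx _) xT.
  have h2 := pass (fun=> 1) (dy l) (fun n => DY a b n l) B x i1 (cdy l)
    (fun n => (picard_cts T0 iq a b n l).2) B1
    (fun n t tT => (eq_ind _ (fun z => _ <= z) (dyP (cmod l) l n t (cmod_ge0 _) (lexx _) tT) _ (mulrA _ _ _))) xT n.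
  have e1 v : cintegral `[0, x] (fun t => 1 * v t) = cintegral `[0, x] v.
    by apply: eq_cintegral => t _; rewrite mul1r.
  rewrite !e1 in h2.
  have -> : y l x - (a + cintegral `[0, x] (dy l)) =
    (y l x - Y a b n.+1 l x) - (cintegral `[0, x] (dy l) - cintegral `[0, x] (DY a b n l)).
    by rewrite /=; ring.
  apply: (le_trans (cmodDl _ _)); rewrite mulrDl; apply: lerD => //.
  apply: (le_trans h1); rewrite mulrA ler_wpM2l // exprSr ler_piMr ?exprn_ge0 ?invr_ge0 //.
  by rewrite invf_le1 // ler1n.
have dyE l x : x \in `[0, T] -> dy l x = b + cintegral `[0, x] (fun t => (q t - l) * y l t).
  move=> xT; apply/eqP; rewrite -subr_eq0; apply/eqP.
  set B := 2 * picard_rate (cmod l) a b; have B1 : 0 <= B by rewrite mulr_ge0.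
  apply: (small _ (B + B * (\int[mu]_(t in `[0, T]) cmod (q t - l)))) => [|n].
    by rewrite addr_ge0 // mulr_ge0.
  have h1 := dyP (cmod l) l n.+1 x (cmod_ge0 _) (lexx _) xT.
  have h2 := pass (fun t => q t - l) (y l) (fun n => Y a b n l) B x (iql l) (cy l)
    (fun n => (picard_cts T0 iq a b n l).1) B1
    (fun n t tT => (eq_ind _ (fun z => _ <= z) (yP (cmod l) l n t (cmod_ge0 _) (lexx _) tT) _ (mulrA _ _ _))) xT n.
  have -> : dy l x - (b + cintegral `[0, x] (fun t => (q t - l) * y l t)) =
    (dy l x - DY a b n.+1 l x) - (cintegral `[0, x] (fun t => (q t - l) * y l t) - cintegral `[0, x] (fun t => (q t - l) * Y a b n l t)).
    by rewrite /=; ring.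
  apply: (le_trans (cmodDl _ _)); rewrite mulrDl; apply: lerD => //.
  apply: (le_trans h1); rewrite mulrA ler_wpM2l // exprSr ler_piMr ?exprn_ge0 ?invr_ge0 //.
  by rewrite invf_le1 // ler1n.
exists y, dy.
have y0 l : y l 0 = a by rewrite yE // cint_pt addr0.
have dy0 l : dy l 0 = b by rewrite dyE // cint_pt addr0.
have entlim (G : nat -> C -> C) (z : C -> C) (K : R -> R) : (forall n, entire (G n)) -> (forall r, 0 <= K r) ->
    (forall r l n, 0 <= r -> cmod l <= r -> cmod (z l - G n l) <= K r * 2^-1 ^+ n) -> entire z.
  move=> eG K0 zG; apply: entire_lim => r e e0.
  have r0 : 0 <= Num.max r 0 by rewrite le_max lexx orbT.
  have K1 : 0 < K (Num.max r 0) + 1 by rewrite ltr_pwDr.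
  have [n nP] := half_pow_small (divr_gt0 e0 K1).
  exists (G n) => // l lr; apply: (le_trans (zG (Num.max r 0) l n r0 _)).
    by rewrite le_max lr.
  have : 0 <= 2^-1 ^+ n :> R by rewrite exprn_ge0 // invr_ge0.
  by rewrite ltr_pdivlMr // in nP; move: nP; set p := _ ^+ n; lra.
split.
- move=> l; split=> //; split; split=> //.
  + exact: ccts_integrable.
  + by move=> x xT; rewrite y0 yE.
  + exact: qy_integrable.
  + by move=> x xT; rewrite dy0 dyE.
- move=> x xT; apply: (@entlim (fun n l => Y a b n l x) _ (fun r => 2 * picard_rate r a b)).
  + by move=> n; have [h _] := picard_polyfam a b n; exact: (polyfam_entire h xT).
  + by move=> r; rewrite mulr_ge0.
  + by move=> r l n r0 lr; rewrite -mulrA; exact: yP.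
- move=> x xT; apply: (@entlim (fun n l => DY a b n l x) _ (fun r => 2 * picard_rate r a b)).
  + by move=> n; have [_ h] := picard_polyfam a b n; exact: (polyfam_entire h xT).
  + by move=> r; rewrite mulr_ge0.
  + by move=> r l n r0 lr; rewrite -mulrA; exact: dyP.
move=> s M ms sM.
have TT : T \in `[0, T] by rewrite in_itv /= lexx T00.
have is_ : cintegrable `[0, T] s.
  have := cintegrableM_bounded (measurable_itv _) ms sM i1.
  by apply: eq_cintegrable => // t _; rewrite mulr1.
apply: (@entlim (fun n l => cintegral `[0, T] (fun t => s t * DY a b n l t)) _
   (fun r => 2 * picard_rate r a b * (\int[mu]_(t in `[0, T]) cmod (s t)))).
- move=> n; have [_ h] := picard_polyfam a b n.
  have := polyfam_entire (polyfam_int 0 h is_) TT; apply: entire_ext => l.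
  by rewrite add0r.
- by move=> r; apply: mulr_ge0 => //; apply: mulr_ge0.
move=> r l n r0 lr.
apply: (pass s (dy l) (fun n => DY a b n l) (2 * picard_rate r a b) T) => //.
- by move=> m; have [] := picard_cts T0 iq a b m l.
- by rewrite mulr_ge0.
- by move=> m t tT; rewrite -mulrA; exact: dyP.
Qed.
End Picard.

(** * Growth of solutions for large spectral parameter *)

Section Asymptotics.
Variables (R : realType) (T : R).
Hypothesis T0 : 0 < T.
Local Notation C := R[i].
Local Notation mu := (@lebesgue_measure R).
Local Notation Re := complex.Re.
Local Notation Im := complex.Im.
Local Notation ac := (ac_with_deriv T).
Implicit Types (y dy s f g : R -> C) (l k a b : C) (x r : R) (F : C -> R -> C).

Lemma cmod_cexpR k x : cmod (cexp (k * x%:C)) = expR (Re k * x).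
Proof. by rewrite cmod_cexp mulrC cReZ mulrC. Qed.

(** A bound N for h improves to G + N/2, so that its excess over 2 G tends to 0
    geometrically. *)
Lemma contraction_bound (A : R -> Prop) (h : R -> R) (G N0 : R) : 0 <= N0 ->
  (forall x, A x -> h x <= N0) ->
  (forall N, 0 <= N -> (forall x, A x -> h x <= N) -> forall x, A x -> h x <= G + N / 2) ->
  0 <= G -> forall x, A x -> h x <= 2 * G.
Proof.
move=> N00 hN step G0 x Ax.
have key n : forall x, A x -> h x <= 2 * G + N0 * 2^-1 ^+ n.
  elim: n => [|n IH] z Az; first by rewrite expr0 mulr1; have := hN z Az; lra.
  have p0 : 0 <= N0 * 2^-1 ^+ n by rewrite mulr_ge0 // exprn_ge0 // invr_ge0.
  have := step (2 * G + N0 * 2^-1 ^+ n) _ IH z Az; rewrite exprSr => H.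
  by apply: le_trans (H _) _; first lra; lra.
rewrite leNgt; apply/negP => lt.
have N1 : 0 < N0 + 1 by lra.
have e0 : 0 < (h x - 2 * G) / (N0 + 1) by rewrite divr_gt0 // subr_gt0.
have [n] := half_pow_small e0; rewrite ltr_pdivlMr // => nP.
have := key n x Ax; have : 0 <= 2^-1 ^+ n :> R by rewrite exprn_ge0 // invr_ge0.
move: nP; set p := _ ^+ n; lra.
Qed.

Variable q : R -> C.
Hypothesis iq : cintegrable `[0, T] q.
Definition q_norm := \int[mu]_(t in `[0, T]) cmod (q t).
Local Notation Q := q_norm.

Lemma q_norm_ge0 : 0 <= Q.
Proof. by apply: Rintegral_ge0 => t _; exact: cmod_ge0. Qed.

Variables (k : C) (y dy : R -> C).
Hypothesis sol : slsol T q (- k ^+ 2) y dy.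
Hypothesis k0 : 0 <= Re k.

(** With l = - k^2 the functions y' + k y and y' - k y are the amplitudes of the
    waves exp(kx) and exp(-kx): up to these factors their derivative is q y. *)
Definition modep x := dy x + k * y x.
Definition modem x := dy x - k * y x.

Lemma modep_ac : ac (fun x => modep x * cexp (- k * x%:C)) (fun x => q x * y x * cexp (- k * x%:C)).
Proof.
have [h1 h2] := sol.
have := acM (ltW T0) (acD h2 (acZ k h1)) (ac_cexp (ltW T0) (- k)).
congr ac_with_deriv; apply/funext => x; rewrite /modep; ring.
Qed.

Lemma modem_ac : ac (fun x => modem x * cexp (k * x%:C)) (fun x => q x * y x * cexp (k * x%:C)).
Proof.
have [h1 h2] := sol.
have := acM (ltW T0) (acB h2 (acZ k h1)) (ac_cexp (ltW T0) k).
congr ac_with_deriv; apply/funext => x; rewrite /modem; ring.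
Qed.

Definition mode_sum x := cmod (modep x) + cmod (modem x).

Lemma mode_sum_ge0 x : 0 <= mode_sum x. Proof. by rewrite addr_ge0 // cmod_ge0. Qed.

Lemma le_mode_sum_y x : 2 * (cmod k * cmod (y x)) <= mode_sum x.
Proof.
have : cmod (modep x - modem x) <= mode_sum x by exact: cmodDl.
have -> : modep x - modem x = 2 * (k * y x) by rewrite /modep /modem; ring.
by rewrite !cmodM cmod_nat.
Qed.

Lemma le_mode_sum_dy x : 2 * cmod (dy x) <= mode_sum x.
Proof.
have : cmod (modep x + modem x) <= mode_sum x by exact: cmodD.
have -> : modep x + modem x = 2 * dy x by rewrite /modep /modem; ring.
by rewrite !cmodM cmod_nat.
Qed.

Hypothesis kQ : 2 * Q <= cmod k.
Hypothesis kpos : 0 < cmod k.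

Lemma ycts : ccts 0 T y /\ ccts 0 T dy. Proof. exact: (slsol_cts T0 sol). Qed.

Lemma qy_int : cintegrable `[0, T] (fun x => q x * y x).
Proof.
apply: (@eq_cintegrable _ _ (fun x => y x * q x)) => //.
  by move=> x _; rewrite mulrC.
exact: (ac_mul_int (ltW T0) ycts.1 iq).
Qed.

Lemma cexp_cts a : ccts 0 T (fun x => cexp (a * x%:C)).
Proof. exact: (ac_cts (ltW T0) (ac_cexp (ltW T0) a)). Qed.

(** The gain 1 / |k| comes from |y| <= mode_sum / (2 |k|). *)
Lemma mode_integral_bound (a : C) (u v N b0 : R) : 0 <= u -> u <= v -> v <= T ->
  (forall t : R, u <= t -> t <= v -> cmod (cexp (a * t%:C)) * expR (Re k * `|t - b0|) <= N) ->
  forall M : R, 0 <= M -> (forall t : R, t \in `[0, T] -> mode_sum t <= M * expR (Re k * `|t - b0|)) ->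
  cmod (cintegral `[u, v] (fun t => q t * y t * cexp (a * t%:C))) <= M * N / 2 * (Q / cmod k).
Proof.
move=> u0 uv vT eN M M0 mM.
have iqye : cintegrable `[0, T] (fun t => q t * y t * cexp (a * t%:C)).
  apply: (@eq_cintegrable _ _ (fun x => cexp (a * x%:C) * (q x * y x))) => //.
    by move=> x _; rewrite mulrC.
  exact: (ac_mul_int (ltW T0) (cexp_cts a) qy_int).
apply: (@le_trans _ _ (\int[mu]_(t in `[u, v]) (M * N / 2 / cmod k * cmod (q t)))).
  apply: cintegral_norm_le => //; first exact: (cint_sub u0 vT).
    by apply: rintegrableZ => //; exact: (rint_cmod_sub iq u0 vT).
  move=> t /=; rewrite in_itv /= => /andP[ut tv].
  have tT : t \in `[0, T] by rewrite in_itv /=; apply/andP; split; lra.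
  rewrite !cmodM mulrAC -mulrA mulrC ler_wpM2r ?cmod_ge0 //.
  have h1 := le_mode_sum_y t; have h2 := mM t tT; have h3 := eN t ut tv.
  have e0 := expR_ge0 (Re k * `|t - b0|).
  rewrite ler_pdivlMr //; set E := expR _ in h2 h3 e0.
  have h4 : cmod k * cmod (y t) <= M * E / 2 by lra.
  have c0 := cmod_ge0 (cexp (a * t%:C)).
  have := ler_wpM2l c0 h4; have := ler_wpM2l M0 h3; lra.
rewrite RintegralZl //; last exact: (rint_cmod_sub iq u0 vT).
have N0 : 0 <= N.
  by apply: le_trans (eN u (lexx u) uv); apply: mulr_ge0; [exact: cmod_ge0|exact: expR_ge0].
have -> : M * N / 2 * (Q / cmod k) = M * N / 2 / cmod k * Q by ring.
rewrite ler_wpM2l ?divr_ge0 ?mulr_ge0 ?cmod_ge0 //.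
apply: Rint_le_itv => //; first exact: rintegrable_cmod.
by move=> t _; exact: cmod_ge0.
Qed.

Lemma cexp_inv (a : C) x : cexp (- a * x%:C) * cexp (a * x%:C) = 1.
Proof. by rewrite -cexpD mulNr addNr cexp0. Qed.

Lemma modep_bound (b0 M x : R) : b0 \in `[0, T] -> x \in `[0, T] -> 0 <= M ->
  (forall t : R, t \in `[0, T] -> mode_sum t <= M * expR (Re k * `|t - b0|)) ->
  cmod (modep x - cexp (k * (x - b0)%:C) * modep b0) <=
     M / 2 * (Q / cmod k) * expR (Re k * `|x - b0|).
Proof.
move=> b0T xT M0 mM; move: (b0T) (xT); rewrite !in_itv /= => /andP[b00 b01] /andP[x0 x1].
have e1 (t : R) : modep t = modep t * cexp (- k * t%:C) * cexp (k * t%:C).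
  by rewrite -mulrA cexp_inv mulr1.
have e2 : cexp (k * (x - b0)%:C) = cexp (k * x%:C) * cexp (- k * b0%:C).
  rewrite -cexpD; congr cexp; rewrite rmorphB /=; ring.
have -> : modep x - cexp (k * (x - b0)%:C) * modep b0 =
   cexp (k * x%:C) * (modep x * cexp (- k * x%:C) - modep b0 * cexp (- k * b0%:C)).
  rewrite {1}(e1 x) e2; ring.
rewrite cmodM cmod_cexpR.
have [xb|/ltW bx] := leP x b0.
  rewrite cmodB (ac_incr modep_ac) //.
  have := @mode_integral_bound (- k) x b0 (expR (Re k * (b0 - x) - Re k * x)) b0 x0 xb b01 _ M M0 mM.
  have h : forall t, x <= t -> t <= b0 ->
     cmod (cexp (- k * t%:C)) * expR (Re k * `|t - b0|) <= expR (Re k * (b0 - x) - Re k * x).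
    move=> t xt tb; rewrite cmod_cexpR cReN -expRD ler_expR distrC ger0_norm ?subr_ge0 //.
    have := mulr_ge0 k0 (_ : 0 <= t - x); rewrite subr_ge0 xt => /(_ isT); nra.
  move=> /(_ h) H; apply: (le_trans (ler_wpM2l (expR_ge0 _) H)).
  rewrite distrC ger0_norm ?subr_ge0 // le_eqVlt; apply/orP; left; apply/eqP.
  by rewrite expRD expRN; field; rewrite !gt_eqF ?expR_gt0.
rewrite (ac_incr modep_ac) //.
have := @mode_integral_bound (- k) b0 x (expR (- (Re k * b0))) b0 b00 bx x1 _ M M0 mM.
have h : forall t, b0 <= t -> t <= x ->
   cmod (cexp (- k * t%:C)) * expR (Re k * `|t - b0|) <= expR (- (Re k * b0)).
  move=> t bt tx; rewrite cmod_cexpR cReN -expRD ler_expR ger0_norm ?subr_ge0 //; nra.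
move=> /(_ h) H; apply: (le_trans (ler_wpM2l (expR_ge0 _) H)).
rewrite ger0_norm ?subr_ge0 // le_eqVlt; apply/orP; left; apply/eqP.
by rewrite mulrBr expRD !expRN; field; rewrite !gt_eqF ?expR_gt0.
Qed.

Lemma modem_bound (b0 M x : R) : b0 \in `[0, T] -> x \in `[0, T] -> 0 <= M ->
  (forall t : R, t \in `[0, T] -> mode_sum t <= M * expR (Re k * `|t - b0|)) ->
  cmod (modem x - cexp (- k * (x - b0)%:C) * modem b0) <=
     M / 2 * (Q / cmod k) * expR (Re k * `|x - b0|).
Proof.
move=> b0T xT M0 mM; move: (b0T) (xT); rewrite !in_itv /= => /andP[b00 b01] /andP[x0 x1].
have e1 (t : R) : modem t = modem t * cexp (k * t%:C) * cexp (- k * t%:C).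
  by rewrite -mulrA [cexp (k * _) * _]mulrC cexp_inv mulr1.
have e2 : cexp (- k * (x - b0)%:C) = cexp (- k * x%:C) * cexp (k * b0%:C).
  rewrite -cexpD; congr cexp; rewrite rmorphB /=; ring.
have -> : modem x - cexp (- k * (x - b0)%:C) * modem b0 =
   cexp (- k * x%:C) * (modem x * cexp (k * x%:C) - modem b0 * cexp (k * b0%:C)).
  rewrite {1}(e1 x) e2; ring.
rewrite cmodM cmod_cexpR cReN.
have [xb|/ltW bx] := leP x b0.
  rewrite cmodB (ac_incr modem_ac) //.
  have := @mode_integral_bound k x b0 (expR (Re k * b0)) b0 x0 xb b01 _ M M0 mM.
  have h : forall t, x <= t -> t <= b0 ->
     cmod (cexp (k * t%:C)) * expR (Re k * `|t - b0|) <= expR (Re k * b0).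
    move=> t xt tb; rewrite cmod_cexpR -expRD ler_expR distrC ger0_norm ?subr_ge0 //; nra.
  move=> /(_ h) H; apply: (le_trans (ler_wpM2l (expR_ge0 _) H)).
  rewrite distrC ger0_norm ?subr_ge0 // le_eqVlt; apply/orP; left; apply/eqP.
  by rewrite mulrBr expRD mulNr !expRN; field; rewrite !gt_eqF ?expR_gt0.
rewrite (ac_incr modem_ac) //.
have := @mode_integral_bound k b0 x (expR (Re k * x + Re k * (x - b0))) b0 b00 bx x1 _ M M0 mM.
have h : forall t, b0 <= t -> t <= x ->
   cmod (cexp (k * t%:C)) * expR (Re k * `|t - b0|) <= expR (Re k * x + Re k * (x - b0)).
  move=> t bt tx; rewrite cmod_cexpR -expRD ler_expR ger0_norm ?subr_ge0 //.
  have := mulr_ge0 k0 (_ : 0 <= x - t); rewrite subr_ge0 tx => /(_ isT); nra.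
move=> /(_ h) H; apply: (le_trans (ler_wpM2l (expR_ge0 _) H)).
rewrite ger0_norm ?subr_ge0 // le_eqVlt; apply/orP; left; apply/eqP.
by rewrite expRD mulNr expRN; field; rewrite !gt_eqF ?expR_gt0.
Qed.

(** The quotient of mode_sum x by exp(Re k |x - b0|) is a contracted quantity:
    by modep_bound and modem_bound the potential contributes at most Q / |k| <=
    1/2 times its bound. *)
Lemma two_point (b0 x : R) : b0 \in `[0, T] -> x \in `[0, T] ->
  mode_sum x <= 2 * mode_sum b0 * expR (Re k * `|x - b0|).
Proof.
move=> b0T xT.
have Q0 := q_norm_ge0.
have E0 z : 0 < expR (Re k * `|z - b0|) by exact: expR_gt0.
pose h z := mode_sum z / expR (Re k * `|z - b0|).
suff : h x <= 2 * mode_sum b0 by rewrite /h ler_pdivrMr.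
have [M M0 MP] : exists2 M, 0 <= M & forall z, z \in `[0, T] -> mode_sum z <= M.
  have [c1 c2] := ycts.
  have [M1 M10 h1] := ccts_bounded (ltW T0) c1; have [M2 M20 h2] := ccts_bounded (ltW T0) c2.
  exists (2 * (M2 + cmod k * M1)); first by rewrite mulr_ge0 // addr_ge0 // mulr_ge0 // ltW.
  move=> z zT; have k1 := cmodD (dy z) (k * y z); have k2 := cmodDl (dy z) (k * y z).
  rewrite /mode_sum /modep /modem; rewrite cmodM in k1 k2.
  have := h2 z zT; have := ler_wpM2l (ltW kpos) (h1 z zT); lra.
apply: (@contraction_bound (fun z => z \in `[0, T]) h (mode_sum b0) M) => //.
- move=> z zT; rewrite /h ler_pdivrMr //; apply: (le_trans (MP z zT)).
  rewrite ler_peMr // -[leLHS]expR0 ler_expR mulr_ge0 //.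
- move=> N N0 hN z zT.
  have hN' t : t \in `[0, T] -> mode_sum t <= N * expR (Re k * `|t - b0|).
    by move=> tT; have := hN t tT; rewrite /h ler_pdivrMr.
  have b1 := modep_bound b0T zT N0 hN'; have b2 := modem_bound b0T zT N0 hN'.
  have n1 : cmod (cexp (k * (z - b0)%:C) * modep b0) <= expR (Re k * `|z - b0|) * cmod (modep b0).
    by rewrite cmodM cmod_cexpR ler_wpM2r ?cmod_ge0 // ler_expR ler_wpM2l // ler_norm.
  have n2 : cmod (cexp (- k * (z - b0)%:C) * modem b0) <= expR (Re k * `|z - b0|) * cmod (modem b0).
    rewrite cmodM cmod_cexpR ler_wpM2r ?cmod_ge0 // ler_expR cReN mulNr -mulrN ler_wpM2l //.
    by rewrite -normrN ler_norm.
  have d1 := cmodDB (modep z) (cexp (k * (z - b0)%:C) * modep b0).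
  have d2 := cmodDB (modem z) (cexp (- k * (z - b0)%:C) * modem b0).
  rewrite /h ler_pdivrMr //; set E := expR (Re k * `|z - b0|) in b1 b2 n1 n2 *.
  have e0 : 0 < E by exact: E0.
  have qk : Q / cmod k <= 2^-1 by rewrite ler_pdivrMr // mulrC ler_pdivlMr // mulrC.
  have qk0 : 0 <= Q / cmod k by rewrite divr_ge0 // ltW.
  set p := Q / cmod k in b1 b2 qk qk0.
  have b3 : N / 2 * p * E <= N / 4 * E.
    rewrite ler_wpM2r ?(ltW e0) //; have := ler_wpM2l N0 qk; lra.
  rewrite /mode_sum mulrDl; move: b1 b2 n1 n2 d1 d2 b3; lra.
- exact: mode_sum_ge0.
Qed.

(** The estimate used for all solutions: from b0 = 0 for X_1 and X_2, from b0 =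
    T for psi, and from an interior b0 for the solutions vanishing there. *)
Lemma sol_growth (b0 x : R) : b0 \in `[0, T] -> x \in `[0, T] ->
  cmod k * cmod (y x) + cmod (dy x) <=
  4 * (cmod k * cmod (y b0) + cmod (dy b0)) * expR (Re k * `|x - b0|).
Proof.
move=> b0T xT; have := two_point b0T xT.
have h1 := le_mode_sum_y x; have h2 := le_mode_sum_dy x.
have : mode_sum b0 <= 2 * (cmod k * cmod (y b0) + cmod (dy b0)).
  have k1 := cmodD (dy b0) (k * y b0); have k2 := cmodDl (dy b0) (k * y b0).
  by rewrite cmodM in k1 k2; rewrite /mode_sum /modep /modem; lra.
have e0 := expR_gt0 (Re k * `|x - b0|); set E := expR _ in e0 *.
set m := mode_sum b0; set A := _ + cmod (dy b0) => h3 h4.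
have := ler_wpM2r (ltW e0) h3; lra.
Qed.

(** Both amplitudes equal -1 at T. The wave that grows towards 0 is the leading
    term; the other one is smaller by the factor exp(-2 Re k (T - x)). *)
Lemma psi_leading (x : R) : y T = 0 -> dy T = -1 -> x \in `[0, T] ->
  cmod (2 * k * y x - cexp (k * (T - x)%:C)) <=
    (expR (- (2 * (Re k * (T - x)))) + 4 * (Q / cmod k)) * expR (Re k * (T - x)).
Proof.
move=> yT dyT xT.
have TT : T \in `[0, T] by rewrite in_itv /= lexx ltW.
have mT : mode_sum T = 2.
  by rewrite /mode_sum /modep /modem yT dyT mulr0 addr0 subr0 cmodN cmod1.
have mM t : t \in `[0, T] -> mode_sum t <= 4 * expR (Re k * `|t - T|).
  by move=> tT; have := two_point TT tT; rewrite mT -natrM.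
have b1 := modep_bound TT xT (ler0n _ 4) mM; have b2 := modem_bound TT xT (ler0n _ 4) mM.
have mp : modep T = -1 by rewrite /modep yT dyT mulr0 addr0.
have mm : modem T = -1 by rewrite /modem yT dyT mulr0 subr0.
rewrite mp in b1; rewrite mm in b2.
have ex : - k * (x - T)%:C = k * (T - x)%:C by rewrite !rmorphB /=; ring.
rewrite ex in b2.
have -> : 2 * k * y x - cexp (k * (T - x)%:C) =
  (modep x - cexp (k * (x - T)%:C) * -1) - (modem x - cexp (k * (T - x)%:C) * -1) - cexp (k * (x - T)%:C).
  by rewrite /modep /modem; ring.
move: xT; rewrite in_itv /= => /andP[x0 x1].
have n1 : `|x - T| = T - x by rewrite distrC ger0_norm // subr_ge0.
rewrite n1 in b1 b2.
apply: (le_trans (cmodDl _ _)); rewrite cmod_cexpR.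
have -> : Re k * (x - T) = - (2 * (Re k * (T - x))) + Re k * (T - x) by ring.
rewrite expRD.
have := cmodDl (modep x - cexp (k * (x - T)%:C) * -1) (modem x - cexp (k * (T - x)%:C) * -1).
by move: b1 b2; set p := Q / cmod k; set E := expR (Re k * _); lra.
Qed.

End Asymptotics.

(** * Estimates of the linear forms *)

Section Estimates.
Variables (R : realType) (T : R).
Hypothesis T0 : 0 < T.
Local Notation C := R[i].
Local Notation mu := (@lebesgue_measure R).
Local Notation Re := complex.Re.
Local Notation Im := complex.Im.
Local Notation ac := (ac_with_deriv T).
Implicit Types (y dy s f g : R -> C) (l k : C).

Lemma sector_slope (a b c m : R) : 0 <= a -> 0 <= c -> c ^+ 2 = b ^+ 2 -> m <= a + c ->
  - (a * a - b * b) <= 2 * a * c -> m <= 4 * a.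
Proof.
move=> a0 c0 cb mab H.
suff : c <= 3 * a by lra.
rewrite leNgt; apply/negP => lt; nra.
Qed.

(** Outside the sector |Im l| < Re l the root k stays away from the imaginary
    axis, so that |k| and Re k are comparable. *)
Lemma neg_square_root l : exists k : C, [/\ l = - k ^+ 2, 0 <= Re k, cmod k ^+ 2 = cmod l &
  (Re l <= `|Im l| -> cmod k <= 4 * Re k)].
Proof.
have [u uP] := @complex_root R 2 (- l) isT.
have [k kP k0] : exists2 k : C, k ^+ 2 = - l & 0 <= Re k.
  have [u0|/ltW u0] := leP 0 (Re u); first by exists u.
  by exists (- u); rewrite ?sqrrN // cReN oppr_ge0.
exists k; rewrite kP opprK; split=> //; first by rewrite -cmodX kP cmodN.
have := cmod_le_ReIm k.
have -> : l = - (k * k) by rewrite -expr2 kP opprK.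
rewrite cReN cImN cReM cImM normrN; move: k0 (cmod k) => {kP}; case: k => a b /= a0 m mab H.
have E : `|a * b + b * a| = 2 * a * `|b|.
  have -> : a * b + b * a = 2 * a * b by ring.
  by rewrite normrM ger0_norm // mulr_ge0.
have : `|b| ^+ 2 = b ^+ 2 by rewrite -normrX ger0_norm // sqr_ge0.
move=> cb; rewrite E in H; rewrite (ger0_norm a0) in mab.
exact: (sector_slope a0 (normr_ge0 b) cb mab H).
Qed.

Lemma Rint_exp (v a b : R) : 0 <= a -> a <= b -> b <= T ->
  v * \int[mu]_(t in `[a, b]) expR (v * t) = expR (v * b) - expR (v * a).
Proof.
move=> a0 ab bT.
have E (t : R) : cexp (v%:C * t%:C) = (expR (v * t))%:C.
  by rewrite -rmorphM /cexp /= cos0 sin0 mulr1 mulr0.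
have c := ac_cts (ltW T0) (ac_cexp (ltW T0) v%:C).
have := ac_incr (ac_cexp (ltW T0) v%:C) a0 ab bT.
rewrite cintegralZ //; last exact: (cint_sub a0 bT (ccts_integrable (ltW T0) c)).
rewrite (eq_cintegral (g := fun t => (expR (v * t))%:C)); last by move=> t _; exact: E.
by rewrite cintegral_real !E -rmorphB -rmorphM => -[] ->.
Qed.

Lemma rint_expR (v a b : R) : rintegrable `[a, b] (fun t => expR (v * t)).
Proof.
apply: rintegrable_cts; apply: continuous_subspaceT => x.
by apply: (continuous_comp (g := expR)); [exact: mulrl_continuous|exact: continuous_expR].
Qed.

(** Each side of the peak has mass at most 1/u. *)
Lemma peak_integral (u a : R) : 0 < u -> a \in `[0, T] ->
  rintegrable `[0, T] (fun t => expR (u * - `|t - a|)) /\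
  \int[mu]_(t in `[0, T]) expR (u * - `|t - a|) <= 2 / u.
Proof.
move=> u0; rewrite in_itv /= => /andP[a0 aT].
have i0 : rintegrable `[0, T] (fun t => expR (u * - `|t - a|)).
  apply: rintegrable_cts; apply: continuous_subspaceT => x.
  apply: (@continuous_comp _ _ _ (fun t : R => u * - `|t - a|) (@expR R)); last exact: continuous_expR.
  apply: (@continuous_comp _ _ _ (fun t : R => - `|t - a|) (fun z : R => u * z)); last exact: mulrl_continuous.
  apply: (@continuousN _ R); apply: (@continuous_comp _ _ _ (fun t : R => t - a) (fun z : R => `|z|)).
    by apply: (@continuousB _ R) => //; exact: cst_continuous.
  exact: norm_continuous.
split=> //; rewrite (Rint_split a0 aT i0).
have -> : \int[mu]_(x in `[0, a]) expR (u * - `|x - a|) = expR (- (u * a)) * \int[mu]_(x in `[0, a]) expR (u * x).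
  rewrite -RintegralZl //; last exact: rint_expR.
  apply: eq_Rintegral => x; rewrite inE /= in_itv /= => /andP[x0 xa].
  rewrite -expRD; congr expR; rewrite distrC ger0_norm ?subr_ge0 //; ring.
have -> : \int[mu]_(x in `[a, T]) expR (u * - `|x - a|) = expR (u * a) * \int[mu]_(x in `[a, T]) expR (- u * x).
  rewrite -RintegralZl //; last exact: rint_expR.
  apply: eq_Rintegral => x; rewrite inE /= in_itv /= => /andP[x0 xa].
  rewrite -expRD; congr expR; rewrite ger0_norm ?subr_ge0 //; ring.
have h1 := Rint_exp u (lexx 0) a0 aT; have h2 := Rint_exp (- u) a0 aT (lexx T).
rewrite ler_pdivlMr // mulrDl mulrAC [X in _ + X]mulrAC.
move: h1 h2; set I1 := \int[mu]_(x in _) _; set I2 := \int[mu]_(x in _) _ => h1 h2.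
rewrite -mulrA [u * I1 in leLHS]h1.
have -> : expR (u * a) * u * I2 = - (expR (u * a) * (- u * I2)) by ring.
rewrite h2 mulr0 expR0 !mulNr !expRN !mulrBr mulr1.
have e1 := expR_gt0 (u * a); have e2 := expR_gt0 (u * T).
rewrite mulVf ?divff ?gt_eqF //.
have : 0 <= expR (u * a) / expR (u * T) by rewrite mulr_ge0 ?invr_ge0 // ltW.
have : 0 <= (expR (u * a))^-1 by rewrite invr_ge0 ltW.
by move: (_^-1) (_ / expR (u * T)) => p r; lra.
Qed.

Variable s : R -> C.
Hypothesis bv : cbounded_variation 0 T s.
Local Notation s0 := (right_lim s 0).

Lemma bv_bounded : exists2 B : R, 0 <= B &
  forall t, t \in `[0, T] -> cmod (s t - s0) <= B.
Proof.
have [v vP] := bv_dominated bv.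
have zT : 0 \in `[0, T] by rewrite in_itv /= lexx ltW.
exists (cmod (s 0) + (v T - v 0) + cmod s0).
  have := dominated_bounded vP zT; have := cmod_ge0 s0; have := cmod_ge0 (s 0); lra.
move=> t tT; have := dominated_bounded vP tT; have := cmodDl (s t) s0; lra.
Qed.

Lemma bv_jump_int dy : ccts 0 T dy -> cintegrable `[0, T] (fun t => (s t - s0) * dy t).
Proof.
move=> cdy; have [B B0 BP] := bv_bounded; have [v vP] := bv_dominated bv.
apply: (@cintegrableM_bounded _ _ _ _ B) => //; last exact: (ccts_integrable (ltW T0)).
by apply: cmeasurableD => //; exact: (dominated_measurable T0 vP).
Qed.

(** The integral over the two peaks gains a factor 1/u, and the value at 0 is
    only seen through the jump of s. *)
Lemma form_peak_bound : exists2 B : R, 0 <= B & forall y dy (u a N : R),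
  ac y dy -> ccts 0 T dy -> y T = 0 -> 0 < u -> a \in `[0, T] -> 0 <= N ->
  (forall t, t \in `[0, T] -> cmod (dy t) <= N * (expR (u * - t) + expR (u * - `|t - a|))) ->
  cmod (U T s y) <= cmod (jump0 s) * cmod (y 0) + B * N * (4 / u).
Proof.
have [B B0 BP] := bv_bounded; exists B => // y dy u a N yP cdy yT u0 aT N0 dyN.
have zT : 0 \in `[0, T] by rewrite in_itv /= lexx ltW.
rewrite (U_jump T0 yP cdy bv) yT mulr0 addr0.
apply: (le_trans (cmodDl _ _)); rewrite cmodM lerD2l.
have [i1 h1] := peak_integral u0 zT; have [i2 h2] := peak_integral u0 aT.
have E : forall t, t \in `[0, T] -> expR (u * - t) = expR (u * - `|t - 0|).
  by move=> t; rewrite in_itv /= => /andP[t0 _]; rewrite subr0 ger0_norm.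
apply: (le_trans (y := \int[mu]_(t in `[0, T]) (B * N * (expR (u * - `|t - 0|) + expR (u * - `|t - a|))))).
  apply: cintegral_norm_le => //; first exact: bv_jump_int.
    by apply: rintegrableZ => //; exact: rintegrableD.
  move=> t tT; rewrite cmodM -mulrA ler_pM ?cmod_ge0 //; first exact: BP.
  by rewrite -E // dyN.
rewrite RintegralZl //; last exact: rintegrableD.
rewrite RintegralD // ler_wpM2l ?mulr_ge0 //.
apply: (le_trans (lerD h1 h2)); lra.
Qed.

(** The function s - s(0+) is small to the right of 0 but not at 0, so the bound
    is asked on the half-open interval. *)
Lemma cintegral_norm_le_oc f (u : R -> R) : cintegrable `[0, T] f -> rintegrable `[0, T] u ->
  (forall t : R, 0 < t -> t <= T -> cmod (f t) <= u t) ->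
  cmod (cintegral `[0, T] f) <= \int[mu]_(t in `[0, T]) u t.
Proof.
move=> cf ru fu.
have sub : `]0, T]%classic `<=` (`[0, T]%classic : set R).
  by move=> t /=; rewrite !in_itv /= => /andP[/ltW-> ->].
have cf' : cintegrable `]0, T] f by apply: cintegrableS cf.
have ru' : rintegrable `]0, T] u by apply: integrableS ru.
have -> : cintegral `[0, T] f = cintegral `]0, T] f.
  by rewrite /cintegral -!Rintegral_itv_obnd_cbnd //; [exact: cf'.2|exact: cf'.1].
rewrite -Rintegral_itv_obnd_cbnd //.
apply: cintegral_norm_le => // t /=; rewrite in_itv /= => /andP[]; exact: fu.
Qed.

Lemma expR_quadratic (x : R) : 0 < x -> expR (- x) <= 4 / x ^+ 2.
Proof.
move=> x0; have h : x / 2 <= expR (x / 2) by have := expR_ge1Dx (x / 2); lra.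
have x2 : 0 < x ^+ 2 by rewrite exprn_gt0.
rewrite expRN ler_pdivlMr // mulrC ler_pdivrMr ?expR_gt0 //.
have -> : expR x = expR (x / 2) ^+ 2 by rewrite expr2 -expRD -splitr.
have p : 0 <= x / 2 by rewrite divr_ge0 // ltW.
have := ler_pM p p h h; rewrite -!expr2 exprMn; lra.
Qed.

Variable q : R -> C.
Hypothesis iq : cintegrable `[0, T] q.
Local Notation Q := (q_norm T q).

(** By U_jump and psi_leading the jump at 0 contributes the leading term. In the
    remaining integral y' is at most 4 exp(Re k (T - t)), a peak at t = 0; for t
    < d the factor s - s(0+) is small, and for t >= d the peak is smaller by
    exp(- Re k d). *)
Lemma form_leading (e : R) : 0 < e -> exists2 K : R, 0 < K & forall (k : C) y dy,
  slsol T q (- k ^+ 2) y dy -> y T = 0 -> dy T = -1 ->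
  cmod k <= 4 * Re k -> K <= cmod k ->
  cmod (2 * k * U T s y - jump0 s * cexp (k * T%:C)) <= e * expR (Re k * T).
Proof.
move=> e0; have [B B0 BP] := bv_bounded; have [v vP] := bv_dominated bv.
have e20 : 0 < e / 128 by rewrite divr_gt0.
have [d d0 dP] := dominated_right_lim T0 vP e20.
have Q0 := q_norm_ge0 T q.
have h0 := cmod_ge0 (jump0 s); set h := cmod (jump0 s) in h0.
(* A / |k| collects the errors of psi_leading and of the part t >= d of the
   integral *)
pose A := h * (2 / T + 4 * Q) + 512 * B * T / d ^+ 2.
have d20 : 0 < d ^+ 2 by rewrite exprn_gt0.
have A0 : 0 <= A.
  apply: addr_ge0.
    by rewrite mulr_ge0 // addr_ge0 // mulr_ge0 // invr_ge0 ltW.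
  apply: divr_ge0; last exact: ltW.
  exact: (mulr_ge0 (mulr_ge0 (ler0n R 512) B0) (ltW T0)).
exists (2 * Q + 1 + 2 * A / e).
  have : 0 <= 2 * A / e by rewrite divr_ge0 ?mulr_ge0 // ltW.
  by lra.
move=> k y dy sol yT dyT ku Kk.
have Ae0 : 0 <= 2 * A / e by rewrite divr_ge0 ?mulr_ge0 // ltW.
have kQ : 2 * Q <= cmod k by lra.
have k0 : 0 < cmod k by lra.
have kA : A / cmod k <= e / 2.
  rewrite ler_pdivrMr //; have : 2 * A / e <= cmod k by lra.
  by rewrite ler_pdivrMr //; lra.
have u0 : 0 < Re k by lra.
have zT : 0 \in `[0, T] by rewrite in_itv /= lexx ltW.
have TT : T \in `[0, T] by rewrite in_itv /= lexx ltW.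
have [yac dyac] := sol.
have cdy : ccts 0 T dy := ac_cts (ltW T0) dyac.
have E0 := expR_gt0 (Re k * T); set E := expR (Re k * T) in E0 *.
have dyb (t : R) : t \in `[0, T] -> cmod (dy t) <= 4 * E * expR (Re k * - t).
  move=> tT; have := sol_growth T0 iq sol (ltW u0) kQ k0 TT tT.
  rewrite yT dyT cmod0 mulr0 add0r cmodN cmod1 mulr1 => H.
  have -> : 4 * E * expR (Re k * - t) = 4 * expR (Re k * `|t - T|).
    rewrite -mulrA -expRD; congr (4 * expR _).
    by move: tT; rewrite in_itv /= => /andP[t0 t1]; rewrite distrC ger0_norm ?subr_ge0 //; ring.
  by have := mulr_ge0 (ltW k0) (cmod_ge0 (y t)); lra.
have lead := psi_leading T0 iq sol (ltW u0) kQ k0 yT dyT zT.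
rewrite subr0 in lead.
have small : expR (- (2 * (Re k * T))) <= 2 / T / cmod k.
  have := expR_ge1Dx (2 * (Re k * T)); rewrite expRN => H.
  have uT : 0 < Re k * T by rewrite mulr_gt0.
  rewrite -[leRHS]invrK lef_pV2 ?posrE ?expR_gt0 ?invr_gt0 ?divr_gt0 //.
  apply: le_trans H; rewrite !invfM !invrK.
  have -> : 2^-1 * T * cmod k = T * cmod k / 2 by ring.
  have := ler_wpM2l (ltW T0) ku; lra.
rewrite (U_jump T0 yac cdy bv) yT mulr0 addr0.
set I := cintegral _ _.
have -> : 2 * k * (jump0 s * y 0 - I) - jump0 s * cexp (k * T%:C) =
  jump0 s * (2 * k * y 0 - cexp (k * T%:C)) - 2 * k * I by ring.
apply: (le_trans (cmodDl _ _)); rewrite !cmodM cmod_nat.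
have p1 : h * cmod (2 * k * y 0 - cexp (k * T%:C)) <= h * ((2 / T + 4 * Q) / cmod k * E).
  rewrite ler_wpM2l //; apply: (le_trans lead); rewrite ler_wpM2r ?(ltW E0) //.
  lra.
have p2 : cmod I <= 4 * E * (e / 64 / Re k + B * expR (- (Re k * d)) * T).
  have [i1 h1] := peak_integral u0 zT.
  have i2 : rintegrable `[0, T] (fun t => e / 128 * expR (Re k * - `|t - 0|) + B * expR (- (Re k * d))).
    by apply: rintegrableD => //; [exact: rintegrableZ|exact: rintegrable_cst].
  apply: (le_trans (y := \int[mu]_(t in `[0, T]) (4 * E * (e / 128 * expR (Re k * - `|t - 0|) + B * expR (- (Re k * d)))))).
    apply: cintegral_norm_le_oc; [exact: bv_jump_int|exact: rintegrableZ|].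
    move=> t t0 tT; have tI : t \in `[0, T] by rewrite in_itv /= (ltW t0).
    rewrite subr0 ger0_norm ?(ltW t0) // cmodM.
    apply: (le_trans (ler_wpM2l (cmod_ge0 _) (dyb t tI))).
    rewrite mulrCA -!mulrA ler_wpM2l // ler_wpM2l ?(ltW E0) //.
    have x0 := expR_ge0 (Re k * - t); have z0 := expR_ge0 (- (Re k * d)).
    have [td|dt] := ltP t d.
      have := ler_wpM2r x0 (dP t t0 td tT); have := mulr_ge0 B0 z0; lra.
    have : expR (Re k * - t) <= expR (- (Re k * d)).
      by rewrite ler_expR mulrN lerN2 ler_wpM2l // ltW.
    move=> H; have := ler_pM (cmod_ge0 _) x0 (BP t tI) H.
    have := mulr_ge0 (ltW e20) x0; lra.
  rewrite RintegralZl // ler_wpM2l ?mulr_ge0 ?(ltW E0) //.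
  rewrite RintegralD //; [|exact: rintegrableZ|exact: rintegrable_cst].
  rewrite RintegralZl // Rint_cst ?(ltW T0) // subr0 lerD2r.
  apply: (le_trans (ler_wpM2l (ltW e20) h1)); lra.
have p3 : cmod k * expR (- (Re k * d)) <= 64 / d ^+ 2 / cmod k.
  have := expR_quadratic (mulr_gt0 u0 d0); rewrite exprMn => H.
  have ru : 0 < Re k ^+ 2 * d ^+ 2 by rewrite mulr_gt0 // exprn_gt0.
  apply: (le_trans (ler_wpM2l (ltW k0) H)).
  rewrite ler_pdivlMr // mulrAC mulrA ler_pdivrMr //.
  have -> : 64 / d ^+ 2 * (Re k ^+ 2 * d ^+ 2) = 64 * Re k ^+ 2 by field; rewrite gt_eqF.
  have := ler_pM (ltW k0) (ltW k0) ku ku; lra.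
have p4 : cmod k / Re k <= 4 by rewrite ler_pdivrMr.
have p5 : 2 * cmod k * cmod I <= (e / 8 * (cmod k / Re k) + 8 * B * T * (cmod k * expR (- (Re k * d)))) * E.
  have := ler_wpM2l (ltW k0) p2; lra.
have p6 : 8 * B * T * (cmod k * expR (- (Re k * d))) <= 8 * B * T * (64 / d ^+ 2 / cmod k).
  by rewrite ler_wpM2l // !mulr_ge0 // ltW.
have p7 : (e / 8 * (cmod k / Re k) + 8 * B * T * (cmod k * expR (- (Re k * d)))) * E <=
   (e / 2 + 512 * B * T / d ^+ 2 / cmod k) * E.
  apply: (ler_wpM2r (ltW E0)); apply: lerD.
    by have := ler_wpM2l (ltW e0) p4; lra.
  by apply: (le_trans p6); lra.
apply: (le_trans (lerD p1 (le_trans p5 p7))).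
have := ler_wpM2r (ltW E0) kA; rewrite /A; lra.
Qed.

End Estimates.

(** * Entire functions of order one half *)

Section OrderHalf.
Variable R : realType.
Local Notation C := R[i].
Implicit Types (f g : C -> C) (l : C).

Definition entire_half f := entire f /\ order_half f.

Lemma half_weight_ge1 l : 1 <= 1 + Num.sqrt (cmod l).
Proof. by rewrite lerDl sqrtr_ge0. Qed.

Lemma le_expR (x : R) : x <= expR x.
Proof. by have := expR_ge1Dx x; lra. Qed.

Lemma entire_half_cst (c : C) : entire_half (fun=> c).
Proof.
split; first exact: entire_cst.
exists (cmod c) => [|z]; first exact: cmod_ge0.
apply: (le_trans _ (le_expR _)); rewrite ler_peMr ?cmod_ge0 //; exact: half_weight_ge1.
Qed.

Lemma entire_halfD f g : entire_half f -> entire_half g -> entire_half (fun z => f z + g z).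
Proof.
move=> [ef [K K0 fK]] [eg [L L0 gL]]; split; first exact: entireD.
exists (K + L + 1) => [|z]; first by rewrite !addr_ge0.
apply: (le_trans (cmodD _ _)); apply: (le_trans (lerD (fK z) (gL z))).
have := half_weight_ge1 z; set r := 1 + _ => r1.
have r0 : 0 <= r by apply: le_trans r1.
rewrite mulrDl expRD mul1r.
have h1 : expR (K * r) <= expR ((K + L) * r) by rewrite ler_expR ler_wpM2r // lerDl.
have h2 : expR (L * r) <= expR ((K + L) * r) by rewrite ler_expR ler_wpM2r // lerDr.
have h3 : 2 <= expR r by have := expR_ge1Dx r; lra.
have := ler_wpM2l (expR_ge0 ((K + L) * r)) h3; lra.
Qed.

Lemma entire_halfM f g : entire_half f -> entire_half g -> entire_half (fun z => f z * g z).
Proof.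
move=> [ef [K K0 fK]] [eg [L L0 gL]]; split; first exact: entireM.
exists (K + L) => [|z]; first by rewrite !addr_ge0.
by rewrite cmodM mulrDl expRD ler_pM ?cmod_ge0.
Qed.

Lemma entire_halfB f g : entire_half f -> entire_half g -> entire_half (fun z => f z - g z).
Proof.
move=> hf hg; have [e o] := entire_halfD hf (entire_halfM (entire_half_cst (-1)) hg).
have E : (fun z => f z + -1 * g z) = (fun z => f z - g z) by apply/funext => z; rewrite mulN1r.
by split; [rewrite -E|rewrite -E].
Qed.

Lemma entire_half_tail f (r K : R) : 0 <= K -> entire f ->
  (forall z, r <= cmod z -> cmod (f z) <= expR (K * (1 + Num.sqrt (cmod z)))) -> entire_half f.
Proof.
move=> K0 ef fK; split=> //; have [M M0 MP] := entire_bounded r ef.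
exists (K + M) => [|z]; first by rewrite addr_ge0.
have r1 := half_weight_ge1 z; have r0 : 0 <= 1 + Num.sqrt (cmod z) by apply: le_trans r1.
have [zr|/ltW rz] := leP (cmod z) r.
  apply: (le_trans (MP z zr)); apply: (le_trans _ (le_expR _)).
  have := mulr_ge0 K0 r0; have := ler_wpM2l M0 r1; lra.
by apply: (le_trans (fK z rz)); rewrite ler_expR ler_wpM2r // lerDl.
Qed.

End OrderHalf.

(** * Solutions with fixed data at 0 *)

Section CauchyFamily.
Variables (R : realType) (T : R).
Hypothesis T0 : 0 < T.
Local Notation C := R[i].
Local Notation mu := (@lebesgue_measure R).
Local Notation Re := complex.Re.
Local Notation Im := complex.Im.
Local Notation ac := (ac_with_deriv T).
Implicit Types (q s : R -> C) (l k a b : C).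

Lemma bv_sup s : cbounded_variation 0 T s -> cmeasurable `[0, T] s /\
  exists2 M : R, 0 <= M & forall x : R, x \in `[0, T] -> cmod (s x) <= M.
Proof.
move=> bv; have [v vP] := bv_dominated bv.
split; first exact: (dominated_measurable T0 vP).
exists (cmod (s 0) + (v T - v 0)); last exact: (dominated_bounded vP).
rewrite addr_ge0 ?cmod_ge0 //.
have TT : T \in `[0, T] by rewrite in_itv /= lexx ltW.
by have := vP 0 T (lexx 0) (ltW T0) (lexx T); apply: le_trans; exact: cmod_ge0.
Qed.

Lemma form_lin s a b y dy z dz : cbounded_variation 0 T s ->
  ac y dy -> ccts 0 T dy -> ac z dz -> ccts 0 T dz ->
  U T s (fun x => a * y x + b * z x) = a * U T s y + b * U T s z.
Proof.
move=> bv hy cy hz cz; have [ms [M M0 sM]] := bv_sup bv.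
have cab : ccts 0 T (fun x => a * dy x + b * dz x).
  by apply: cctsD; apply: cctsM => //; exact: ccts_cst.
rewrite (U_parts T0 (acD (acZ a hy) (acZ b hz)) cab bv) (U_parts T0 hy cy bv) (U_parts T0 hz cz bv).
have ci g : ccts 0 T g -> cintegrable `[0, T] (fun t => s t * g t).
  move=> cg; apply: (@cintegrableM_bounded _ _ _ _ M) => //.
  exact: (ccts_integrable (ltW T0) cg).
have -> : cintegral `[0, T] (fun t => s t * (a * dy t + b * dz t)) =
   a * cintegral `[0, T] (fun t => s t * dy t) + b * cintegral `[0, T] (fun t => s t * dz t).
  have iy := ci _ cy; have iz := ci _ cz.
  rewrite -(cintegralZ a _ iy) // -(cintegralZ b _ iz) // -cintegralD //; [|exact: cintegrableZ|exact: cintegrableZ].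
  by apply: eq_cintegral => t _; ring.
ring.
Qed.

Variable q : R -> C.
Hypothesis iq : cintegrable `[0, T] q.

(** The three properties through which the solutions of cauchy_exists are used;
    the order 1/2 reflects |k| = sqrt |l|. *)
Definition cauchy_family a b (y dy : C -> R -> C) :=
  [/\ forall l, [/\ slsol T q l (y l) (dy l), y l 0 = a & dy l 0 = b],
      forall x, x \in `[0, T] -> entire_half (y ^~ x) &
      forall s, cbounded_variation 0 T s -> entire_half (fun l => U T s (y l))].

Lemma sol_order_half a b : exists2 K : R, 0 <= K & exists r : R, forall l y dy,
  slsol T q l y dy -> y 0 = a -> dy 0 = b -> r <= cmod l -> forall x, x \in `[0, T] ->
  cmod (y x) <= expR (K * (1 + Num.sqrt (cmod l))) /\ cmod (dy x) <= expR (K * (1 + Num.sqrt (cmod l))).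
Proof.
have Q0 := q_norm_ge0 T q.
pose A := 4 * (cmod a + cmod b).
have a0 := cmod_ge0 a; have b0 := cmod_ge0 b.
have A0 : 0 <= A by rewrite mulr_ge0 // addr_ge0.
exists (A + (T + 1)) => [|]; first by rewrite !addr_ge0 // ltW.
exists ((2 * q_norm T q + 1) ^+ 2) => l y dy sol y0 dy0 rl x xT.
have [k [lk k0 mk _]] := neg_square_root l.
have -> : Num.sqrt (cmod l) = cmod k by rewrite -mk sqrtr_sqr ger0_norm // cmod_ge0.
have km : 2 * q_norm T q + 1 <= cmod k.
  by move: rl; rewrite -mk ler_pXn2r // nnegrE ?cmod_ge0 // addr_ge0 // mulr_ge0.
rewrite lk in sol.
have kQ : 2 * q_norm T q <= cmod k by lra.
have k1 : 1 <= cmod k by lra.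
have kp : 0 < cmod k by lra.
have zT : 0 \in `[0, T] by rewrite in_itv /= lexx ltW.
have := sol_growth T0 iq sol k0 kQ kp zT xT; rewrite y0 dy0 subr0.
move: (xT); rewrite in_itv /= => /andP[x0 x1]; rewrite (ger0_norm x0) => H.
have ek : expR (Re k * x) <= expR (cmod k * T).
  rewrite ler_expR ler_pM //; exact: (le_trans (ler_norm _) (Re_le_cmod k)).
have kab : 4 * (cmod k * cmod a + cmod b) <= cmod k * A.
  rewrite /A; have := ler_wpM2r b0 k1; lra.
have H2 : cmod k * cmod (y x) + cmod (dy x) <= cmod k * (A * expR (cmod k * T)).
  apply: (le_trans H); rewrite mulrA.
  apply: (le_trans (ler_wpM2r (expR_ge0 _) kab)).
  by rewrite ler_wpM2l // mulr_ge0 // ltW.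
have yx := cmod_ge0 (y x); have dyx := cmod_ge0 (dy x).
have yb : cmod (y x) <= A * expR (cmod k * T).
  by rewrite -(ler_pM2l kp); lra.
have E1 : A * expR (cmod k * T) <= expR (A + cmod k * T).
  by rewrite expRD ler_wpM2r ?expR_ge0 ?le_expR.
have AT := mulr_ge0 A0 (ltW kp).
split.
  apply: (le_trans yb); apply: (le_trans E1); rewrite ler_expR; lra.
have : cmod k * (A * expR (cmod k * T)) <= expR (A + (T + 1) * cmod k).
  have -> : A + (T + 1) * cmod k = cmod k + (A + cmod k * T) by ring.
  by rewrite [leRHS]expRD; apply: ler_pM => //; [exact: ltW|rewrite mulr_ge0 ?expR_ge0|exact: le_expR].
have : expR (A + (T + 1) * cmod k) <= expR ((A + (T + 1)) * (1 + cmod k)).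
  by rewrite ler_expR; lra.
have := mulr_ge0 (ltW kp) yx; lra.
Qed.

Lemma cauchy_family_exists a b : exists y dy, cauchy_family a b y dy.
Proof.
have [y [dy [yP ey edy eI]]] := cauchy_exists T0 iq a b; exists y, dy.
have [K K0 [r rP]] := sol_order_half a b.
split=> //.
  move=> x xT; apply: (entire_half_tail (r := r) K0 (ey x xT)) => l rl.
  by have [s1 s2 s3] := yP l; have [] := rP l _ _ s1 s2 s3 rl x xT.
move=> s bv; have [ms [M M0 sM]] := bv_sup bv.
have TT : T \in `[0, T] by rewrite in_itv /= lexx ltW.
have zT : 0 \in `[0, T] by rewrite in_itv /= lexx ltW.
have UE l : U T s (y l) = y l T * s T - y l 0 * s 0 - cintegral `[0, T] (fun t => s t * dy l t).
  have [[h1 h2] _ _] := yP l; exact: (U_parts T0 h1 (ac_cts (ltW T0) h2) bv).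
have e : entire (fun l => U T s (y l)).
  apply: (entire_ext (f := fun l => y l T * s T - y l 0 * s 0 - cintegral `[0, T] (fun t => s t * dy l t))).
    by move=> l; rewrite UE.
  apply: entireB; last exact: eI ms sM.
  by apply: entireB; apply: entireM; [exact: ey|exact: entire_cst|exact: ey|exact: entire_cst].
have sT := sM T TT; have s00 := sM 0 zT.
pose S := M * (1 + T + cmod a).
have S0 : 0 <= S by rewrite mulr_ge0 // !addr_ge0 ?cmod_ge0 // ltW.
apply: (entire_half_tail (r := r) (K := K + S)) => // [|l rl]; first by rewrite addr_ge0.
have [[h1 h2] y0 dy0] := yP l.
have B := rP l _ _ (conj h1 h2) y0 dy0 rl.
have r1 := half_weight_ge1 l; set w := 1 + _ in B r1 *.
have E1 : 1 <= expR (K * w).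
  by rewrite -[leLHS]expR0 ler_expR mulr_ge0 // (le_trans _ r1).
have cdy := ac_cts (ltW T0) h2.
have I : cmod (cintegral `[0, T] (fun t => s t * dy l t)) <= M * expR (K * w) * T.
  rewrite -[T in leRHS]subr0 -(Rint_cst (M * expR (K * w)) (ltW T0)).
  apply: cintegral_norm_le => //.
  - apply: (@cintegrableM_bounded _ _ _ _ M) => //; exact: (ccts_integrable (ltW T0) cdy).
  - exact: rintegrable_cst.
  - by move=> t tT; rewrite cmodM ler_pM ?cmod_ge0 //; [exact: sM|exact: (B t tT).2].
rewrite UE y0; apply: (le_trans (cmodDl _ _)).
have I2 := cmodDl (y l T * s T) (a * s 0); rewrite !cmodM in I2.
have I3 := ler_pM (cmod_ge0 _) (cmod_ge0 _) (B T TT).1 sT.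
have I4 := ler_wpM2l (cmod_ge0 a) s00.
have a0 := cmod_ge0 a.
have I5 : S * expR (K * w) <= expR ((K + S) * w).
  rewrite mulrDl expRD [leRHS]mulrC ler_wpM2r ?expR_ge0 //.
  by apply: (le_trans _ (le_expR _)); rewrite ler_peMr.
apply: (le_trans _ I5); rewrite /S.
have I6 := ler_wpM2l (mulr_ge0 M0 a0) E1.
set X := expR (K * w) in I I3 I6 *; lra.
Qed.

End CauchyFamily.

(** * Fundamental systems and characteristic functions *)

Section System.
Variables (R : realType) (T : R).
Hypothesis T0 : 0 < T.
Local Notation C := R[i].
Local Notation mu := (@lebesgue_measure R).
Local Notation ac := (ac_with_deriv T).
Implicit Types (q s y dy z dz : R -> C) (l k a b : C).

(** X_1 and X_2 with their derivatives, as families that depend analytically on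
    the spectral parameter; the functions in the statement are picked for every
    parameter separately. *)
Record fundamental_system q := FundamentalSystem {
  fcos : C -> R -> C; dfcos : C -> R -> C;
  fsin : C -> R -> C; dfsin : C -> R -> C;
  fcosP : cauchy_family T q 1 0 fcos dfcos;
  fsinP : cauchy_family T q 0 1 fsin dfsin }.

Lemma fundamental_system_exists q : cintegrable `[0, T] q ->
  exists S : fundamental_system q, True.
Proof.
move=> iq; have [c [dc cP]] := cauchy_family_exists T0 iq 1 0.
have [s [ds sP]] := cauchy_family_exists T0 iq 0 1.
by exists (FundamentalSystem cP sP).
Qed.

Lemma form_ext s y dy z dz : cbounded_variation 0 T s ->
  ac y dy -> ccts 0 T dy -> ac z dz -> ccts 0 T dz ->
  (forall x, x \in `[0, T] -> y x = z x /\ dy x = dz x) -> U T s y = U T s z.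
Proof.
move=> bv hy cy hz cz yz; rewrite (U_parts T0 hy cy bv) (U_parts T0 hz cz bv).
have TT : T \in `[0, T] by rewrite in_itv /= lexx ltW.
have zT : 0 \in `[0, T] by rewrite in_itv /= lexx ltW.
rewrite (yz T TT).1 (yz 0 zT).1; congr (_ - _).
by apply: eq_cintegral => x xT; rewrite (yz x xT).2.
Qed.

Lemma slsol_C1 q l y dy : slsol T q l y dy -> ac y dy /\ ccts 0 T dy.
Proof. by move=> [h1 h2]; split=> //; exact: (ac_cts (ltW T0) h2). Qed.

Section OnePotential.
Variables (q : R -> C) (iq : cintegrable `[0, T] q) (S : fundamental_system q).

Lemma fcos_sol l : [/\ slsol T q l (fcos S l) (dfcos S l), fcos S l 0 = 1 & dfcos S l 0 = 0].
Proof. by have [] := fcosP S. Qed.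
Lemma fsin_sol l : [/\ slsol T q l (fsin S l) (dfsin S l), fsin S l 0 = 0 & dfsin S l 0 = 1].
Proof. by have [] := fsinP S. Qed.

Lemma sol_expand l y dy : slsol T q l y dy -> forall x, x \in `[0, T] ->
  y x = y 0 * fcos S l x + dy 0 * fsin S l x /\ dy x = y 0 * dfcos S l x + dy 0 * dfsin S l x.
Proof.
move=> h; have [c1 c2 c3] := fcos_sol l; have [s1 s2 s3] := fsin_sol l.
exact: (slsol_basis T0 h c1 s1).
Qed.

Lemma form_expand s l y dy : cbounded_variation 0 T s -> slsol T q l y dy ->
  U T s y = y 0 * U T s (fcos S l) + dy 0 * U T s (fsin S l).
Proof.
move=> bv h; have [c1 c2 c3] := fcos_sol l; have [s1 s2 s3] := fsin_sol l.
have [hy cy] := slsol_C1 h; have [hc cc] := slsol_C1 c1; have [hs cs] := slsol_C1 s1.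
have [hl cl] := slsol_C1 (slsol_lin (y 0) (dy 0) c1 s1).
rewrite -(form_lin T0 (y 0) (dy 0) bv hc cc hs cs).
exact: (form_ext bv hy cy hl cl (sol_expand h)).
Qed.

Lemma unit_wronskian l x : x \in `[0, T] ->
  fcos S l x * dfsin S l x - dfcos S l x * fsin S l x = 1.
Proof.
move=> xT; have [c1 c2 c3] := fcos_sol l; have [s1 s2 s3] := fsin_sol l.
by rewrite (wronskian T0 c1 s1 xT) c2 s3 c3 mul0r subr0 mulr1.
Qed.

(** The solution with psi(T) = 0 and psi'(T) = -1. *)
Definition psi l x := fsin S l T * fcos S l x - fcos S l T * fsin S l x.
Definition dpsi l x := fsin S l T * dfcos S l x - fcos S l T * dfsin S l x.

(** The solution annihilated by the form of s, normalized so that its value at T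
    is the form of psi. *)
Definition phi s l x := U T s (fcos S l) * fsin S l x - U T s (fsin S l) * fcos S l x.
Definition dphi s l x := U T s (fcos S l) * dfsin S l x - U T s (fsin S l) * dfcos S l x.

(** The solution that vanishes at x0 with derivative -1 there; for x0 = T it is
    psi. *)
Definition ker x0 l x := fsin S l x0 * fcos S l x - fcos S l x0 * fsin S l x.
Definition dker x0 l x := fsin S l x0 * dfcos S l x - fcos S l x0 * dfsin S l x.

(** The form of psi: Delta_1 for the first form. *)
Definition char_fun s l := fsin S l T * U T s (fcos S l) - fcos S l T * U T s (fsin S l).
(** The function omega of the statement. *)
Definition form_det s s' l :=
  U T s (fcos S l) * U T s' (fsin S l) - U T s (fsin S l) * U T s' (fcos S l).

Lemma ker_sol x0 l : slsol T q l (ker x0 l) (dker x0 l).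
Proof.
have [c1 _ _] := fcos_sol l; have [s1 _ _] := fsin_sol l.
have := slsol_lin (fsin S l x0) (- fcos S l x0) c1 s1.
by congr slsol; apply/funext => x; rewrite mulNr.
Qed.

Lemma phi_sol s l : slsol T q l (phi s l) (dphi s l).
Proof.
have [c1 _ _] := fcos_sol l; have [s1 _ _] := fsin_sol l.
have := slsol_lin (U T s (fcos S l)) (- U T s (fsin S l)) s1 c1.
by congr slsol; apply/funext => x; rewrite mulNr.
Qed.

Lemma psi_sol l : slsol T q l (psi l) (dpsi l).
Proof. exact: ker_sol. Qed.

Lemma ker_at x0 l : x0 \in `[0, T] -> ker x0 l x0 = 0 /\ dker x0 l x0 = -1.
Proof.
move=> xT; rewrite /ker /dker; split; first by rewrite mulrC subrr.
by rewrite -(unit_wronskian l xT); ring.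
Qed.

Lemma psi_at_T l : psi l T = 0 /\ dpsi l T = -1.
Proof. by apply: ker_at; rewrite in_itv /= lexx ltW. Qed.

Lemma ker_form s x0 l : cbounded_variation 0 T s -> U T s (ker x0 l) = phi s l x0.
Proof.
move=> bv; rewrite (form_expand bv (ker_sol x0 l)) /ker /dker.
have [c1 c2 c3] := fcos_sol l; have [s1 s2 s3] := fsin_sol l.
by rewrite c2 c3 s2 s3 /phi; ring.
Qed.

Lemma psi_form s l : cbounded_variation 0 T s -> U T s (psi l) = char_fun s l.
Proof. by move=> bv; rewrite (ker_form _ _ bv) /phi /char_fun; ring. Qed.

Lemma phi_psi_wronskian s l x : x \in `[0, T] ->
  phi s l x * dpsi l x - dphi s l x * psi l x = - char_fun s l.
Proof.
move=> xT; have W := unit_wronskian l xT.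
rewrite /phi /dphi /psi /dpsi /char_fun.
transitivity (- (fsin S l T * U T s (fcos S l) - fcos S l T * U T s (fsin S l)) *
  (fcos S l x * dfsin S l x - dfcos S l x * fsin S l x)); first by ring.
by rewrite W mulr1.
Qed.

(** The values of psi are recovered from omega, the characteristic functions and
    the solutions phi. *)
Lemma form_det_psi s s' l x :
  form_det s s' l * psi l x = char_fun s' l * phi s l x - char_fun s l * phi s' l x.
Proof. by rewrite /form_det /psi /char_fun /phi; ring. Qed.

(** Otherwise (X_2(T), - X_1(T)) would be a nonzero kernel vector of the matrix
    with determinant omega. *)
Lemma no_common_zero s s' l : form_det s s' l != 0 ->
  char_fun s l = 0 -> char_fun s' l != 0.
Proof.
move=> w0 d1; apply/eqP => d2.
have TT : T \in `[0, T] by rewrite in_itv /= lexx ltW.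
have H1 : form_det s s' l * fsin S l T = 0.
  transitivity (char_fun s l * U T s' (fsin S l) - char_fun s' l * U T s (fsin S l)).
    by rewrite /form_det /char_fun; ring.
  by rewrite d1 d2 !mul0r subrr.
have H2 : form_det s s' l * fcos S l T = 0.
  transitivity (char_fun s l * U T s' (fcos S l) - char_fun s' l * U T s (fcos S l)).
    by rewrite /form_det /char_fun; ring.
  by rewrite d1 d2 !mul0r subrr.
move: H1 H2 => /eqP; rewrite mulf_eq0 (negPf w0) /= => /eqP S0 /eqP.
rewrite mulf_eq0 (negPf w0) /= => /eqP C0.
have := unit_wronskian l TT; rewrite S0 C0 mul0r mulr0 subrr => /esym/eqP.
by rewrite oner_eq0.
Qed.

Lemma fcos_half x : x \in `[0, T] -> entire_half (fcos S ^~ x).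
Proof. by have [_ h _] := fcosP S; exact: h. Qed.
Lemma fsin_half x : x \in `[0, T] -> entire_half (fsin S ^~ x).
Proof. by have [_ h _] := fsinP S; exact: h. Qed.
Lemma form_fcos_half s : cbounded_variation 0 T s -> entire_half (fun l => U T s (fcos S l)).
Proof. by have [_ _ h] := fcosP S; exact: h. Qed.
Lemma form_fsin_half s : cbounded_variation 0 T s -> entire_half (fun l => U T s (fsin S l)).
Proof. by have [_ _ h] := fsinP S; exact: h. Qed.

Lemma psi_half x : x \in `[0, T] -> entire_half (psi ^~ x).
Proof.
move=> xT; have TT : T \in `[0, T] by rewrite in_itv /= lexx ltW.
exact (entire_halfB (entire_halfM (fsin_half TT) (fcos_half xT))
                    (entire_halfM (fcos_half TT) (fsin_half xT))).
Qed.

Lemma phi_half s x : cbounded_variation 0 T s -> x \in `[0, T] -> entire_half (phi s ^~ x).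
Proof.
move=> bv xT.
exact (entire_halfB (entire_halfM (form_fcos_half bv) (fsin_half xT))
                    (entire_halfM (form_fsin_half bv) (fcos_half xT))).
Qed.

Lemma char_half s : cbounded_variation 0 T s -> entire_half (char_fun s).
Proof.
move=> bv; have TT : T \in `[0, T] by rewrite in_itv /= lexx ltW.
exact (entire_halfB (entire_halfM (fsin_half TT) (form_fcos_half bv))
                    (entire_halfM (fcos_half TT) (form_fsin_half bv))).
Qed.

Lemma form_det_half s s' : cbounded_variation 0 T s -> cbounded_variation 0 T s' ->
  entire_half (form_det s s').
Proof.
move=> bv bv'.
exact (entire_halfB (entire_halfM (form_fcos_half bv) (form_fsin_half bv'))
                    (entire_halfM (form_fsin_half bv) (form_fcos_half bv'))).
Qed.

End OnePotential.

Section Link.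
Variables (q : R -> C) (iq : cintegrable `]0, T[ q) (S : fundamental_system (trunc T q)).

Lemma cauchy_solution_slsol l a b : exists dy, [/\ slsol T (trunc T q) l (cauchy_solution T q l a b) dy,
  cauchy_solution T q l a b 0 = a & dy 0 = b].
Proof.
have : [set y | exists dy, [/\ sl_solution T q l y dy, y 0 = a & dy 0 = b]] (cauchy_solution T q l a b).
  apply: xgetPex.
  have [c1 c2 c3] := fcos_sol S l; have [s1 s2 s3] := fsin_sol S l.
  exists (fun x => a * fcos S l x + b * fsin S l x).
  exists (fun x => a * dfcos S l x + b * dfsin S l x); split.
  - by apply/(sl_solutionP T0 _ _ _ iq); exact: slsol_lin.
  - by rewrite c2 s2 mulr0 mulr1 addr0.
  - by rewrite c3 s3 mulr0 mulr1 add0r.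
by move=> [dy [/(sl_solutionP T0 _ _ _ iq) h1 h2 h3]]; exists dy.
Qed.

Lemma X1_link s l : cbounded_variation 0 T s ->
  U T s (X1 T q l) = U T s (fcos S l) /\ X1 T q l T = fcos S l T.
Proof.
move=> bv; have [dy [h1 h2 h3]] := cauchy_solution_slsol l 1 0.
have TT : T \in `[0, T] by rewrite in_itv /= lexx ltW.
rewrite /X1 (form_expand S bv h1) (sol_expand S h1 TT).1 h2 h3.
by rewrite !mul1r !mul0r !addr0.
Qed.

Lemma X2_link s l : cbounded_variation 0 T s ->
  U T s (X2 T q l) = U T s (fsin S l) /\ X2 T q l T = fsin S l T.
Proof.
move=> bv; have [dy [h1 h2 h3]] := cauchy_solution_slsol l 0 1.
have TT : T \in `[0, T] by rewrite in_itv /= lexx ltW.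
rewrite /X2 (form_expand S bv h1) (sol_expand S h1 TT).1 h2 h3.
by rewrite !mul1r !mul0r !add0r.
Qed.

Lemma Delta1_link s l : cbounded_variation 0 T s -> Delta1 T s q l = char_fun S s l.
Proof.
move=> bv; rewrite /Delta1 /V1 (X1_link l bv).1 (X1_link l bv).2 (X2_link l bv).1 (X2_link l bv).2.
by rewrite /char_fun; ring.
Qed.

Lemma omega_link s s' l : cbounded_variation 0 T s -> cbounded_variation 0 T s' ->
  omega T s s' q l = form_det S s s' l.
Proof.
move=> bv bv'; rewrite /omega (X1_link l bv).1 (X1_link l bv').1 (X2_link l bv).1 (X2_link l bv').1.
by [].
Qed.

(** The solution Phi vanishes at T, so it is the multiple of psi normalized by
    its first form. *)
Lemma weylM_link s s' l : cbounded_variation 0 T s -> cbounded_variation 0 T s' ->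
  char_fun S s l != 0 -> weylM T s s' q l * char_fun S s l = char_fun S s' l.
Proof.
move=> bv bv' d0.
have TT : T \in `[0, T] by rewrite in_itv /= lexx ltW.
have : [set y | [/\ exists dy, sl_solution T q l y dy, U T s y = 1 & V1 T y = 0]] (Phi T s q l).
  apply: xgetPex; have h := psi_sol S l.
  exists (fun x => (char_fun S s l)^-1 * psi S l x + 0 * psi S l x); split.
  - exists (fun x => (char_fun S s l)^-1 * dpsi S l x + 0 * dpsi S l x).
    by apply/(sl_solutionP T0 _ _ _ iq); exact: slsol_lin.
  - have [hp cp] := slsol_C1 h.
    by rewrite (form_lin T0 _ _ bv hp cp hp cp) psi_form // mul0r addr0 mulVf.
  - by rewrite /V1 (psi_at_T S l).1 !mulr0 addr0.
move=> [[dy /(sl_solutionP T0 _ _ _ iq) h] U1 yT].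
rewrite /weylM (form_expand S bv' h); move: U1 yT.
rewrite /V1 (form_expand S bv h) (sol_expand S h TT).1.
set a := Phi _ _ _ _ 0; set b := dy 0; move=> U1 yT.
transitivity (char_fun S s' l * (a * U T s (fcos S l) + b * U T s (fsin S l)) +
   (a * fcos S l T + b * fsin S l T) *
   (U T s' (fsin S l) * U T s (fcos S l) - U T s' (fcos S l) * U T s (fsin S l))).
  by rewrite /char_fun; ring.
by rewrite U1 yT mul0r addr0 mulr1.
Qed.

End Link.
End System.

(** * The Weyl-type function determines the characteristic functions *)

Section CharacteristicFunction.
Variables (R : realType) (T : R).
Hypothesis T0 : 0 < T.
Local Notation C := R[i].
Local Notation Re := complex.Re.
Local Notation Im := complex.Im.
Implicit Types (q s : R -> C) (l k : C).
Variable s1 : R -> C.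
Hypothesis bv1 : cbounded_variation 0 T s1.
Hypothesis H0 : jump0 s1 != 0.
Local Notation h := (cmod (jump0 s1)).

Lemma jump_gt0 : 0 < h. Proof. by rewrite cmod_gt0. Qed.

Section OnePotential.
Variables (q : R -> C) (iq : cintegrable `[0, T] q) (S : fundamental_system T q).

Lemma char_leading (e : R) : 0 < e -> exists2 K : R, 0 < K & forall k : C,
  cmod k <= 4 * Re k -> K <= cmod k ->
  cmod (2 * k * char_fun S s1 (- k ^+ 2) - jump0 s1 * cexp (k * T%:C)) <= e * expR (Re k * T).
Proof.
move=> e0; have [K K0 KP] := form_leading T0 bv1 iq e0; exists K => // k ku Kk.
have [yT dyT] := psi_at_T T0 S (- k ^+ 2).
by have := KP k _ _ (psi_sol S (- k ^+ 2)) yT dyT ku Kk; rewrite psi_form.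
Qed.

Lemma char_two_sided : exists2 K : R, 0 < K & forall k : C,
  cmod k <= 4 * Re k -> K <= cmod k ->
  h / 2 * expR (Re k * T) <= 2 * cmod k * cmod (char_fun S s1 (- k ^+ 2)) <= 3 * (h / 2) * expR (Re k * T).
Proof.
have h2 : 0 < h / 2 by rewrite divr_gt0 // jump_gt0.
have [K K0 KP] := char_leading h2; exists K => // k ku Kk.
have := KP k ku Kk; set d := char_fun _ _ _.
have E : cmod (jump0 s1 * cexp (k * T%:C)) = h * expR (Re k * T) by rewrite cmodM cmod_cexpR.
have E2 : cmod (2 * k * d) = 2 * cmod k * cmod d by rewrite !cmodM cmod_nat.
have := cmodDB (jump0 s1 * cexp (k * T%:C)) (2 * k * d).
have := cmodDB (2 * k * d) (jump0 s1 * cexp (k * T%:C)).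
by rewrite [cmod (_ - 2 * _ * _)]cmodB E E2; set X := expR _ => a b c; apply/andP; split; lra.
Qed.

End OnePotential.

Lemma real_point (x : R) : 0 < x -> cmod (x%:C : C) <= 4 * Re (x%:C : C) /\ cmod (x%:C : C) = x.
Proof. by move=> x0; rewrite cmodR ger0_norm /=; [split=> //; lra|exact: ltW]. Qed.

Lemma sector_point (z : C) (K : R) : 0 < K -> K ^+ 2 <= cmod z -> Re z <= `|Im z| ->
  exists k : C, [/\ z = - k ^+ 2, cmod k <= 4 * Re k & K <= cmod k].
Proof.
move=> K0 Kz zs; have [k [zk k0 km ks]] := neg_square_root z.
exists k; split=> //; first exact: ks.
by move: Kz; rewrite -km ler_pXn2r // nnegrE ?cmod_ge0 // ltW.
Qed.

Lemma le_small (x : R) : (forall e : R, 0 < e -> x <= e) -> x <= 0.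
Proof.
move=> H; rewrite leNgt; apply/negP => x0.
have x2 : 0 < x / 2 by rewrite divr_gt0.
by have := H _ x2; lra.
Qed.

Variables (q1 q2 : R -> C).
Hypotheses (iq1 : cintegrable `[0, T] q1) (iq2 : cintegrable `[0, T] q2).
Variables (S1 : fundamental_system T q1) (S2 : fundamental_system T q2).
Variable s2 : R -> C.
Hypothesis bv2 : cbounded_variation 0 T s2.
Hypothesis ratio : forall l, char_fun S1 s1 l != 0 -> char_fun S2 s1 l != 0 ->
  char_fun S1 s2 l * char_fun S2 s1 l = char_fun S2 s2 l * char_fun S1 s1 l.
Hypothesis no_common2 : forall l, char_fun S1 s1 l = 0 -> char_fun S1 s2 l != 0.

(** The functions M agree off the zeros of the two functions Delta_1, hence the
    entire cross products agree everywhere. *)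
Lemma char_cross l : char_fun S1 s2 l * char_fun S2 s1 l = char_fun S2 s2 l * char_fun S1 s1 l.
Proof.
have [K1 K10 KP1] := char_two_sided iq1 S1; have [K2 K20 KP2] := char_two_sided iq2 S2.
pose x := Num.max K1 K2.
have x0 : 0 < x by rewrite lt_max K10.
have [xs xm] := real_point x0.
have K1x : K1 <= cmod (x%:C : C) by rewrite xm le_max lexx.
have K2x : K2 <= cmod (x%:C : C) by rewrite xm le_max lexx orbT.
have E0 : 0 < h / 2 * expR (Re (x%:C : C) * T) by rewrite mulr_gt0 ?expR_gt0 // divr_gt0 // jump_gt0.
have nz (d : C) : h / 2 * expR (Re (x%:C : C) * T) <= 2 * cmod (x%:C : C) * cmod d -> d != 0.
  move=> H; apply/eqP => d0; move: H; rewrite d0 cmod0 mulr0; move: E0; lra.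
have /andP[/nz d1 _] := KP1 _ xs K1x; have /andP[/nz d2 _] := KP2 _ xs K2x.
apply/eqP; rewrite -subr_eq0; apply/eqP.
have [e11 _] := char_half T0 S1 bv1; have [e21 _] := char_half T0 S2 bv1.
have [e12 _] := char_half T0 S1 bv2; have [e22 _] := char_half T0 S2 bv2.
apply: (entire_idomain (f := fun z => char_fun S1 s1 z * char_fun S2 s1 z)
  (g := fun z => char_fun S1 s2 z * char_fun S2 s1 z - char_fun S2 s2 z * char_fun S1 s1 z)
  (z1 := - x%:C ^+ 2)).
- exact: entireM.
- by apply: entireB; apply: entireM.
- by rewrite mulf_neq0.
- move=> z; have [->|n1] := eqVneq (char_fun S1 s1 z) 0; first by rewrite !mul0r.
  have [->|n2] := eqVneq (char_fun S2 s1 z) 0; first by rewrite mulr0 mul0r.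
  by rewrite (ratio n1 n2) subrr mulr0.
Qed.

(** The quotient of the first characteristic functions, continued through their
    zeros by the quotient of the second ones. *)
Definition char_ratio l := if char_fun S1 s1 l == 0 then char_fun S2 s2 l / char_fun S1 s2 l
  else char_fun S2 s1 l / char_fun S1 s1 l.

Lemma char_ratioP l : char_fun S2 s1 l = char_ratio l * char_fun S1 s1 l /\
  char_fun S2 s2 l = char_ratio l * char_fun S1 s2 l.
Proof.
have cr := char_cross l; rewrite /char_ratio; case: eqP => [d0|/eqP d0].
  have n2 := no_common2 d0; split; last by rewrite divfK.
  move: cr; rewrite d0 !mulr0 => /eqP; rewrite mulf_eq0 (negPf n2) /= => /eqP ->.
  by [].
split; first by rewrite divfK.
by rewrite mulrAC [_ * char_fun S1 s2 l]mulrC cr mulfK.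
Qed.

(** The ratio has no poles and is bounded outside the sector by char_two_sided,
    so it is constant; along real k it tends to 1, because both first
    characteristic functions have the same leading term. *)
Lemma char_ratio_one l : char_ratio l = 1.
Proof.
have [e11 o11] := char_half T0 S1 bv1; have [e21 o21] := char_half T0 S2 bv1.
have [e12 _] := char_half T0 S1 bv2; have [e22 _] := char_half T0 S2 bv2.
have [K1 K10 KP1] := char_two_sided iq1 S1; have [K2 K20 KP2] := char_two_sided iq2 S2.
pose K := Num.max K1 K2.
have K0 : 0 < K by rewrite lt_max K10.
have hp := jump_gt0.
have qr : qentire char_ratio.
  move=> z0; have [z00|nz] := eqVneq (char_fun S1 s1 z0) 0.
    exists (char_fun S2 s2), (char_fun S1 s2); split=> //; first exact: no_common2.
    by move=> z; exact: (char_ratioP z).2.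
  by exists (char_fun S2 s1), (char_fun S1 s1); split=> // z; exact: (char_ratioP z).1.
have [a aP] : exists a, char_fun S1 s1 a != 0.
  have [xs xm] := real_point K0.
  exists (- K%:C ^+ 2); apply/eqP => d0.
  have K1x : K1 <= cmod (K%:C : C) by rewrite xm le_max lexx.
  have := KP1 _ xs K1x; rewrite d0 cmod0 mulr0 => /andP[H _].
  have : 0 < h / 2 * expR (Re (K%:C : C) * T) by rewrite mulr_gt0 ?expR_gt0 // divr_gt0.
  lra.
have gb k : cmod k <= 4 * Re k -> K <= cmod k -> cmod (char_ratio (- k ^+ 2)) <= 3.
  move=> ku; rewrite ge_max => /andP[k1 k2].
  have /andP[l1 _] := KP1 k ku k1; have /andP[_ u2] := KP2 k ku k2.
  move: u2; rewrite (char_ratioP _).1 cmodM; set g := cmod (char_ratio _).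
  set d := cmod (char_fun _ _ _) in l1 *; set X := expR _ in l1 * => u2.
  have X0 : 0 < h / 2 * X by rewrite mulr_gt0 ?expR_gt0 // divr_gt0.
  have g0 : 0 <= g by exact: cmod_ge0.
  have b4 := ler_wpM2l g0 l1; rewrite -(ler_pM2r X0); lra.
have const : forall z, char_ratio z = char_ratio 0.
  apply: (quotient_constant (F := char_fun S2 s1) (D := char_fun S1 s1) (a := a) (r := K ^+ 2) (M := 3)) => //.
    by move=> z; exact: (char_ratioP z).1.
  by move=> z rz zs; have [k [-> ku Kk]] := sector_point K0 rz zs; exact: gb.
rewrite const; apply/eqP; rewrite -subr_eq0 -cmod_eq0 eq_le cmod_ge0 andbT.
apply: le_small => e e0.
have e1 : 0 < e * (h / 4) by rewrite mulr_gt0 // divr_gt0.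
have [L1 L10 LP1] := char_leading iq1 S1 e1; have [L2 L20 LP2] := char_leading iq2 S2 e1.
pose x := Num.max K (Num.max L1 L2).
have x0 : 0 < x by rewrite lt_max K0.
have [xs xm] := real_point x0.
have xK1 : K1 <= cmod (x%:C : C) by rewrite xm !le_max lexx.
have xL1 : L1 <= cmod (x%:C : C) by rewrite xm !le_max lexx /= !orbT.
have xL2 : L2 <= cmod (x%:C : C) by rewrite xm !le_max lexx /= !orbT.
have /andP[l1 _] := KP1 _ xs xK1.
have := LP1 _ xs xL1; have := LP2 _ xs xL2.
rewrite (char_ratioP _).1 const.
set g := char_ratio 0; set d := char_fun _ _ _ in l1 *; set X := expR _ in l1 *.
set E := jump0 s1 * _ => b2 b1.
have b3 := le_cmod_dist (2 * x%:C * (g * d)) E (2 * x%:C * d).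
have E3 : cmod (2 * x%:C * (g * d) - 2 * x%:C * d) = cmod (g - 1) * (2 * cmod (x%:C : C) * cmod d).
  have -> : 2 * x%:C * (g * d) - 2 * x%:C * d = (g - 1) * (2 * x%:C * d) by ring.
  by rewrite !cmodM cmod_nat.
rewrite E3 [cmod (E - _)]cmodB in b3.
have g0 := cmod_ge0 (g - 1).
have b4 := ler_wpM2l g0 l1.
have X0 : 0 < h / 2 * X by rewrite mulr_gt0 ?expR_gt0 // divr_gt0.
rewrite -(ler_pM2r X0); lra.
Qed.

Theorem char_fun_eq l : char_fun S2 s1 l = char_fun S1 s1 l /\ char_fun S2 s2 l = char_fun S1 s2 l.
Proof. by have [e1 e2] := char_ratioP l; rewrite {1}e1 {1}e2 char_ratio_one !mul1r. Qed.

End CharacteristicFunction.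

(** * Constancy on an interval and vanishing derivatives *)

Section Flat.
Variables (R : realType) (T : R).
Hypothesis T0 : 0 < T.
Local Notation C := R[i].
Local Notation mu := (@lebesgue_measure R).
Local Notation Re := complex.Re.
Local Notation Im := complex.Im.
Local Notation ac := (ac_with_deriv T).
Implicit Types (f g : R -> C) (u : R -> R) (a b x : R).

(** Lebesgue's differentiation theorem recovers u from its primitive. *)
Lemma primitive_flat u a b c : rintegrable `[0, T] u -> 0 <= a -> b <= T ->
  (forall x, a < x -> x < b -> \int[mu]_(t in `[0, x]) u t = c) ->
  {ae mu, forall x, a < x -> x < b -> u x = 0}.
Proof.
move=> iu a0 bT uc; pose v := u \_ `[0, T].
have lv : locally_integrable [set: R] v by exact: integrable_locally.
have iv (y : R) : mu.-integrable [set` Interval (BLeft 0) (BRight y)] (EFin \o v).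
  have -> : EFin \o v = (EFin \o u) \_ `[0, T] by rewrite /v restrict_EFin.
  apply: (@integrableS _ _ _ _ setT) => //.
  by rewrite -integrable_mkcond.
apply: ae_imp (FTC1 iv lv) => x H ax xb.
have x0 : 0 < x by lra.
have [_] := H x0; rewrite derive1E.
have -> : v x = u x by rewrite /v patchE mem_set //= in_itv /= (ltW x0); apply/andP; split => //; lra.
move=> <-; rewrite (near_eq_derive (g := fun=> c)) ?derive_cst //.
have : \forall y \near x, y \in `]a, b[ by apply: near_in_itvoo; rewrite in_itv /= ax xb.
apply: filterS => y; rewrite in_itv /= => /andP[ay yb].
rewrite -(uc y ay yb); apply: eq_Rintegral => t; rewrite inE /= in_itv /= => /andP[t0 ty].
by rewrite /v patchE mem_set //= in_itv /= t0; lra.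
Qed.

Lemma ac_flat f g a b c : ac f g -> 0 <= a -> b <= T ->
  (forall x, a < x -> x < b -> f x = c) -> {ae mu, forall x, a < x -> x < b -> g x = 0}.
Proof.
move=> [ig fg] a0 bT fc.
have E x : a < x -> x < b -> cintegral `[0, x] g = c - f 0.
  move=> ax xb; rewrite -(fc x ax xb) fg ?in_itv /=; first by ring.
  by apply/andP; split; lra.
have h1 : {ae mu, forall x, a < x -> x < b -> Re (g x) = 0}.
  apply: (@primitive_flat _ a b (Re (c - f 0))) => //; first exact: ig.1.
  by move=> x ax xb; rewrite -(E x ax xb).
have h2 : {ae mu, forall x, a < x -> x < b -> Im (g x) = 0}.
  apply: (@primitive_flat _ a b (Im (c - f 0))) => //; first exact: ig.2.
  by move=> x ax xb; rewrite -(E x ax xb).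
apply: ae_imp (ae_and h1 h2) => x [r i] ax xb.
by apply: complex_eq; [exact: r|exact: i].
Qed.

Lemma ae_dense (P : R -> Prop) a b : {ae mu, forall x, P x} -> a < b ->
  exists x, [/\ a < x, x < b & P x].
Proof.
move=> [A [mA A0 PA]] ab; apply: contrapT => nP.
have sub : `]a, b[%classic `<=` A.
  move=> x /=; rewrite in_itv /= => /andP[ax xb]; apply: PA => /= Px.
  by apply: nP; exists x.
have : (mu `]a, b[ <= mu A)%E by apply: le_measure => //; rewrite inE.
by rewrite A0 lebesgue_measure_itv /= lte_fin ab -EFinB lee_fin leNgt subr_gt0 ab.
Qed.

Lemma rcts_ae_zero u a b : {within `[0, T], continuous u} -> 0 <= a -> b <= T ->
  {ae mu, forall x, a < x -> x < b -> u x = 0} -> forall x, a < x -> x < b -> u x = 0.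
Proof.
move=> cu a0 bT uz x ax xb; apply/eqP/negPn/negP => nz.
have xT : `[0, T]%classic x by rewrite /= in_itv /=; apply/andP; split; lra.
have e0 : 0 < `|u x| by rewrite normr_gt0.
move: cu => /subspace_continuousP/(_ x xT)/cvgrPdist_lt/(_ _ e0).
rewrite near_withinE => /nbhs_ballP[d /= d0 dP].
have xm : x < Num.min b (x + d) by rewrite lt_min xb ltrDl.
have [y [xy]] := ae_dense uz xm; rewrite lt_min => /andP[yb yd] uy.
have ay : a < y by lra.
have := dP y; rewrite /= /ball /= distrC ger0_norm; last by lra.
rewrite /from_subspace (uy ay yb) subr0 ltxx => H.
have : false by apply: H; [lra|rewrite in_itv /=; apply/andP; split; lra].
by [].
Qed.

Lemma ccts_ae_zero f a b : ccts 0 T f -> 0 <= a -> b <= T ->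
  {ae mu, forall x, a < x -> x < b -> f x = 0} -> forall x, a < x -> x < b -> f x = 0.
Proof.
move=> [cr ci] a0 bT fz x ax xb; apply: complex_eq.
  apply: (rcts_ae_zero cr a0 bT _ ax xb); apply: ae_imp fz => y h ay yb.
  by rewrite h.
apply: (rcts_ae_zero ci a0 bT _ ax xb); apply: ae_imp fz => y h ay yb.
by rewrite h.
Qed.

Lemma ac_cts_flat f g a b c : ac f g -> ccts 0 T g -> 0 <= a -> b <= T ->
  (forall x, a < x -> x < b -> f x = c) -> forall x, a < x -> x < b -> g x = 0.
Proof. by move=> fg cg a0 bT fc; apply: ccts_ae_zero => //; exact: (ac_flat fg a0 bT fc). Qed.

End Flat.

(** * The solution vanishing at T *)

Section PsiApprox.
Variables (R : realType) (T : R).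
Hypothesis T0 : 0 < T.
Local Notation C := R[i].
Local Notation mu := (@lebesgue_measure R).
Local Notation Re := complex.Re.
Implicit Types (l k : C).
Variables (q : R -> C) (iq : cintegrable `[0, T] q) (S : fundamental_system T q).
Local Notation Q := (q_norm T q).

Lemma sector_half_plane (k : C) : cmod k <= 4 * Re k -> 0 <= Re k.
Proof. by have := cmod_ge0 k; lra. Qed.

(** A relative error 1/2 in psi_leading. The distance of x from T keeps the two
    waves, which cancel at T, apart. *)
Lemma psi_approx (b : R) : b < T -> exists2 K : R, 0 < K & forall k : C,
  cmod k <= 4 * Re k -> K <= cmod k -> forall x : R, 0 <= x -> x <= b ->
  cmod (2 * k * psi S (- k ^+ 2) x - cexp (k * (T - x)%:C)) <= expR (Re k * (T - x)) / 2.
Proof.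
move=> bT; have Q0 := q_norm_ge0 T q.
have d0 : 0 < T - b by lra.
have p0 : 0 < 6 / (T - b) by rewrite divr_gt0.
exists (16 * Q + 6 / (T - b) + 1) => [|k ku Kk x x0 xb]; first by lra.
have k0 : 0 < cmod k by lra.
have kQ : 2 * Q <= cmod k by lra.
have [yT dyT] := psi_at_T T0 S (- k ^+ 2).
have xT : x \in `[0, T] by rewrite in_itv /= x0; lra.
apply: (le_trans (psi_leading T0 iq (psi_sol S _) (sector_half_plane ku) kQ k0 yT dyT xT)).
rewrite mulrC ler_wpM2l ?expR_ge0 //.
have h1 : Q / cmod k <= 16^-1 by rewrite ler_pdivrMr //; lra.
have h2 : 3 <= 2 * (Re k * (T - x)).
  have : 6 / (T - b) <= cmod k by lra.
  rewrite ler_pdivrMr // => h.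
  have := ler_wpM2r (ltW d0) ku.
  have : Re k * (T - b) <= Re k * (T - x).
    by rewrite ler_wpM2l ?sector_half_plane //; lra.
  lra.
have h3 : expR (- (2 * (Re k * (T - x)))) <= 4^-1.
  rewrite expRN lef_pV2 ?posrE ?expR_gt0 //.
  by have := expR_ge1Dx (2 * (Re k * (T - x))); lra.
lra.
Qed.

Lemma approx_lower (k : C) (z : C) (x : R) :
  cmod (2 * k * z - cexp (k * (T - x)%:C)) <= expR (Re k * (T - x)) / 2 ->
  expR (Re k * (T - x)) <= 4 * cmod k * cmod z.
Proof.
have := cmodDB (cexp (k * (T - x)%:C)) (2 * k * z).
rewrite cmod_cexpR !cmodM cmod_nat [X in _ <= X -> _]cmodB; lra.
Qed.

Lemma sol_vanish_at_T l y dy : slsol T q l y dy -> y T = 0 -> forall t, t \in `[0, T] ->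
  y t = - dy T * psi S l t /\ dy t = - dy T * dpsi S l t.
Proof.
move=> h yT t tT.
have TT : T \in `[0, T] by rewrite in_itv /= lexx ltW.
have [c1 _ _] := fcos_sol S l; have [s1 _ _] := fsin_sol S l.
have W := unit_wronskian T0 S l tT.
have Ws : y t * dfsin S l t - dy t * fsin S l t = - dy T * fsin S l T.
  by rewrite (wronskian T0 h s1 tT) -(wronskian T0 h s1 TT) yT; ring.
have Wc : y t * dfcos S l t - dy t * fcos S l t = - dy T * fcos S l T.
  by rewrite (wronskian T0 h c1 tT) -(wronskian T0 h c1 TT) yT; ring.
split.
  transitivity (y t * (fcos S l t * dfsin S l t - dfcos S l t * fsin S l t)); first by rewrite W mulr1.
  transitivity (fcos S l t * (y t * dfsin S l t - dy t * fsin S l t) -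
    fsin S l t * (y t * dfcos S l t - dy t * fcos S l t)); first by ring.
  by rewrite Ws Wc /psi; ring.
transitivity (dy t * (fcos S l t * dfsin S l t - dfcos S l t * fsin S l t)); first by rewrite W mulr1.
transitivity (dfcos S l t * (y t * dfsin S l t - dy t * fsin S l t) -
    dfsin S l t * (y t * dfcos S l t - dy t * fcos S l t)); first by ring.
by rewrite Ws Wc /dpsi; ring.
Qed.

(** The Wronskians of y with X_1 and X_2 of the other potential have derivative
    (q - q') y w, which vanishes beyond a; their constant values are the
    coefficients of the continued solution. *)
Lemma continuation (q' : R -> C) (a : R) l y dy : cintegrable `[0, T] q' -> 0 <= a -> a <= T ->
  {ae mu, forall x : R, a < x -> x < T -> q x = q' x} -> slsol T q' l y dy ->
  exists z dz, slsol T q l z dz /\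
    forall t, a <= t -> t <= T -> y t = z t /\ dy t = dz t.
Proof.
move=> iq' a0 aT qq [h1 h2].
have [c1 _ _] := fcos_sol S l; have [s1 _ _] := fsin_sol S l.
have Wc w dw : slsol T q l w dw -> forall t, a <= t -> t <= T ->
    y t * dw t - dy t * w t = y T * dw T - dy T * w T.
  move=> [w1 w2] t at_ tT.
  have t0 : 0 <= t by lra.
  have A := acB (acM (ltW T0) h1 w2) (acM (ltW T0) h2 w1).
  have := ac_incr A t0 tT (lexx T).
  set g := fun x : R => _.
  have -> : cintegral `[t, T] g = cintegral `[t, T] (fun=> 0).
    apply: cintegral_ae => //.
    - exact: cintegrable_meas (cint_sub t0 (lexx T) (ac_int A)).
    - apply: ae_imp (ae_and qq (ae_and (ae_neq a) (ae_neq T))) => x [E [xa xT]].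
      rewrite /= in_itv /= => /andP[x1 x2]; rewrite /g E ?lt_neqAle ?xT ?x2 //; first by ring.
      by rewrite eq_sym xa (le_trans at_ x1).
  rewrite /cintegral /= Rintegral_cst // mul0r => /eqP; rewrite subr_eq0 => /eqP -> //.
exists (fun t => (y T * dfsin S l T - dy T * fsin S l T) * fcos S l t +
   - (y T * dfcos S l T - dy T * fcos S l T) * fsin S l t).
exists (fun t => (y T * dfsin S l T - dy T * fsin S l T) * dfcos S l t +
   - (y T * dfcos S l T - dy T * fcos S l T) * dfsin S l t).
split; first exact: slsol_lin.
move=> t at_ tT; rewrite -(Wc _ _ s1 t at_ tT) -(Wc _ _ c1 t at_ tT).
have tI : t \in `[0, T] by rewrite in_itv /= tT andbT (le_trans a0).
have W := unit_wronskian T0 S l tI.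
split.
  transitivity (y t * (fcos S l t * dfsin S l t - dfcos S l t * fsin S l t)); first by rewrite W mulr1.
  ring.
transitivity (dy t * (fcos S l t * dfsin S l t - dfcos S l t * fsin S l t)); first by rewrite W mulr1.
ring.
Qed.

End PsiApprox.

(** * Vanishing of the cross function *)

Section CrossBound.
Variables (R : realType) (T : R).
Hypothesis T0 : 0 < T.
Local Notation C := R[i].
Local Notation mu := (@lebesgue_measure R).
Local Notation Re := complex.Re.
Local Notation Im := complex.Im.
Local Notation ac := (ac_with_deriv T).
Implicit Types (l k : C).
Variable s1 : R -> C.
Hypothesis bv1 : cbounded_variation 0 T s1.
Variables (q1 q2 : R -> C).
Hypotheses (iq1 : cintegrable `[0, T] q1) (iq2 : cintegrable `[0, T] q2).
Variables (S1 : fundamental_system T q1) (S2 : fundamental_system T q2).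

(** Vanishes identically if the potentials agree. *)
Definition cross l x := psi S1 l x * phi S2 s1 l x - psi S2 l x * phi S1 s1 l x.

(** The form of this function of t is the cross function at x; it combines the
    solutions of the two equations that vanish at x so as to vanish at T as
    well. *)
Definition cross_ker x l t := psi S1 l x * ker S2 x l t + - psi S2 l x * ker S1 x l t.
Definition dcross_ker x l t := psi S1 l x * dker S2 x l t + - psi S2 l x * dker S1 x l t.

Lemma cross_ker_ac x l : ac (cross_ker x l) (dcross_ker x l) /\ ccts 0 T (dcross_ker x l).
Proof.
have [h1 c1] := slsol_C1 T0 (ker_sol S1 x l); have [h2 c2] := slsol_C1 T0 (ker_sol S2 x l).
split; first exact (acD (acZ _ h2) (acZ _ h1)).
exact (cctsD (cctsM (ccts_cst _ _ _) c2) (cctsM (ccts_cst _ _ _) c1)).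
Qed.

Lemma cross_form l x : U T s1 (cross_ker x l) = cross l x.
Proof.
have [h1 c1] := slsol_C1 T0 (ker_sol S1 x l); have [h2 c2] := slsol_C1 T0 (ker_sol S2 x l).
rewrite (form_lin T0 _ _ bv1 h2 c2 h1 c1) !ker_form // /cross; ring.
Qed.

Lemma cross_ker_T x l : cross_ker x l T = 0.
Proof. by rewrite /cross_ker /ker /psi; ring. Qed.

Section OneFrequency.
Variables (k : C) (a x : R).
Hypothesis ku : cmod k <= 4 * Re k.
Hypothesis kQ1 : 2 * q_norm T q1 <= cmod k.
Hypothesis kQ2 : 2 * q_norm T q2 <= cmod k.
Hypothesis k0 : 0 < cmod k.
Hypotheses (a0 : 0 < a) (aT : a <= T) (ax : a / 2 <= x) (xa : x <= a).
Local Notation l := (- k ^+ 2).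
Local Notation u := (Re k).
Local Notation E := (expR (Re k * T)).

Let u0 : 0 <= u. Proof. exact: sector_half_plane. Qed.
Let geo : [/\ 0 < a, a <= T, a / 2 <= x & x <= a]. Proof. by []. Qed.
Let xT : x \in `[0, T].
Proof. by rewrite in_itv /=; apply/andP; split; move: a0 aT ax xa; lra. Qed.
Let TT : T \in `[0, T]. Proof. by rewrite in_itv /= lexx ltW. Qed.

Lemma psi_growth q (iq : cintegrable `[0, T] q) (S : fundamental_system T q) t :
  2 * q_norm T q <= cmod k -> t \in `[0, T] ->
  cmod k * cmod (psi S l t) + cmod (dpsi S l t) <= 4 * expR (u * (T - t)).
Proof.
move=> kQ tT; have [yT dyT] := psi_at_T T0 S l.
have := sol_growth T0 iq (psi_sol S l) u0 kQ k0 TT tT.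
rewrite yT dyT cmod0 mulr0 add0r cmodN cmod1 mulr1 distrC ger0_norm //.
by rewrite subr_ge0; move: tT; rewrite in_itv /= => /andP[].
Qed.

Lemma ker_growth q (iq : cintegrable `[0, T] q) (S : fundamental_system T q) t :
  2 * q_norm T q <= cmod k -> t \in `[0, T] ->
  cmod k * cmod (ker S x l t) + cmod (dker S x l t) <= 4 * expR (u * `|t - x|).
Proof.
move=> kQ tT; have [yT dyT] := ker_at T0 S l xT.
have := sol_growth T0 iq (ker_sol S x l) u0 kQ k0 xT tT.
by rewrite yT dyT cmod0 mulr0 add0r cmodN cmod1 mulr1.
Qed.

Lemma cross_ker_growth t : t \in `[0, T] ->
  cmod k * (cmod k * cmod (cross_ker x l t) + cmod (dcross_ker x l t)) <=
  32 * expR (u * (T - x + `|t - x|)).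
Proof.
move=> tT; rewrite [Re k * _]mulrDr expRD mulrDr.
have h1 := psi_growth iq1 S1 kQ1 xT; have h2 := psi_growth iq2 S2 kQ2 xT.
have g1 := ker_growth iq1 S1 kQ1 tT; have g2 := ker_growth iq2 S2 kQ2 tT.
have n1 := cmodD (psi S1 l x * ker S2 x l t) (- psi S2 l x * ker S1 x l t).
have n2 := cmodD (psi S1 l x * dker S2 x l t) (- psi S2 l x * dker S1 x l t).
rewrite !cmodM cmodN in n1 n2; rewrite -/(cross_ker x l t) in n1; rewrite -/(dcross_ker x l t) in n2.
have p1 : cmod k * cmod (psi S1 l x) <= 4 * expR (u * (T - x)).
  by have := cmod_ge0 (dpsi S1 l x); lra.
have p2 : cmod k * cmod (psi S2 l x) <= 4 * expR (u * (T - x)).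
  by have := cmod_ge0 (dpsi S2 l x); lra.
have c1 : 0 <= cmod k * cmod (psi S1 l x) by rewrite mulr_ge0 ?cmod_ge0.
have c2 : 0 <= cmod k * cmod (psi S2 l x) by rewrite mulr_ge0 ?cmod_ge0.
have d1 : 0 <= cmod k * cmod (ker S1 x l t) + cmod (dker S1 x l t).
  by rewrite addr_ge0 ?mulr_ge0 ?cmod_ge0.
have d2 : 0 <= cmod k * cmod (ker S2 x l t) + cmod (dker S2 x l t).
  by rewrite addr_ge0 ?mulr_ge0 ?cmod_ge0.
have m1 := ler_pM c1 d2 p1 g2; have m2 := ler_pM c2 d1 p2 g1.
have w1 := ler_wpM2l (cmod_ge0 k) (ler_wpM2l (cmod_ge0 k) n1).
have w2 := ler_wpM2l (cmod_ge0 k) n2.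
move: m1 m2 w1 w2.
set X := expR (u * (T - x)); set Y := expR (u * `|t - x|).
move: (cmod k) (cmod (cross_ker _ _ _)) (cmod (dcross_ker _ _ _)) (cmod (psi S1 l x)) (cmod (psi S2 l x)).
move: (cmod (ker _ _ _ _)) (cmod (dker _ _ _ _)) (cmod (ker _ _ _ _)) (cmod (dker _ _ _ _)).
by move: X Y => X Y r1 r2 r3 r4 m c d v1 v2; lra.
Qed.

(** Up to x the exponent is u (T - t). From x to a it is u (T - 2 x + t), which
    is at most u (T - (a - t)) because a <= 2 x. *)
Lemma exponent_before t : 0 <= t -> t <= a ->
  expR (u * (T - x + `|t - x|)) <= E * (expR (u * - t) + expR (u * - `|t - a|)).
Proof.
have [g1 g2 g3 g4] := geo.
move=> t0 ta; rewrite [leRHS]mulrDr -!expRD.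
have h1 := expR_gt0 (u * T + u * - t); have h2 := expR_gt0 (u * T + u * - `|t - a|).
have [tx|/ltW xt] := leP t x.
  rewrite distrC (ger0_norm (_ : 0 <= x - t)) ?subr_ge0 //.
  have -> : u * (T - x + (x - t)) = u * T + u * - t by ring.
  by rewrite lerDl ltW.
rewrite (ger0_norm (_ : 0 <= t - x)) ?subr_ge0 //.
have : expR (u * (T - x + (t - x))) <= expR (u * T + u * - `|t - a|).
  rewrite ler_expR -mulrDr ler_wpM2l //.
  by rewrite distrC ger0_norm ?subr_ge0 //; lra.
lra.
Qed.

Lemma dcross_before t : 0 <= t -> t <= a ->
  cmod (dcross_ker x l t) <= 32 * E / cmod k * (expR (u * - t) + expR (u * - `|t - a|)).
Proof.
have [g1 g2 g3 g4] := geo.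
move=> t0 ta; have tT : t \in `[0, T] by rewrite in_itv /= t0; lra.
have h1 := cross_ker_growth tT; have h2 := exponent_before t0 ta.
rewrite mulrAC ler_pdivlMr // mulrC -mulrA.
have := mulr_ge0 (ltW k0) (mulr_ge0 (ltW k0) (cmod_ge0 (cross_ker x l t))).
rewrite mulrDr in h1; lra.
Qed.

Lemma cross_ker_at t : 0 <= t -> t <= a -> expR (u * (T - x + `|t - x|)) <= E ->
  cmod (cross_ker x l t) <= 32 * E / cmod k ^+ 2.
Proof.
have [g1 g2 g3 g4] := geo.
move=> t0 ta hE; have tT : t \in `[0, T] by rewrite in_itv /= t0; lra.
have h1 := cross_ker_growth tT.
rewrite ler_pdivlMr ?exprn_gt0 //.
have := mulr_ge0 (ltW k0) (cmod_ge0 (dcross_ker x l t)).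
rewrite mulrDr in h1; lra.
Qed.

Lemma cross_ker_0 : cmod (cross_ker x l 0) <= 32 * E / cmod k ^+ 2.
Proof.
have [g1 g2 g3 g4] := geo.
apply: cross_ker_at => //; first exact: ltW.
rewrite sub0r normrN ger0_norm; last lra.
by rewrite subrK.
Qed.

Lemma cross_ker_a : cmod (cross_ker x l a) <= 32 * E / cmod k ^+ 2.
Proof.
have [g1 g2 g3 g4] := geo.
apply: cross_ker_at => //; first exact: ltW.
rewrite ger0_norm ?subr_ge0 // ler_expR ler_wpM2l //; lra.
Qed.

(** On [a, T] the kernel solves one equation and vanishes at T, so it is a
    multiple of psi; the factor is found from its size at a, and psi decays from
    a towards T. *)
Lemma dcross_after t : {ae mu, forall x : R, a < x -> x < T -> q1 x = q2 x} ->
  expR (u * (T - a)) <= 4 * cmod k * cmod (psi S1 l a) ->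
  a <= t -> t <= T ->
  cmod (dcross_ker x l t) <= 16 * (32 * E) / cmod k * expR (u * - `|t - a|).
Proof.
have [g1 g2 g3 g4] := geo.
move=> qq la at_ tT.
have tI : t \in `[0, T] by rewrite in_itv /= tT andbT; lra.
have aI : a \in `[0, T] by rewrite in_itv /= aT andbT; lra.
have [z [dz [hz zP]]] := continuation T0 S1 iq2 (ltW a0) aT qq (ker_sol S2 x l).
have hL := slsol_lin (psi S1 l x) (- psi S2 l x) hz (ker_sol S1 x l).
have LT : psi S1 l x * z T + - psi S2 l x * ker S1 x l T = 0.
  by rewrite -(zP T aT (lexx T)).1; exact: cross_ker_T.
have LP := sol_vanish_at_T T0 S1 hL LT.
set kap := - (psi S1 l x * dz T + - psi S2 l x * dker S1 x l T) in LP.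
have La : cross_ker x l a = kap * psi S1 l a.
  by rewrite /cross_ker (zP a (lexx a) aT).1; exact: (LP a aI).1.
have dLt : dcross_ker x l t = kap * dpsi S1 l t.
  by rewrite /dcross_ker (zP t at_ tT).2; exact: (LP t tI).2.
have bA := cross_ker_a; rewrite La cmodM ler_pdivlMr ?exprn_gt0 // in bA.
have g := psi_growth iq1 S1 kQ1 tI.
have g5 : cmod (dpsi S1 l t) <= 4 * expR (u * (T - t)).
  by have := mulr_ge0 (ltW k0) (cmod_ge0 (psi S1 l t)); lra.
rewrite dLt cmodM -(ler_pM2r (expR_gt0 (u * (T - a)))).
rewrite -(ler_pM2r k0).
have -> : 16 * (32 * E) / cmod k * expR (u * - `|t - a|) * expR (u * (T - a)) * cmod k =
   16 * (32 * E) * expR (u * (T - t)).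
  have -> : expR (u * (T - t)) = expR (u * - `|t - a|) * expR (u * (T - a)).
    rewrite -expRD (ger0_norm (_ : 0 <= t - a)) ?subr_ge0 //; congr expR; ring.
  by field; rewrite gt_eqF.
have K0 := cmod_ge0 kap.
have X0 := expR_ge0 (u * (T - t)).
have h1 := ler_pM (cmod_ge0 _) (expR_ge0 _) g5 la.
have h2 := ler_wpM2l (mulr_ge0 (ltW k0) K0) h1.
have h3 := ler_wpM2r X0 bA.
move: h2 h3.
set X := expR (u * (T - t)); set Y := expR (u * (T - a)); set Z := E.
move: (cmod k) (cmod kap) (cmod (dpsi _ _ _)) (cmod (psi _ _ _)) X Y Z => m p d s X Y Z.
lra.
Qed.

End OneFrequency.
Section CrossZero.
Variables (a x : R).
Hypotheses (a0 : 0 < a) (aT : a <= T) (ax : a / 2 <= x) (xa : x <= a).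
Hypothesis qq : {ae mu, forall x : R, a < x -> x < T -> q1 x = q2 x}.

Let geo : [/\ 0 < a, a <= T, a / 2 <= x & x <= a]. Proof. by []. Qed.

Lemma cross_small : exists2 M : R, 0 <= M & exists2 K : R, 0 < K & forall k : C,
  cmod k <= 4 * Re k -> K <= cmod k ->
  cmod (cross (- k ^+ 2) x) <= M * expR (Re k * T) / cmod k ^+ 2.
Proof.
have [g1 g2 g3 g4] := geo.
have [B B0 BP] := form_peak_bound T0 bv1.
have Q1 := q_norm_ge0 T q1; have Q2 := q_norm_ge0 T q2.
have h0 := cmod_ge0 (jump0 s1).
exists (32 * cmod (jump0 s1) + B * (16 * (32 * 16))).
  apply: addr_ge0; first by rewrite mulr_ge0.
  by apply: mulr_ge0 => //; rewrite -!natrM ler0n.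
have [K K0 KP] : exists2 K : R, 0 < K & forall k : C, cmod k <= 4 * Re k -> K <= cmod k ->
    a < T -> expR (Re k * (T - a)) <= 4 * cmod k * cmod (psi S1 (- k ^+ 2) a).
  have [aT'|Ta] := ltP a T; last by exists 1.
  have [K K0 KP] := psi_approx T0 iq1 S1 aT'; exists K => // k ku Kk _.
  by apply: approx_lower; apply: KP => //; exact: ltW.
exists (K + 2 * q_norm T q1 + 2 * q_norm T q2 + 1) => [|k ku Kk]; first lra.
have kK : K <= cmod k by lra.
have kQ1 : 2 * q_norm T q1 <= cmod k by lra.
have kQ2 : 2 * q_norm T q2 <= cmod k by lra.
have k0 : 0 < cmod k by lra.
have u0 : 0 < Re k by lra.
have E0 := expR_gt0 (Re k * T); set E := expR (Re k * T) in E0 *.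
have [hac hc] := cross_ker_ac x (- k ^+ 2).
have aI : a \in `[0, T] by rewrite in_itv /= aT andbT ltW.
have N0 : 0 <= 16 * (32 * E) / cmod k.
  by rewrite divr_ge0 ?mulr_ge0 // ?(ltW E0) // ltW.
have bd t : t \in `[0, T] -> cmod (dcross_ker x (- k ^+ 2) t) <=
    16 * (32 * E) / cmod k * (expR (Re k * - t) + expR (Re k * - `|t - a|)).
  rewrite in_itv /= => /andP[t0 tT].
  have e1 := expR_ge0 (Re k * - t); have e2 := expR_ge0 (Re k * - `|t - a|).
  have [ta|at_] := leP t a.
    have := dcross_before ku kQ1 kQ2 k0 a0 aT ax xa t0 ta; rewrite -/E => H.
    apply: (le_trans H); rewrite ler_wpM2r ?addr_ge0 // ler_wpM2r ?invr_ge0 ?(ltW k0) //; lra.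
  have aT' : a < T by exact: lt_le_trans tT.
  have := dcross_after ku kQ1 kQ2 k0 a0 aT ax xa qq (KP k ku kK aT') (ltW at_) tT.
  rewrite -/E => H; apply: (le_trans H); rewrite ler_wpM2l //; lra.
have := BP _ _ (Re k) a _ hac hc (cross_ker_T _ _) u0 aI N0 bd.
rewrite cross_form => H; apply: (le_trans H).
have L0 := cross_ker_0 ku kQ1 kQ2 k0 a0 aT ax xa; rewrite -/E in L0.
have h1 := ler_wpM2l h0 L0.
have uk : 4 / Re k <= 16 / cmod k by rewrite ler_pdivrMr // mulrAC ler_pdivlMr //; lra.
have h2 := ler_wpM2l (mulr_ge0 B0 N0) uk.
apply: (le_trans (lerD h1 h2)).
rewrite le_eqVlt; apply/orP; left; apply/eqP; field.
by rewrite gt_eqF.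
Qed.

Variable s2 : R -> C.
Hypothesis bv2 : cbounded_variation 0 T s2.
Hypothesis H0 : jump0 s1 != 0.
Hypothesis char1 : forall l, char_fun S2 s1 l = char_fun S1 s1 l.
Hypothesis char2 : forall l, char_fun S2 s2 l = char_fun S1 s2 l.
Hypothesis det_eq : forall l, form_det S2 s1 s2 l = form_det S1 s1 s2 l.
Hypothesis no_common : forall l, char_fun S1 s1 l = 0 -> form_det S1 s1 s2 l != 0.

Definition cross_cofactor l := phi S2 s2 l x * phi S1 s1 l x - phi S1 s2 l x * phi S2 s1 l x.

(** form_det_psi for the two potentials, whose omega and characteristic
    functions agree. *)
Lemma cross_factor l : form_det S1 s1 s2 l * cross l x = char_fun S1 s1 l * cross_cofactor l.
Proof.
have e1 := form_det_psi S1 s1 s2 l x; have e2 := form_det_psi S2 s1 s2 l x.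
rewrite det_eq char1 char2 in e2.
transitivity (form_det S1 s1 s2 l * psi S1 l x * phi S2 s1 l x -
              form_det S1 s1 s2 l * psi S2 l x * phi S1 s1 l x); first by rewrite /cross; ring.
by rewrite e1 e2 /cross_cofactor; ring.
Qed.

(** The cross function divided by Delta_1, continued through the zeros of
    Delta_1 by cross_factor. *)
Definition cross_quotient l := if char_fun S1 s1 l == 0 then cross_cofactor l / form_det S1 s1 s2 l
  else cross l x / char_fun S1 s1 l.

Lemma cross_quotientP l : cross l x = cross_quotient l * char_fun S1 s1 l /\
  cross_cofactor l = cross_quotient l * form_det S1 s1 s2 l.
Proof.
have cf := cross_factor l; rewrite /cross_quotient; case: eqP => [d0|/eqP d0].
  have w0 := no_common d0; split; last by rewrite divfK.
  by move: cf; rewrite d0 mul0r mulr0 => /eqP; rewrite mulf_eq0 (negPf w0) /= => /eqP.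
split; first by rewrite divfK.
by rewrite mulrAC [cross l x * _]mulrC cf [char_fun S1 s1 l * _]mulrC mulfK.
Qed.

(** By cross_small and char_two_sided the quotient is O(1/|k|) outside the
    sector, so it is constant and equal to 0. *)
Lemma cross_zero l : cross l x = 0.
Proof.
have [g1 g2 g3 g4] := geo.
have xT : x \in `[0, T] by rewrite in_itv /=; apply/andP; split; lra.
have [eD oD] := char_half T0 S1 bv1.
have [ew _] := form_det_half S1 bv1 bv2.
have [eF oF] : entire_half (fun l => cross l x).
  exact (entire_halfB (entire_halfM (psi_half T0 S1 xT) (phi_half S2 bv1 xT))
                      (entire_halfM (psi_half T0 S2 xT) (phi_half S1 bv1 xT))).
have [eC _] : entire_half cross_cofactor.
  exact (entire_halfB (entire_halfM (phi_half S2 bv2 xT) (phi_half S1 bv1 xT))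
                      (entire_halfM (phi_half S1 bv2 xT) (phi_half S2 bv1 xT))).
have qG : qentire cross_quotient.
  move=> z0; have [z00|nz] := eqVneq (char_fun S1 s1 z0) 0.
    exists cross_cofactor, (form_det S1 s1 s2); split=> //; first exact: no_common.
    by move=> z; exact: (cross_quotientP z).2.
  by exists (fun l => cross l x), (char_fun S1 s1); split=> // z; exact: (cross_quotientP z).1.
have hp := jump_gt0 H0.
have [K1 K10 KP1] := char_two_sided T0 bv1 H0 iq1 S1.
have [M M0 [K2 K20 KP2]] := cross_small.
have gb k : cmod k <= 4 * Re k -> K1 <= cmod k -> K2 <= cmod k ->
    cmod (cross_quotient (- k ^+ 2)) <= 4 * M / cmod (jump0 s1) / cmod k.
  move=> ku k1 k2; have k0 : 0 < cmod k by exact: lt_le_trans k1.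
  have /andP[l1 _] := KP1 k ku k1; have := KP2 k ku k2.
  rewrite (cross_quotientP _).1 cmodM ler_pdivlMr ?exprn_gt0 //.
  set g := cmod (cross_quotient _); set d := cmod (char_fun _ _ _) in l1 *.
  have X0 := expR_gt0 (Re k * T); set X := expR _ in l1 X0 * => u2.
  have g0 : 0 <= g by exact: cmod_ge0.
  rewrite !ler_pdivlMr // -(ler_pM2r X0).
  have b1 := ler_wpM2l g0 l1; have b2 := ler_wpM2l (ltW k0) b1.
  move: b2 u2; rewrite expr2; move: (cmod k) (cmod (jump0 _)) => m h; lra.
have xm : exists z, char_fun S1 s1 z != 0.
  have [xs xm] := real_point K10; exists (- K1%:C ^+ 2); apply/eqP => d0.
  have K1x : K1 <= cmod (K1%:C : C) by rewrite xm.
  have := KP1 _ xs K1x; rewrite d0 cmod0 mulr0 => /andP[H _].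
  have : 0 < cmod (jump0 s1) / 2 * expR (Re (K1%:C : C) * T) by rewrite mulr_gt0 ?expR_gt0 // divr_gt0.
  lra.
have [z1 z1P] := xm.
pose K := K1 + K2 + 1.
have KK : 0 < K by rewrite /K; lra.
have Mh : 0 <= 4 * M / cmod (jump0 s1) by rewrite divr_ge0 ?mulr_ge0 // ltW.
have const : forall z, cross_quotient z = cross_quotient 0.
  apply: (quotient_constant (F := fun l => cross l x) (D := char_fun S1 s1) (a := z1) (r := K ^+ 2)
    (M := 4 * M / cmod (jump0 s1))) => //.
    by move=> z; exact: (cross_quotientP z).1.
  move=> z rz zs; have [k [-> ku Kk]] := sector_point KK rz zs.
  have k1 : K1 <= cmod k by apply: le_trans Kk; rewrite /K; lra.
  have k2 : K2 <= cmod k by apply: le_trans Kk; rewrite /K; lra.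
  have k3 : 1 <= cmod k by apply: le_trans Kk; rewrite /K; lra.
  apply: (le_trans (gb k ku k1 k2)); rewrite ler_pdivrMr; last by lra.
  by rewrite ler_peMr.
have G0 : cross_quotient 0 = 0.
  apply/eqP; rewrite -cmod_eq0 eq_le cmod_ge0 andbT; apply: le_small => e e0.
  pose y := K + 4 * M / cmod (jump0 s1) / e.
  have ye : 0 <= 4 * M / cmod (jump0 s1) / e by rewrite divr_ge0 // ltW.
  have y0 : 0 < y by rewrite /y; lra.
  have [ys ym] := real_point y0.
  have y1 : K1 <= cmod (y%:C : C) by rewrite ym /y /K; rewrite /K in KK; lra.
  have y2 : K2 <= cmod (y%:C : C) by rewrite ym /y /K; rewrite /K in KK; lra.
  have := gb _ ys y1 y2; rewrite const ym => H; apply: (le_trans H).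
  rewrite ler_pdivrMr // [leRHS]mulrC -ler_pdivrMr //.
  by rewrite /y lerDr ltW.
by rewrite (cross_quotientP l).1 const G0 mul0r.
Qed.

End CrossZero.
End CrossBound.

(** * From the cross function to the potential *)

Section LocalStep.
Variables (R : realType) (T : R).
Hypothesis T0 : 0 < T.
Local Notation C := R[i].
Local Notation mu := (@lebesgue_measure R).
Local Notation Re := complex.Re.
Local Notation Im := complex.Im.
Local Notation ac := (ac_with_deriv T).
Implicit Types (l k : C).

(** Both numbers are closer to w than to - w. *)
Lemma same_sign (z1 z2 w : C) (X : R) : 0 < X -> cmod w = X -> z1 ^+ 2 = z2 ^+ 2 ->
  cmod (z1 - w) <= X / 2 -> cmod (z2 - w) <= X / 2 -> z1 = z2.
Proof.
move=> X0 wX /eqP; rewrite eqf_sqr => /orP[/eqP //|/eqP ->] h1 h2.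
have := cmodD (- z2 - w) (z2 - w).
have -> : - z2 - w + (z2 - w) = - (2 * w) by ring.
by rewrite cmodN cmodM cmod_nat wX => H; exfalso; lra.
Qed.

Section TwoPotentials.
Variable s1 : R -> C.
Hypothesis bv1 : cbounded_variation 0 T s1.
Hypothesis H0 : jump0 s1 != 0.
Variables (q1 q2 : R -> C).
Hypotheses (iq1 : cintegrable `[0, T] q1) (iq2 : cintegrable `[0, T] q2).
Variables (S1 : fundamental_system T q1) (S2 : fundamental_system T q2).
Hypothesis char1 : forall l, char_fun S2 s1 l = char_fun S1 s1 l.

(** One large real k is enough. The derivative of the vanishing cross function,
    combined with the Wronskian of phi and psi, gives equal squares of the two
    psi; same_sign gives psi itself, and the equations then differ by (q1 - q2)
    psi with psi nonzero. *)
Lemma potential_eq_of_cross (a b : R) : 0 <= a -> b < T ->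
  (forall l x, a < x -> x < b -> cross s1 S1 S2 l x = 0) ->
  {ae mu, forall x : R, a < x -> x < b -> q1 x = q2 x}.
Proof.
move=> a0 bT cz; have bT' := ltW bT.
have [K1 K10 KP1] := psi_approx T0 iq1 S1 bT; have [K2 K20 KP2] := psi_approx T0 iq2 S2 bT.
have [K3 K30 KP3] := char_two_sided T0 bv1 H0 iq1 S1.
pose y := K1 + K2 + K3.
have y0 : 0 < y by rewrite /y; lra.
have [ys ym] := real_point y0.
set k : C := y%:C in ys ym.
have k1 : K1 <= cmod k by rewrite ym /y; lra.
have k2 : K2 <= cmod k by rewrite ym /y; lra.
have k3 : K3 <= cmod k by rewrite ym /y; lra.
have k0 : 0 < cmod k by rewrite ym.
pose l := - k ^+ 2.
have D0 : char_fun S1 s1 l != 0.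
  apply/eqP => d0; have /andP[H _] := KP3 k ys k3; move: H; rewrite -/l d0 cmod0 mulr0.
  have : 0 < cmod (jump0 s1) / 2 * expR (Re k * T).
    by rewrite mulr_gt0 ?expR_gt0 // divr_gt0 // jump_gt0.
  lra.
have xI (x : R) : a < x -> x < b -> x \in `[0, T].
  by move=> ax xb; rewrite in_itv /=; apply/andP; split; lra.
have [p1 dp1] := psi_sol S1 l; have [p2 dp2] := psi_sol S2 l.
have [f1 df1] := phi_sol S1 s1 l; have [f2 df2] := phi_sol S2 s1 l.
have T00 := ltW T0.
have c0 := (ac_cts T00 p1, ac_cts T00 p2, ac_cts T00 f1, ac_cts T00 f2).
have c1 := (ac_cts T00 dp1, ac_cts T00 dp2, ac_cts T00 df1, ac_cts T00 df2).
have A := acB (acM T00 p1 f2) (acM T00 p2 f1).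
pose g x := dpsi S1 l x * phi S2 s1 l x + psi S1 l x * dphi S2 s1 l x -
  (dpsi S2 l x * phi S1 s1 l x + psi S2 l x * dphi S1 s1 l x).
have cB (u v : R -> C) : ccts 0 T u -> ccts 0 T v -> ccts 0 T (fun x => u x - v x).
  move=> cu cv; have := cctsD cu (cctsM (ccts_cst 0 T (-1)) cv).
  by congr ccts; apply/funext => x; rewrite mulN1r.
have cg : ccts 0 T g.
  exact (cB _ _ (cctsD (cctsM c1.1.1.1 c0.2) (cctsM c0.1.1.1 c1.2))
                (cctsD (cctsM c1.1.1.2 c0.1.2) (cctsM c0.1.1.2 c1.1.2))).
have gz := ac_cts_flat A cg a0 bT' (fun x ax xb => cz l x ax xb).
have sq x : a < x -> x < b -> psi S1 l x ^+ 2 = psi S2 l x ^+ 2.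
  move=> ax xb; have W1 := phi_psi_wronskian T0 S1 s1 l (xI x ax xb).
  have W2 := phi_psi_wronskian T0 S2 s1 l (xI x ax xb).
  rewrite char1 in W2; have G := gz x ax xb; have Z := cz l x ax xb.
  rewrite /g in G; rewrite /cross in Z.
  set d := char_fun S1 s1 l in W1 W2 D0.
  move: (psi S1 l x) (psi S2 l x) (dpsi S1 l x) (dpsi S2 l x) (phi S1 s1 l x) (phi S2 s1 l x)
    (dphi S1 s1 l x) (dphi S2 s1 l x) W1 W2 G Z => P1 P2 d1 d2 F1 F2 e1 e2 W1 W2 G Z.
  apply: (mulfI D0); apply/eqP; rewrite -subr_eq0; apply/eqP.
  have -> : d * P1 ^+ 2 - d * P2 ^+ 2 = - d * P2 ^+ 2 - (- d) * P1 ^+ 2 by ring.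
  rewrite -{1}W1 -W2.
  transitivity ((P1 * P2) * (d1 * F2 + P1 * e2 - (d2 * F1 + P2 * e1)) -
     (d1 * P2 + P1 * d2) * (P1 * F2 - P2 * F1)); first by ring.
  by rewrite G Z !mulr0 subrr.
have peq x : a < x -> x < b -> psi S1 l x = psi S2 l x.
  move=> ax xb; have x0 : 0 <= x by lra.
  have kn : 2 * k != 0 by rewrite -cmod_eq0 cmodM cmod_nat mulf_neq0 ?gt_eqF.
  apply: (mulfI kn); apply: (same_sign (expR_gt0 (Re k * (T - x))) (cmod_cexpR k (T - x))).
  - by rewrite !exprMn sq.
  - exact: (KP1 k ys k1 x x0 (ltW xb)).
  - exact: (KP2 k ys k2 x x0 (ltW xb)).
have B := acB p1 p2.
have dpeq := ac_cts_flat B (cB _ _ c1.1.1.1 c1.1.1.2) a0 bT' (c := 0).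
have dz : forall x : R, a < x -> x < b -> dpsi S1 l x - dpsi S2 l x = 0.
  by apply: dpeq => x ax xb; rewrite (peq x ax xb) subrr.
have := ac_flat (acB dp1 dp2) a0 bT' dz.
apply: ae_imp => x H ax xb; have := H ax xb; rewrite -(peq x ax xb) => E.
have nz : psi S1 l x != 0.
  apply/eqP => z; have x0 : 0 <= x by lra.
  have := approx_lower (KP1 k ys k1 x x0 (ltW xb)); rewrite -/l z cmod0 mulr0.
  by rewrite leNgt expR_gt0.
apply: (mulIf nz); apply/eqP; rewrite -subr_eq0; apply/eqP; rewrite -[RHS]E; ring.
Qed.

Variable s2 : R -> C.
Hypothesis bv2 : cbounded_variation 0 T s2.
Hypothesis char2 : forall l, char_fun S2 s2 l = char_fun S1 s2 l.
Hypothesis det_eq : forall l, form_det S2 s1 s2 l = form_det S1 s1 s2 l.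
Hypothesis no_common : forall l, char_fun S1 s1 l = 0 -> form_det S1 s1 s2 l != 0.

(** The intervals (a/2, a - 2^-n) keep away from T, as psi_approx requires, and
    exhaust (a/2, a). *)
Lemma halving_step (a : R) : 0 < a -> a <= T ->
  {ae mu, forall x : R, a < x -> x < T -> q1 x = q2 x} ->
  {ae mu, forall x : R, a / 2 < x -> x < T -> q1 x = q2 x}.
Proof.
move=> a0 aT qq.
have loc (b : R) : b < a -> {ae mu, forall x : R, a / 2 < x -> x < b -> q1 x = q2 x}.
  move=> ba; apply: potential_eq_of_cross; first lra.
    by apply: lt_le_trans aT.
  move=> l x ax xb.
  have xa : x <= a by lra.
  exact: (cross_zero T0 bv1 iq1 iq2 a0 aT (ltW ax) xa qq bv2 H0 char1 char2 det_eq no_common).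
have all : {ae mu, forall x (n : nat), a / 2 < x -> x < a - 2^-1 ^+ n -> q1 x = q2 x}.
  by apply: ae_foralln => n; apply: loc; rewrite gtrBl exprn_gt0 // invr_gt0.
apply: ae_imp (ae_and qq (ae_and all (ae_neq a))) => x [H1 [H2 xa]] ax xT.
have [lt|gt|E] := ltgtP x a; [|exact: H1|by rewrite E eqxx in xa].
have d0 : 0 < a - x by rewrite subr_gt0.
have [n nP] := half_pow_small d0; apply: (H2 n) => //; move: nP; set p := _ ^+ n; lra.
Qed.

Lemma potentials_eq : {ae mu, forall x : R, x \in `]0, T[ -> q1 x = q2 x}.
Proof.
have step n : {ae mu, forall x : R, T * 2^-1 ^+ n < x -> x < T -> q1 x = q2 x}.
  elim: n => [|n IH].
    by apply: ae_imp (ae_neq 0) => x _; rewrite expr0 mulr1 => Tx xT; move: (lt_trans Tx xT); rewrite ltxx.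
  have p0 : 0 < 2^-1 ^+ n :> R by rewrite exprn_gt0 // invr_gt0.
  have p1 : 2^-1 ^+ n <= 1 :> R by rewrite exprn_ile1 // ?invr_ge0 // invf_le1 // ler1n.
  have -> : T * 2^-1 ^+ n.+1 = T * 2^-1 ^+ n / 2 by rewrite exprSr mulrA.
  by apply: halving_step => //; [rewrite mulr_gt0|rewrite ler_piMr // ltW].
apply: ae_imp (ae_foralln step) => x H; rewrite in_itv /= => /andP[x0 xT].
have [n nP] := half_pow_small (divr_gt0 x0 T0).
by apply: (H n) => //; rewrite mulrC -ltr_pdivlMr.
Qed.

End TwoPotentials.
End LocalStep.

Theorem theorem1 (R : realType) (T : R) (q qt s1 s2 : R -> R[i])
  (T_gt0 : 0 < T)
  (q_L1 : cintegrable `]0, T[ q) (qt_L1 : cintegrable `]0, T[ qt)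
  (s1_adm : admissible T s1) (s2_adm : admissible T s2)
  (H1_neq0 : jump0 s1 <> 0)
  (omega_neq0 : exists l : R[i], omega T s1 s2 q l <> 0)
  (omegat_neq0 : exists l : R[i], omega T s1 s2 qt l <> 0)
  (Lambda1_Xi : Lambda1 T s1 q `&` Xi T s1 s2 q = set0)
  (eqM : eq_weylM T s1 s2 q qt)
  (eq_omega : forall l : R[i], omega T s1 s2 q l = omega T s1 s2 qt l) :
  {ae @lebesgue_measure R, forall x : R, x \in `]0, T[ -> q x = qt x}.
Proof.
have [bv1 _] := s1_adm; have [bv2 _] := s2_adm.
have H0 : jump0 s1 != 0 by apply/eqP.
have iq1 := trunc_integrable q_L1; have iq2 := trunc_integrable qt_L1.
have [S1 _] := fundamental_system_exists T_gt0 iq1.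
have [S2 _] := fundamental_system_exists T_gt0 iq2.
have no_common l : char_fun S1 s1 l = 0 -> form_det S1 s1 s2 l != 0.
  move=> d0; apply/eqP => w0.
  have : (Lambda1 T s1 q `&` Xi T s1 s2 q) l.
    split; rewrite /Lambda1 /Xi /=.
      by rewrite (Delta1_link T_gt0 q_L1 S1 l bv1).
    by rewrite (omega_link T_gt0 q_L1 S1 l bv1 bv2).
  by rewrite Lambda1_Xi.
have det_eq l : form_det S2 s1 s2 l = form_det S1 s1 s2 l.
  by rewrite -(omega_link T_gt0 q_L1 S1 l bv1 bv2) -(omega_link T_gt0 qt_L1 S2 l bv1 bv2) eq_omega.
have ratio l : char_fun S1 s1 l != 0 -> char_fun S2 s1 l != 0 ->
    char_fun S1 s2 l * char_fun S2 s1 l = char_fun S2 s2 l * char_fun S1 s1 l.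
  move=> d1 d2.
  have E : weylM T s1 s2 q l = weylM T s1 s2 qt l.
    apply: eqM; rewrite /Lambda1 /= => /eqP.
      by rewrite (Delta1_link T_gt0 q_L1 S1 l bv1) (negPf d1).
    by rewrite (Delta1_link T_gt0 qt_L1 S2 l bv1) (negPf d2).
  rewrite -(weylM_link T_gt0 q_L1 bv1 bv2 d1) -(weylM_link T_gt0 qt_L1 bv1 bv2 d2) E.
  by rewrite mulrAC.
have no2 l : char_fun S1 s1 l = 0 -> char_fun S1 s2 l != 0.
  by move=> d0; apply: (no_common_zero T_gt0 (no_common l d0) d0).
have ch := char_fun_eq T_gt0 bv1 H0 iq1 iq2 bv2 ratio no2.
have := potentials_eq T_gt0 bv1 H0 iq1 iq2 (fun l => (ch l).1) bv2 (fun l => (ch l).2) det_eq no_common.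
by apply: ae_imp => x H xT; have := H xT; rewrite /trunc xT.
Qed.
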